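(* Provided $h$ is sufficiently small, the problem: find $u_h\in W_h$ such that $$a_h(u_h,v)=F_h(v)\quad\forall v\in V_h,$$ where $$a_h(w,v):=\int_{\Omega_h}\big[\nu\,\mathbf{grad}\,w\cdot\mathbf{grad}\,v+(\mathbf b\cdot\mathbf{grad}\,w)\,v\big],\qquad F_h(v):=\int_{\Omega_h}f\,v,$$ has a unique solution. Moreover there exists a constant $\alpha>0$ independent of $h$ such that $$\forall w\in W_h,\ w\neq 0:\qquad \sup_{v\in V_h\setminus\{0\}}\frac{a_h(w,v)}{\|\mathbf{grad}\,w\|_{0,h}\,\|\mathbf{grad}\,v\|_{0,h}}\ \ge\ \alpha .$$
   Context: Domain and data. $k\ge 2$ is a fixed integer. $\Omega\subset\mathbb{R}^2$ is a bounded domain with boundary $\Gamma$, sufficiently smooth and at least of class $C^{k-1}$ (if $k=2$ the curvature of $\Gamma$ is moreover uniquely defined almost everywhere). $\nu>0$ is a constant, $\mathbf b$ is a given continuous, sufficiently smooth (at least $C^{k-1}$), solenoidal ($\mathrm{div}\,\mathbf b\equiv 0$) vector field on $\mathbb{R}^2$. $f$ is a given function on $\Omega$ ($f\in H^{k-1}(\Omega)$), extended in some way to a function in $L^2(\Omega\cup\Omega_h)$, still denoted $f$. Meshes. $\mathcal T_h$ ranges over a regular (shape-regular, not necessarily quasi-uniform) family of meshes made of closed straight-edged triangles satisfying the usual compatibility (conformity) conditions; the vertices of the polygon $\cup_{T\in\mathcal T_h}T$ lie on $\Gamma$. $\Omega_h$ is the interior of this polygon and $\Gamma_h$ its boundary.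 $h_T$ is the diameter of $T$ and $h=\max_T h_T$. Every triangle has at most one edge contained in $\Gamma_h$; $\mathcal S_h$ is the set of triangles $T$ having one edge $e_T$ on $\Gamma_h$, and for $T\in\mathcal S_h$, $O_T$ is the vertex of $T$ not on $\Gamma$, $T^\Gamma$ is the curved triangle delimited by $\Gamma$ and the two edges of $T$ meeting at $O_T$, and $\Delta_T$ is the closed set delimited by $\Gamma$ and $e_T$. Points separating convex and concave portions of $\Gamma$ are vertices of $\Omega_h$. Meshes are assumed fine enough that, for every $T\in\mathcal S_h$: (Assumption$^+$) for some (possibly small) $\rho<1$, every straight line joining a point of the homothetic image of $T$ with center $O_T$ and ratio $\rho$ to a point $M\in e_T$ has a uniquely defined intersection with $\Gamma$ belonging to $T^\Gamma$; (Assumption$^*$) $Q_T$ being the closest intersection with $\Gamma$ of the perpendicular to $e_T$ through its mid-point, there is a ball $B(Q_T,r_T)$ containing $e_T$ and an orthogonal frame with $x_T$-axis aligned with $e_T$ in which the part of $\Gamma$ in the ball is the graph $y_T=f_T(x_T)$ of a function of piecewise $C^2$-class. ''$h$ sufficiently small'' means: there is $h_0>0$ such that the statement holds for all meshes of the family with $h\le h_0$. Spaces. The lattice points of a triangle $T$ are the $(k+2)(k+1)/2$ points resulting from its subdivision into $k^2$ equal triangles. $V_h$ is the space of continuous functions on $\overline{\Omega_h}$ vanishing on $\Gamma_h$ whose restriction to each $T\in\mathcal T_h$ is a polynomial of degree $\le k$ (extended by zero to $\Omega\setminus\Omega_h$). $W_h$ is the space of functions $w$ on $\Omega_h$ such that: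 (1) $w|_T$ is a polynomial of degree $\le k$ for each $T\in\mathcal T_h$; (2) $w$ is continuous in $\Omega_h$ and vanishes at the vertices of $\Gamma_h$; (3) $w$ is extended to $\Omega\setminus\Omega_h$ by letting its polynomial expression in $T\in\mathcal S_h$ also apply in $\Delta_T$; (4) for all $T\in\mathcal S_h$, $w(P)=0$ at each of the $k-1$ points $P\in\Gamma$ that are the nearest intersections with $\Gamma$ of the lines through $O_T$ and the $k-1$ points $M$ (different from vertices) subdividing $e_T$ into $k$ segments of equal length. $\|\cdot\|_{0,h}$ is the norm of $L^2(\Omega_h)$. *)

(* Defs.v *)
From mathcomp Require Import all_boot all_order all_algebra.
From mathcomp Require Import all_classical all_reals all_analysis.
Import Order.TTheory GRing.Theory Num.Theory numFieldNormedType.Exports.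

Set Implicit Arguments.
Unset Strict Implicit.
Unset Printing Implicit Defensive.

Local Open Scope classical_set_scope.
Local Open Scope ring_scope.

(* Points of the plane are elements of R * R.  Its library norm is the max
   norm, so Euclidean distances, discs and rotations are defined by hand. *)
Section Plane.
Variable R : realType.
Implicit Types (a b c t x y : R * R) (A G : set (R * R)).

Definition edist x y : R := Num.sqrt ((x.1 - y.1) ^+ 2 + (x.2 - y.2) ^+ 2).

Definition disc c (r : R) : set (R * R) := [set x | edist c x < r].

Definition diam A : R := sup [set edist p.1 p.2 | p in A `*` A].

Definition indiam A : R :=
  sup [set d | exists c, exists2 r, disc c r `<=` A & 0 < r /\ d = 2 * r].

Definition pt_on a b (s : R) : R * R := a + s *: (b - a).

Definition segm a b : set (R * R) := [set pt_on a b s | s in `[0, 1]].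

Definition line a b : set (R * R) := range (pt_on a b).

Definition bdry A : set (R * R) := closure A `\` interior A.

Definition rot90 t : R * R := (- t.2, t.1).

(* The point of coordinates (s, u) in the orthogonal frame with origin o and
   axes directed by t and rot90 t. *)
Definition frame o t (s u : R) : R * R := o + s *: t + u *: rot90 t.

(* P is an intersection of L with G nearest to M. *)
Definition nearest_on G (L : set (R * R)) (M P : R * R) : Prop :=
  (G `&` L) P /\ forall Q, (G `&` L) Q -> edist M P <= edist M Q.

Definition area :
    {measure set (measurableTypeR R * measurableTypeR R) -> \bar R} :=
  (@lebesgue_measure R \x @lebesgue_measure R)%E.

End Plane.

Section Regularity.
Variable R : realType.

Definition Cn1 (n : nat) (g : R -> R) : Prop :=
  (forall j, (j < n)%N -> forall x, derivable (derive1n j g) x 1) /\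
  continuous (derive1n n g).

Definition piecewise_C2 (g : R -> R) : Prop :=
  exists s : seq R, forall a b, a < b ->
    (forall c, c \in s -> ~~ (a < c < b)) ->
    exists2 g2, Cn1 2 g2 & forall x, a <= x <= b -> g x = g2 x.

Definition dx (g : R * R -> R) : R * R -> R := 'D_((1, 0) : R * R) g.
Definition dy (g : R * R -> R) : R * R -> R := 'D_((0, 1) : R * R) g.

Fixpoint Cn (n : nat) (g : R * R -> R) : Prop :=
  continuous g /\
  if n is m.+1 then
    (forall x, derivable g x (1, 0) /\ derivable g x (0, 1)) /\
    Cn m (dx g) /\ Cn m (dy g)
  else True.

Definition L2 (A : set (R * R)) (g : R * R -> R) : Prop :=
  measurable_fun A g /\ (@area R).-integrable A (fun x => (g x ^+ 2)%:E).

Definition test_function (A : set (R * R)) (phi : R * R -> R) : Prop :=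
  (forall n, Cn n phi) /\
  exists2 K, compact K /\ K `<=` A & forall x, ~ K x -> phi x = 0.

Definition sobolev (m : nat) (A : set (R * R)) (g : R * R -> R) : Prop :=
  L2 A g /\
  forall i j, (i + j <= m)%N -> exists2 d, L2 A d &
    forall phi, test_function A phi ->
      \int[@area R]_(x in A) (g x * iter i dx (iter j dy phi) x) =
      (-1) ^+ (i + j) * \int[@area R]_(x in A) (d x * phi x).

Definition solenoidal (b : R * R -> R * R) : Prop :=
  forall x, dx (fst \o b) x + dy (snd \o b) x = 0.

(* Near each boundary point, Omega is the strict epigraph of a C^{k-1} function
   in some orthonormal frame.  The curvature phi'' / (1 + phi'^2)^(3/2) is
   defined exactly where phi' is derivable. *)
Definition smooth_boundary (k : nat) (Omega : set (R * R)) : Prop :=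
  forall p, bdry Omega p -> exists t (r : R) (phi : R -> R),
    [/\ edist 0 t = 1, 0 < r, Cn1 k.-1 phi,
        (k = 2)%N ->
          {ae @lebesgue_measure R, forall s, derivable (derive1 phi) s 1} &
        forall s u, disc p r (frame p t s u) ->
          Omega (frame p t s u) <-> phi s < u].

Definition domain (Omega : set (R * R)) : Prop :=
  [/\ open Omega, connected Omega, Omega !=set0 & bounded_set Omega].

(* Gamma = bdry Omega is neither locally convex nor locally concave at p. *)
Definition separates_convexity (Omega : set (R * R)) (p : R * R) : Prop :=
  bdry Omega p /\ forall r, 0 < r ->
    ~ convex_set (disc p r `&` Omega) /\ ~ convex_set (disc p r `\` Omega).

Definition poly_le (k : nat) (q : R * R -> R) : Prop :=
  exists c : nat -> nat -> R, forall x,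
    q x = \sum_(i < k.+1) \sum_(j < k.+1 - i) c i j * x.1 ^+ i * x.2 ^+ j.

End Regularity.

(* A mesh lists the vertices of its triangles.  The vertices of a triangle are
   indexed by 'I_3, where ordS and ord_pred move cyclically. *)
Record mesh (R : realType) :=
  Mesh { ntri : nat; vtx : 'I_ntri -> 'I_3 -> R * R }.

Section Meshes.
Variable R : realType.
Implicit Types (M : mesh R) (Omega : set (R * R)).

Definition tri M (i : 'I_(ntri M)) : set (R * R) :=
  [set x | exists l : 'I_3 -> R, [/\ forall j, 0 <= l j, \sum_j l j = 1 &
                                     x = \sum_j l j *: vtx i j]].

(* The edge of the i-th triangle opposite to its j-th vertex, and its ends. *)
Definition endA M (i : 'I_(ntri M)) (j : 'I_3) : R * R := vtx i (ordS j).
Definition endB M (i : 'I_(ntri M)) (j : 'I_3) : R * R := vtx i (ord_pred j).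
Definition edge M (i : 'I_(ntri M)) (j : 'I_3) : set (R * R) :=
  segm (endA i j) (endB i j).

Definition meshsize M : R := \big[Num.max/0]_(i < ntri M) diam (tri i).

Definition Omegah M : set (R * R) :=
  interior [set x | exists i : 'I_(ntri M), tri i x].

Definition Gammah M : set (R * R) := bdry (Omegah M).

(* The i-th triangle T is in S_h, with e_T = edge i j and O_T = vtx i j. *)
Definition in_Sh M (i : 'I_(ntri M)) (j : 'I_3) : Prop := edge i j `<=` Gammah M.

Definition conforming M : Prop :=
  (forall i : 'I_(ntri M), interior (tri i) !=set0) /\
  forall i i' : 'I_(ntri M), i != i' ->
    [\/ tri i `&` tri i' = set0,
        exists j j', vtx i j = vtx i' j' /\ tri i `&` tri i' = [set vtx i j] |
        exists j j', edge i j = edge i' j' /\ tri i `&` tri i' = edge i j].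

(* T^Gamma: the points of the angular sector at O_T spanned by e_T that are not
   hidden from O_T by Gamma. *)
Definition curved_tri Omega M (i : 'I_(ntri M)) (j : 'I_3) : set (R * R) :=
  [set x | (exists N (s : R), [/\ edge i j N, 0 <= s & x = pt_on (vtx i j) N s])
           /\ forall s, 0 <= s < 1 -> ~ bdry Omega (pt_on (vtx i j) x s)].

Definition assumption_plus Omega M : Prop :=
  forall (i : 'I_(ntri M)) j, in_Sh i j -> exists2 rho : R, 0 < rho < 1 &
    forall Y N, tri i Y -> edge i j N ->
      exists! P, [/\ line (pt_on (vtx i j) Y rho) N P, bdry Omega P &
                     curved_tri Omega i j P].

Definition assumption_star Omega M : Prop :=
  forall (i : 'I_(ntri M)) j, in_Sh i j ->
    let A := endA i j in let B := endB i j in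
    let mid := pt_on A B 2^-1 in
    let t := (edist A B)^-1 *: (B - A) in
    exists Q (r : R) (fT : R -> R),
      [/\ nearest_on (bdry Omega) (line mid (mid + rot90 t)) mid Q,
          edge i j `<=` disc Q r, piecewise_C2 fT &
          forall s u, disc Q r (frame A t s u) ->
            bdry Omega (frame A t s u) <-> u = fT s].

Definition admissible Omega M : Prop :=
  [/\ conforming M,
      forall (i : 'I_(ntri M)) j, Gammah M (vtx i j) -> bdry Omega (vtx i j),
      forall (i : 'I_(ntri M)) j j', in_Sh i j -> in_Sh i j' -> j = j',
      forall (i : 'I_(ntri M)) j, in_Sh i j -> ~ bdry Omega (vtx i j) &
      forall p, separates_convexity Omega p ->
        exists (i : 'I_(ntri M)) j, vtx i j = p /\ Gammah M p]
  /\ assumption_plus Omega M /\ assumption_star Omega M.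

Definition regular_family (Th : set (mesh R)) : Prop :=
  exists sigma : R, forall M, Th M -> forall i : 'I_(ntri M),
    diam (tri i) <= sigma * indiam (tri i).

Definition Vh (k : nat) Omega M : set (R * R -> R) :=
  [set v | [/\ {within closure (Omegah M), continuous v},
               forall x, Gammah M x -> v x = 0,
               forall i : 'I_(ntri M),
                 exists2 q, poly_le k q & (forall x, tri i x -> v x = q x) &
               forall x, (Omega `\` Omegah M) x -> v x = 0]].

(* The polynomial expression of w in the i-th triangle T.  As a function on the
   whole plane it also gives the values of w on the set Delta_T delimited by
   Gamma and e_T, i.e. the extension of w outside Omega_h. *)
Definition poly_expr (k : nat) M (w : R * R -> R) (i : 'I_(ntri M)) :
    R * R -> R :=
  get [set q | poly_le k q /\ (forall x, tri i x -> w x = q x)].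

(* Trial functions: zero at nodes of Gamma, not on all of e_T.
   The node P associated with the m-th subdivision point of e_T lies in T or in
   Delta_T, so that w(P) is the value of the polynomial expression of w in T. *)
Definition Wh (k : nat) Omega M : set (R * R -> R) :=
  [set w | [/\ forall i : 'I_(ntri M),
                 exists2 q, poly_le k q & (forall x, tri i x -> w x = q x),
               {within Omegah M, continuous w},
               forall (i : 'I_(ntri M)) j, Gammah M (vtx i j) -> w (vtx i j) = 0 &
               forall (i : 'I_(ntri M)) j (m : nat) P, in_Sh i j -> (0 < m < k)%N ->
                 let N := pt_on (endA i j) (endB i j) (m%:R / k%:R) in
                 nearest_on (bdry Omega) (line (vtx i j) N) N P ->
                 poly_expr k w i P = 0]].

Definition ah (nu : R) (b : R * R -> R * R) M (w v : R * R -> R) : R :=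
  \int[@area R]_(x in Omegah M)
    (nu * (dx w x * dx v x + dy w x * dy v x)
     + ((b x).1 * dx w x + (b x).2 * dy w x) * v x).

Definition Fh (f : R * R -> R) M (v : R * R -> R) : R :=
  \int[@area R]_(x in Omegah M) (f x * v x).

Definition grad_norm M (w : R * R -> R) : R :=
  Num.sqrt (\int[@area R]_(x in Omegah M) (dx w x ^+ 2 + dy w x ^+ 2)).

(* Elements of Vh and Wh count as functions on Omega_h. *)
Definition nonzero M (w : R * R -> R) : Prop :=
  exists2 x, Omegah M x & w x != 0.

Definition discrete_solution (k : nat) Omega (nu : R) b f M (u : R * R -> R) :
    Prop :=
  Wh k Omega M u /\ forall v, Vh k Omega M v -> ah nu b M u v = Fh f M v.

End Meshes.

(* Main.v *)
Require Import Defs.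
From mathcomp Require Import all_boot all_order all_algebra.
From mathcomp Require Import all_classical all_reals all_analysis.
From mathcomp Require Import measurable_realfun qpoly zify ring lra.
Import Order.TTheory GRing.Theory Num.Theory numFieldNormedType.Exports.
Import HBNNSimple.

Set Implicit Arguments.
Unset Strict Implicit.
Unset Printing Implicit Defensive.

Local Open Scope classical_set_scope.
Local Open Scope ring_scope.

(** The two assertions both come from comparing a trial function w with the
   test function v = to_test w obtained from it by subtracting, in every
   triangle T with an edge e_T on the boundary of the polygon, the sum over the
   interior nodes N of e_T of w(N) times the Lagrange bubble of N.  A bubble has
   degree k, vanishes on the two other edges of T and at the other nodes of e_T,
   so v is continuous and its restriction to e_T, a polynomial of degree k with
   k + 1 zeros, is zero.

   The correction w - v is small.  By definition w, continued as a polynomial,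
   vanishes at the point P of Gamma on the ray from O_T through N.  If N - P is
   at most s times N - O_T, then w(N) = w(N) - w(P) is at most s times a bound
   of the gradient of w near T, and all norms of polynomials of degree k on T
   being equivalent, with constants that only depend on k and on the shape of T,
   the energy of w - v on T is at most C s^2 times that of w (local_estimate,
   to_test_energy).  As Gamma is C^1 and the rays are transversal to e_T by
   shape regularity, s tends to zero uniformly with the mesh size: near a
   boundary point Gamma is a graph over its tangent, with a slope which varies
   little, and compactness of Gamma makes this uniform (boundary_nodes,
   mesh_nodes).

   For the form, a_h(w, v) = a_h(v, v) + a_h(w - v, v).  The convection term of
   a_h(v, v) is an integral of div (b v^2) / 2, hence zero (convection_skew);
   Poincare's inequality with a constant given by the size of Omega bounds
   the second term.  So a_h(w, v) >= nu / 2 |grad w| |grad v| once the energy of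
   w - v is small relative to that of w (infsup_of_close).  This is the inf-sup
   bound with alpha = nu / 2, provided that |grad w| only vanishes for w = 0:
   in that case w(N) = 0 at all nodes, so w = v is a test function, and
   Poincare's inequality applies (trial_definite).

   For existence, V_h has finite dimension (pwp_dependent) and w |-> to_test w
   maps W_h onto V_h: prescribing the values of a combination of bubbles at the
   shifted nodes P instead of the nodes N is a linear system close to the
   identity (shifted_interpolation, to_test_surj).  Choosing trial functions
   above a basis of V_h gives a square system, whose kernel is zero by the
   inf-sup bound (solve_abstract, wellposed).

   Integrals over the polygon are computed over the union of the open triangles,
   where piecewise polynomials are differentiable; the excluded lines are
   negligible.  Integration by parts does not go through the triangles one by
   one: a Lipschitz function with bounded support which is differentiable in the
   direction e off a null set is the limit of its difference quotients, whose
   integrals vanish by translation invariance (integral_deriv0).  A continuous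
   function glued from polynomials, zero on the boundary of the polygon and
   extended by zero, is of that kind (mesh_ibp). *)

Local Notation edist := Defs.edist.

(** * Lebesgue measure in the plane *)
Section Measure.
Variable R : realType.
Local Notation mu := (@lebesgue_measure R).
Local Notation rT := (measurableTypeR R).

(** Both sides are measures that agree on half-open intervals. *)
Lemma lebesgue_measure_affine (r c : R) (A : set R) : 0 < r ->
  measurable A -> (r%:E * mu ((fun x : rT => (c + r * x)%R) @^-1` A) = mu A)%E.
Proof.
move=> r0 mA.
have mf : measurable_fun [set: rT] ((fun x => c + r * x) : rT -> rT).
  by apply: measurable_funD => //; exact: measurable_funM.
pose m : {measure set rT -> \bar R} := mscale (NngNum (ltW r0)) (pushforward mu ((fun x => c + r * x) : rT -> rT)).
suff -> : mu A = m mf A by [].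
apply: lebesgue_measure_unique => // _ [[a b] _ <-] /=.
rewrite /m /mscale/= /pushforward.
have -> : ((fun x : rT => c + r * x) @^-1` `]a, b]) = `](a - c) / r, (b - c) / r]%classic.
  apply/seteqP; split => x /=; rewrite !in_itv/= => /andP[h1 h2]; apply/andP; split.
  - by rewrite ltr_pdivrMr // mulrC ltrBlDl.
  - by rewrite ler_pdivlMr // mulrC lerBrDl.
  - by move: h1; rewrite ltr_pdivrMr // mulrC ltrBlDl.
  - by move: h2; rewrite ler_pdivlMr // mulrC lerBrDl.
rewrite !lebesgue_measure_itv /= !lte_fin ltr_pM2r ?invr_gt0// ltrD2r.
case: ifP => _; rewrite ?mule0 //.
by rewrite -!EFinB -EFinM; congr (_%:E); field; rewrite gt_eqF.
Qed.

Lemma measurable_funaff (r c : R) : measurable_fun [set: rT] ((fun x => c + r * x) : rT -> rT).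
Proof. by apply: measurable_funD => //; exact: measurable_funM. Qed.

Lemma measurable_aff2 (z : R * R) (r : R) :
  measurable_fun [set: rT * rT] ((fun x => z + r *: x) : rT * rT -> rT * rT).
Proof.
apply: (@measurable_fun_pair _ _ _ _ _ _ (fun x : rT * rT => z.1 + r * x.1)
  (fun x : rT * rT => z.2 + r * x.2)).
  by apply: (measurableT_comp (measurable_funaff r z.1)).
by apply: (measurableT_comp (measurable_funaff r z.2)).
Qed.

Lemma area_homothety (z : R * R) (r : R) (A : set (rT * rT)) : 0 < r ->
  measurable A ->
  ((r ^+ 2)%:E * @area R ((fun x : rT * rT => (z + r *: x)%R) @^-1` A) = @area R A)%E.
Proof.
move=> r0 mA.
have mf := measurable_aff2 z r.
pose m : {measure set (rT * rT) -> \bar R} := mscale (NngNum (exprn_ge0 2 (ltW r0)))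
  (pushforward (@area R) ((fun x => z + r *: x) : rT * rT -> rT * rT)).
suff -> : @area R A = m mf A by [].
apply: product_measure_unique => // A1 A2 mA1 mA2.
transitivity (mu A1 * mu A2)%E; last by [].
rewrite -(lebesgue_measure_affine z.1 r0 mA1) -(lebesgue_measure_affine z.2 r0 mA2).
rewrite -[LHS]/((r ^+ 2)%:E * (mu \x mu)
   (((fun x : rT => (z.1 + r * x)%R) @^-1` A1) `*` ((fun x : rT => (z.2 + r * x)%R) @^-1` A2)))%E.
rewrite product_measure1E; first by rewrite expr2 EFinM muleACA.
  by rewrite -[X in measurable X]setTI; exact: measurable_funaff.
by rewrite -[X in measurable X]setTI; exact: measurable_funaff.
Qed.
End Measure.

Section Measure2.
Variable R : realType.
Local Notation mu := (@lebesgue_measure R).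
Local Notation rT := (measurableTypeR R).

Lemma nbhs_prodP (x : R * R) (A : set (R * R)) :
  nbhs x A <-> exists2 e : R, 0 < e & forall y, `|x.1 - y.1| < e -> `|x.2 - y.2| < e -> A y.
Proof.
rewrite -nbhs_ballE; split => [[e /= e0 sA]|[e e0 sA]]; exists e => //.
  by move=> y h1 h2; apply: sA; split.
by move=> y [h1 h2]; apply: sA.
Qed.

(** The product sigma-algebra contains the open sets since each of them is a
    countable union of rectangles with rational ends. *)
Lemma open_measurable2 (A : set (rT * rT)) : open (A : set (R * R)) -> measurable A.
Proof.
move=> oA.
pose B (a b c d : rat) : set (rT * rT) :=
  `](ratr a : R), ratr b[%classic `*` `](ratr c : R), ratr d[%classic.
pose F a b c d : set (rT * rT) := if `[< B a b c d `<=` A >] then B a b c d else set0.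
(* Rectangles which are not contained in A are replaced by the empty set. *)
have -> : A = \bigcup_a \bigcup_b \bigcup_c \bigcup_d F a b c d.
  apply/seteqP; split => [x Ax|x [a _ [b _ [c _ [d _]]]]]; last first.
    by rewrite /F; case: ifP => // /asboolP + Bx; exact.
  have /nbhs_prodP[e e0 sA] : nbhs (x : R * R) A by move: oA; rewrite openE; exact.
  have hl (t : R) : t - e < t by lra.
  have hr (t : R) : t < t + e by lra.
  have [a] := rat_in_itvoo (hl x.1); rewrite in_itv/= => /andP[a1 a2].
  have [b] := rat_in_itvoo (hr x.1); rewrite in_itv/= => /andP[b1 b2].
  have [c] := rat_in_itvoo (hl x.2); rewrite in_itv/= => /andP[c1 c2].
  have [d] := rat_in_itvoo (hr x.2); rewrite in_itv/= => /andP[d1 d2].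
  exists a => //; exists b => //; exists c => //; exists d => //.
  rewrite /F ifT; first by split; rewrite /= in_itv/=; apply/andP.
  apply/asboolP => y [] /=; rewrite !in_itv/= => /andP[y1 y2] /andP[y3 y4].
  by apply: sA; rewrite ltr_norml; apply/andP; split; lra.
do 4 (apply: bigcupT_measurable_rat => ?).
by rewrite /F; case: ifP => // _; apply: measurableX; exact: measurable_itv.
Qed.

Lemma continuous_measurable2 (f : R * R -> R) : continuous f ->
  measurable_fun [set: rT * rT] (f : rT * rT -> rT).
Proof.
move=> /continuousP cf; apply: (measurability _ (RGenOpens.measurableE R)).
move=> _ [_ [a [b ->] <-]]; rewrite setTI; apply: open_measurable2.
exact/cf/interval_open.
Qed.

Lemma area_vline (c : R) : @area R [set x | x.1 = c] = 0%E.
Proof.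
have -> : [set x : R * R | x.1 = c] = [set c] `*` [set: R].
  by apply/seteqP; split => x /=; [move=> ->|case].
rewrite [LHS]product_measure1E //.
transitivity (mu [set c] * mu [set: R])%E; first by [].
by rewrite lebesgue_measure_set1 mul0e.
Qed.

Lemma area_line (a b c : R) : (a != 0) || (b != 0) ->
  @area R [set x | a * x.1 + b * x.2 = c] = 0%E.
Proof.
have [->/= a0|b0 _] := eqVneq b 0.
  rewrite orbF in a0; rewrite (_ : mkset _ = [set x | x.1 = c / a]) ?area_vline//.
  apply/seteqP; split => x /=; rewrite mul0r addr0.
    by move=> <-; rewrite mulrC mulKf.
  by move=> ->; rewrite mulrC divfK.
transitivity (\int[mu]_x (mu \o xsection [set x : rT * rT | (a * x.1 + b * x.2 = c)%R]) x)%E; first by [].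
apply: integral0_eq => x _.
rewrite /xsection/=.
rewrite (_ : mkset _ = [set (c - a * x) / b]); first exact: (lebesgue_measure_set1 ((c - a * x) / b)).
apply/seteqP; split => y /=; rewrite inE/=.
  by move=> <-; rewrite addrC addKr mulrC mulKf.
by move=> ->; rewrite [b * _]mulrC divfK// addrC subrK.
Qed.

End Measure2.

Section NullSet.
Local Open Scope ereal_scope.
Context d (T : measurableType d) (R : realType) (mu : {measure set T -> \bar R}).

Let nint (f : T -> \bar R) := ereal_sup [set sintegral mu h |
  h in [set h : {nnsfun T >-> R} | forall x, (h x)%:E <= f x]].

Let nint_null (f g : T -> \bar R) (N : set T) : measurable N -> mu N = 0 ->
  (forall x, 0 <= g x) ->
  (forall x, ~ N x -> f x = g x) -> nint f <= nint g.
Proof.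
move=> mN N0 g0 fg; apply: ge_ereal_sup => _ [h hf <-].
have mC : measurable (~` N) by exact: measurableC.
(* The simple function h restricted to the complement of N. *)
pose h' := proj_nnsfun h mC.
have hE x : h' x = (h \_ (~` N)) x by rewrite mrestrict.
have h'g x : (h' x)%:E <= g x.
  by rewrite hE patchE; case: ifPn => [|_]; rewrite // inE => xN; rewrite -fg.
apply: ereal_sup_ubound; exists h'; first exact: h'g.
have -> : sintegral mu h' = \int[mu]_x (h' x)%:E.
  by rewrite integral_nnsfun// patch_setT.
have -> : sintegral mu h = \int[mu]_x (h x)%:E.
  by rewrite integral_nnsfun// patch_setT.
apply: ge0_ae_eq_integral => //.
- exact/measurable_EFinP.
- exact/measurable_EFinP.
- by move=> x _; rewrite lee_fin.
- by move=> x _; rewrite lee_fin.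
- exists N; split => // x /= hx; apply: contrapT => xN; apply: hx => _.
  by congr (_%:E); rewrite -[LHS]/(h' x) hE patchE mem_set.
Qed.

(** The positive and negative parts are integrated as suprema over simple
    functions, which may be set to zero on N.  So this applies to integrands about
    which nothing is known on the edges of the triangles. *)
Lemma integral_off_null (D D' N : set T) (f g : T -> \bar R) :
  measurable N -> mu N = 0 -> (forall x, ~ N x -> (f \_ D) x = (g \_ D') x) ->
  \int[mu]_(x in D) f x = \int[mu]_(x in D') g x.
Proof.
move=> mN N0 fg; rewrite /integral.
have E (u v : T -> \bar R) : (forall x, 0 <= u x) -> (forall x, 0 <= v x) ->
    (forall x, ~ N x -> u x = v x) -> nint u = nint v.
  move=> u0 v0 uv; apply/eqP; rewrite eq_le; apply/andP; split.
    exact: (nint_null mN).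
  by apply: (nint_null mN) => // x /uv.
congr (_ - _); apply: E => [x|x|x /fg e].
- exact: funepos_ge0.
- exact: funepos_ge0.
- by rewrite !funeposE e.
- exact: funeneg_ge0.
- exact: funeneg_ge0.
- by rewrite !funenegE e.
Qed.

End NullSet.

(** * Integrals of directional derivatives *)
Section IBP.
Variable R : realType.
Local Notation mu := (@lebesgue_measure R).
Local Notation rT := (measurableTypeR R).
Local Notation area := (@area R).

Definition box (D : R) : set (rT * rT) := `[- D, D] `*` `[- D, D].

Lemma measurable_box D : measurable (box D).
Proof. by apply: measurableX; exact: measurable_itv. Qed.

Lemma boxP (D : R) (x : R * R) : box D x <-> `|x.1| <= D /\ `|x.2| <= D.
Proof. by rewrite !ler_norml /box /= !in_itv/=. Qed.

Lemma area_box_fin D : (area (box D) < +oo)%E.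
Proof.
rewrite [ltLHS]product_measure1E //.
have f : forall D' : R, (mu `[(- D')%R, D'] < +oo)%E.
  by move=> D'; rewrite lebesgue_measure_itv/=; case: ifP; rewrite // -EFinB ltry.
by apply: lte_mul_pinfty; rewrite ?f// ge0_fin_numE ?f.
Qed.

Lemma continuous_box_bounded (f : R * R -> R) (D : R) : continuous f ->
  exists2 B, 0 < B & forall x, box D x -> `|f x| <= B.
Proof.
move=> cf.
have cK : compact (box D : set (R * R)).
  by apply: compact_setX; exact: segment_compact.
have /compact_bounded[M [_ hM]] : compact [set f x | x in (box D : set (R * R))].
  by apply: continuous_compact => //; exact: continuous_subspaceT.
exists (`|M| + 1) => [|x bx]; first by rewrite ltr_wpDl.
by apply: (hM (`|M| + 1)); [rewrite (le_lt_trans (ler_norm M))// ltrDl|exists x].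
Qed.

Lemma bounded_box_integrable (f : R * R -> R) (B D : R) :
  measurable_fun [set: rT * rT] (f : rT * rT -> rT) ->
  (forall x, `|f x| <= B) -> (forall x, ~ box D x -> f x = 0) ->
  area.-integrable setT (fun x => (f x)%:E).
Proof.
move=> mf fB f0.
have -> : (fun x => (f x)%:E) = (fun x => (f x)%:E) \_ (box D).
  apply/funext => x; rewrite patchE; case: ifPn => //; rewrite notin_setE => /f0 ->//.
apply: (iffLR (integrable_mkcond _ (measurable_box D))).
apply: measurable_bounded_integrable.
- exact: measurable_box.
- exact: area_box_fin.
- exact: measurable_funTS.
- exists B; split; first exact: num_real.
  by move=> M BM x _ /=; apply: le_trans (ltW BM).
Qed.

(** Stated for functions which are bounded with bounded support, so that both
    integrals are finite without further hypotheses. *)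
Lemma integral_translation (f : R * R -> R) (z : R * R) (B D : R) :
  measurable_fun [set: rT * rT] (f : rT * rT -> rT) ->
  (forall x, `|f x| <= B) -> (forall x, ~ box D x -> f x = 0) ->
  (\int[area]_x (f (z + x)%R)%:E = \int[area]_x (f x)%:E)%E.
Proof.
move=> mf fB f0.
have mt : measurable_fun [set: rT * rT] ((fun x => z + x)%R : rT * rT -> rT * rT).
  rewrite (_ : (fun x => _) = (fun x => z + 1 *: x)); first exact: measurable_aff2.
  by apply/funext => x; rewrite scale1r.
have mft := measurableT_comp mf mt.
have int_t : area.-integrable setT (fun x => (f (z + x))%:E).
  apply: (@bounded_box_integrable _ B (D + `|z.1| + `|z.2|)) => //.
  move=> x nx; apply: f0; apply: contra_not nx => /boxP/= [h1 h2]; apply/boxP.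
  split.
    have -> : x.1 = (z.1 + x.1) - z.1 by ring.
    by rewrite (le_trans (ler_normB _ _))//; have := normr_ge0 z.2; lra.
  have -> : x.2 = (z.2 + x.2) - z.2 by ring.
  by rewrite (le_trans (ler_normB _ _))//; have := normr_ge0 z.1; lra.
pose T := (fun x => z + x) : rT * rT -> rT * rT.
have mfE : measurable_fun [set: rT * rT] (fun x => (f x)%:E) by exact/measurable_EFinP.
have E := @integral_pushforward _ _ _ _ _ T mt area setT (fun x => (f x)%:E) mfE int_t measurableT.
rewrite preimage_setT in E.
transitivity (\int[pushforward area T]_x (f x)%:E)%E.
  rewrite E; apply: eq_integral => x _; rewrite /comp /T //.
apply: eq_measure_integral => A mA _.
rewrite -(area_homothety z ltr01 mA) expr1n mul1e.
by congr (area _); apply/seteqP; split => x /=; rewrite scale1r.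
Qed.

(** The difference quotients of G in the direction e have integral zero by
    translation invariance; they are bounded by L on a common box and converge
    to dG off N, so dominated convergence applies. *)
Lemma integral_deriv0 (e : R * R) (G dG : R * R -> R) (D L : R) (N : set (rT * rT)) :
  continuous G -> (forall x, ~ box D x -> G x = 0) ->
  (forall x t, `|G (t *: e + x) - G x| <= L * `|t|) ->
  measurable N -> area N = 0%E ->
  measurable_fun [set: rT * rT] (dG : rT * rT -> rT) ->
  (forall x, ~ N x -> is_derive x e G (dG x)) ->
  area.-integrable setT (fun x => (dG x)%:E) /\
  (\int[area]_x (dG x)%:E = 0)%E.
Proof.
move=> cG G0 LG mN N0 mdG dGG.
have mG := continuous_measurable2 cG.
have [B GB] : exists B, forall x, `|G x| <= B.
  have [B B0 hB] := continuous_box_bounded D cG; exists B => x.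
  by have [/hB//|/G0 ->] := pselect (box D x); rewrite normr0 ltW.
pose t n : R := n.+1%:R^-1.
have t0 n : 0 < t n by rewrite invr_gt0.
pose f n x := (t n)^-1 * (G (t n *: e + x) - G x).
(* The supports of all the difference quotients lie in this box. *)
pose E := D + `|e.1| + `|e.2|.
have L0 : 0 <= L.
  by have := LG 0 1; rewrite normr1 mulr1; apply: le_trans.
have mt n : measurable_fun [set: rT * rT] ((fun x => t n *: e + x)%R : rT * rT -> rT * rT).
  rewrite (_ : (fun x => _) = (fun x => t n *: e + 1 *: x)); first exact: measurable_aff2.
  by apply/funext => x; rewrite scale1r.
have mf n : measurable_fun [set: rT * rT] (f n : rT * rT -> rT).
  apply: measurable_funM => //; apply: measurable_funB => //.
  exact: (measurableT_comp mG (mt n)).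
have t1 n : t n <= 1 by rewrite invf_le1// ler1n.
have fL n x : `|f n x| <= L.
  rewrite /f normrM gtr0_norm ?invr_gt0// mulrC ler_pdivrMr//.
  by apply: (le_trans (LG _ _)); rewrite gtr0_norm.
have f0 n x : ~ box E x -> f n x = 0.
  move=> nx; rewrite /f !G0 ?subrr ?mulr0//.
    apply: contra_not nx => /boxP[h1 h2]; apply/boxP; rewrite /E; split.
      by have := normr_ge0 e.1; have := normr_ge0 e.2; lra.
    by have := normr_ge0 e.1; have := normr_ge0 e.2; lra.
  apply: contra_not nx => /boxP/= [h1 h2]; apply/boxP; rewrite /E.
  have te (u : R) : `|t n * u| <= `|u|.
    by rewrite normrM gtr0_norm// ler_piMl// t1.
  split.
    have -> : x.1 = (t n * e.1 + x.1) - t n * e.1 by ring.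
    rewrite (le_trans (ler_normB _ _))//; have := normr_ge0 e.2; have := te e.1.
    by move: h1; rewrite /GRing.scale/=; lra.
  have -> : x.2 = (t n * e.2 + x.2) - t n * e.2 by ring.
  rewrite (le_trans (ler_normB _ _))//; have := normr_ge0 e.1; have := te e.2.
  by move: h2; rewrite /GRing.scale/=; lra.
have If n : (\int[area]_x (f n x)%:E = 0)%E.
  rewrite /f.
  under eq_integral do rewrite EFinM.
  have iG : area.-integrable setT (fun x => (G x)%:E) by exact: (bounded_box_integrable mG GB G0).
  have iGt : area.-integrable setT (fun x => (G (t n *: e + x))%:E).
    apply: (@bounded_box_integrable _ B E) => //.
      exact: (measurableT_comp mG (mt n)).
    move=> x nx; have := f0 n x nx; rewrite /f; have -> : G x = 0.
      apply: G0; apply: contra_not nx => /boxP[h1 h2]; apply/boxP; rewrite /E.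
      by split; have := normr_ge0 e.1; have := normr_ge0 e.2; lra.
    by rewrite subr0 => /eqP; rewrite mulf_eq0 invr_eq0 gt_eqF//= => /eqP.
  rewrite integralZl//; last first.
    under eq_fun do rewrite EFinB.
    exact: integrableB.
  under eq_integral do rewrite EFinB.
  rewrite integralB//.
  rewrite (@integral_translation G (t n *: e) B D)// subee ?mule0//.
  exact: integrable_fin_num.
have [] := @dominated_convergence _ _ _ area setT measurableT
  (fun n x => (f n x)%:E) (fun x => (dG x)%:E) (fun x => (L%:E * (\1_(box E) x)%:E))%E.
- by move=> n; apply/measurable_EFinP; exact: mf.
- exact/measurable_EFinP.
- exists N; split => // x /= hx; apply: contrapT => xN; apply: hx => _.
  apply: cvg_EFin; first by near=> n.
  have [dx dE] := dGG x xN.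
  rewrite -dE.
  have /cvgr_dnbhsP := dx; apply; split => [n|]; first by rewrite gt_eqF.
  exact: cvg_harmonic.
- apply: integrableZl => //; apply: (@bounded_box_integrable _ 1 E).
  + by apply: measurable_indic; exact: measurable_box.
  + by move=> x; rewrite indicE; case: (_ \in _); rewrite ?normr1 ?normr0.
  + by move=> x nx; rewrite indicE memNset.
- apply: aeW => x n _ /=; rewrite -EFinM lee_fin indicE.
  have [xE|xE] := pselect (box E x); first by rewrite mem_set// mulr1.
  by rewrite memNset// mulr0 f0// normr0.
move=> idG _ lim; split => //.
have : (fun=> 0%E) @ \oo --> (\int[area]_x (dG x)%:E)%E.
  by move: lim; under eq_fun do rewrite If.
by move=> /(cvg_lim (@ereal_hausdorff _)) <-; rewrite lim_cst.
Unshelve. all: end_near.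
Qed.
End IBP.

(** * Lipschitz functions on a finite closed cover of a segment *)
Section Lip.
Variable R : realType.

(** Starting from a, go to the last point of the closed set that contains a:
    that set is not met any more afterwards, whence an induction on the number
    of sets. *)
Lemma closed_cover_lipschitz (I : finType) (C : I -> set R) (h : R -> R) (L : R) :
  (forall i, closed (C i)) ->
  (forall i s t, C i s -> C i t -> `|h s - h t| <= L * `|s - t|) ->
  forall a b, a <= b -> (forall t, a <= t <= b -> exists i, C i t) ->
  `|h b - h a| <= L * (b - a).
Proof.
move=> cC LC.
suff H n (P : {set I}) : (#|P| <= n)%N -> forall a b, a <= b ->
    (forall t, a <= t <= b -> exists2 i, i \in P & C i t) ->
    `|h b - h a| <= L * (b - a).
  move=> a b ab cov; apply: (H _ (finset.setTfor I) (leqnn _)) => // t /cov[i Ci].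
  by exists i; rewrite ?inE.
elim: n P => [|n IH] P cP a b ab cov.
  have [|i iP _] := cov a; first by rewrite lexx.
  by move: cP; rewrite leqn0 cards_eq0 => /eqP P0; rewrite P0 inE in iP.
have [|i iP Cia] := cov a; first by rewrite lexx.
pose S := C i `&` `[a, b].
have cS : closed S by apply: closedI; [exact: cC|exact: interval_closed].
have hS : has_sup S.
  split; first by exists a; split => //=; rewrite in_itv/= lexx.
  by exists b => x [_]; rewrite /= in_itv/= => /andP[].
have [Cia' ] : S (sup S).
  by rewrite [X in X _]((closure_id _).1 cS); case: hS; exact: closure_sup.
set a' := sup S; rewrite /= in_itv/= => /andP[aa' a'b].
have Lip1 : `|h a' - h a| <= L * (a' - a).
  by rewrite -[a' - a]ger0_norm ?subr_ge0//; exact: (LC i).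
have [<- //|ba'] := eqVneq a' b.
have a'ltb : a' < b by rewrite lt_neqAle ba'.
have cov' t : a' < t <= b -> exists2 j, j \in P :\ i & C j t.
  move=> /andP[t1 t2]; have [|j jP Cjt] := cov t.
    by rewrite t2 (le_trans aa' (ltW t1)).
  exists j => //; rewrite !inE jP andbT; apply/eqP => ji.
  have : t <= a'.
    apply: ub_le_sup; first by case: hS.
    by split; [rewrite -ji|rewrite /= in_itv/= t2 (le_trans aa' (ltW t1))].
  by rewrite leNgt t1.
have Lip2 : `|h b - h a'| <= L * (b - a').
  apply: (IH (P :\ i)) => //; first by move: cP; rewrite (cardsD1 i) iP.
  move=> t /andP[]; rewrite le_eqVlt => /predU1P[<- _|t1 t2]; last by apply: cov'; rewrite t1.
  apply: contrapT => no.
  have : \forall t \near a', forall j, j \in P :\ i -> ~ C j t.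
    have := @filter_forall R I (fun j t => j \in P :\ i -> ~ C j t) (nbhs a') _; apply => j; have [jP|jP] := boolP (j \in P :\ i); last by near=> x.
    have : nbhs a' (~` C j).
      by apply: open_nbhs_nbhs; split; [exact: closed_openC|move=> ?; apply: no; exists j].
    by apply: filterS => x nC _.
  move=> /nbhs_ballP[e /= e0 he].
  pose t1 := a' + Num.min (e / 2) (b - a').
  have m0 : 0 < Num.min (e / 2) (b - a') by rewrite lt_min divr_gt0// subr_gt0.
  have [|j jP Cj] := cov' t1.
    by rewrite /t1 ltrDl m0/= -lerBrDl ge_min lexx orbT.
  apply: (he t1 _ j) => //.
  rewrite /ball/= /t1 opprD addrA subrr sub0r normrN gtr0_norm//.
  by rewrite (le_lt_trans (y := e / 2))// ?ge_min ?lexx//; lra.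
have -> : h b - h a = (h b - h a') + (h a' - h a) by ring.
have -> : L * (b - a) = L * (b - a') + L * (a' - a) by ring.
by rewrite (le_trans (ler_normD _ _))// lerD.
Unshelve. all: end_near.
Qed.
End Lip.

(** * Polynomials of bounded degree in two variables *)
Section Poly.
Variable R : realType.
Implicit Types (q : R * R -> R) (x z : R * R).

Lemma poly_le0P q : poly_le 0 q <-> exists c, forall x, q x = c.
Proof.
split=> [[c hc]|[c hc]].
  by exists (c 0%N 0%N) => x; rewrite hc !big_ord1 /= ?big_ord1 !mulr1.
by exists (fun _ _ => c) => x; rewrite !big_ord1 /= ?big_ord1 !mulr1.
Qed.

(** This decomposition turns statements on poly_le into inductions on k with no
    double sums. *)
Lemma poly_leS_inv k q : poly_le k.+1 q ->
  exists c q1 q2, [/\ poly_le k q1, poly_le k q2 &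
    forall x, q x = c + x.1 * q1 x + x.2 * q2 x].
Proof.
move=> [c hc]; exists (c 0%N 0%N).
exists (fun x => \sum_(i < k.+1) \sum_(j < k.+1 - i) c i.+1 j * x.1 ^+ i * x.2 ^+ j).
exists (fun x => \sum_(i < k.+1) \sum_(j < k.+1 - i) (if i == 0%N :> nat then c 0%N j.+1 else 0) * x.1 ^+ i * x.2 ^+ j).
split; [by exists (fun i j => c i.+1 j)|by exists (fun i j => if i == 0%N :> nat then c 0%N j.+1 else 0)|].
move=> x; rewrite hc big_ord_recl /= subn0 big_ord_recl /= !mulr1 -!addrA; congr (_ + _).
rewrite addrC; congr (_ + _).
  rewrite big_distrr; apply: eq_bigr => i _ /=; rewrite /bump /= add1n subSS.
  by rewrite big_distrr; apply: eq_bigr => j _ /=; rewrite exprS; ring.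
rewrite [in RHS]big_ord_recl /= subn0 [X in _ = _ * (_ + X)]big1 ?addr0.
  rewrite big_distrr; apply: eq_bigr => i _ /=.
  by rewrite /bump /= add1n exprS; ring.
by move=> i _; rewrite big1// => j _; rewrite !mul0r.
Qed.

Lemma poly_leD k q1 q2 : poly_le k q1 -> poly_le k q2 -> poly_le k (fun x => q1 x + q2 x).
Proof.
move=> [c1 h1] [c2 h2]; exists (fun i j => c1 i j + c2 i j) => x.
rewrite h1 h2 -big_split /=; apply: eq_bigr => i _.
by rewrite -big_split /=; apply: eq_bigr => j _; ring.
Qed.

Lemma poly_leZ k (a : R) q : poly_le k q -> poly_le k (fun x => a * q x).
Proof.
move=> [c h]; exists (fun i j => a * c i j) => x.
rewrite h big_distrr; apply: eq_bigr => i _ /=.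
by rewrite big_distrr; apply: eq_bigr => j _ /=; ring.
Qed.

Lemma poly_le_ext k q1 q2 : q1 =1 q2 -> poly_le k q1 -> poly_le k q2.
Proof. by move=> e [c h]; exists c => x; rewrite -e. Qed.

Lemma poly_leS k c q1 q2 : poly_le k q1 -> poly_le k q2 ->
  poly_le k.+1 (fun x => c + x.1 * q1 x + x.2 * q2 x).
Proof.
move=> [c1 h1] [c2 h2].
have H1 : poly_le k.+1 (fun x => x.1 * q1 x).
  exists (fun i j => if i is i'.+1 then c1 i' j else 0) => x.
  rewrite big_ord_recl /= [X in _ = X + _]big1 ?add0r; last by move=> j _; rewrite !mul0r.
  rewrite h1 big_distrr; apply: eq_bigr => i _ /=; rewrite /bump /= add1n subSS.
  by rewrite big_distrr; apply: eq_bigr => j _ /=; rewrite exprS; ring.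
have H2 : poly_le k.+1 (fun x => x.2 * q2 x).
  exists (fun i j => if j is j'.+1 then c2 i j' else 0) => x.
  rewrite big_ord_recr /= [X in _ = _ + X]big1 ?addr0; last first.
    rewrite subSn// subnn => j _; rewrite (ord1 j) !mul0r //.
  rewrite h2 big_distrr; apply: eq_bigr => i _ /=.
  rewrite (subSn (ltnW (ltn_ord i))) big_ord_recl /= !mul0r add0r.
  by rewrite big_distrr; apply: eq_bigr => j _ /=; rewrite /bump/= add1n exprS; ring.
have H0 : poly_le k.+1 (fun=> c : R).
  exists (fun i j => if (i == 0%N) && (j == 0%N) then c else 0) => x.
  rewrite big_ord_recl /= subn0 big_ord_recl /= !mulr1 !big1 ?addr0// => i _.
    by rewrite big1// => j _; rewrite !mul0r.
  by rewrite !mul0r.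
exact: poly_leD (poly_leD H0 H1) H2.
Qed.

Lemma poly_le_cst k (c : R) : poly_le k (fun=> c).
Proof.
elim: k => [|k IH]; first by apply/poly_le0P; exists c.
apply: (poly_le_ext _ (poly_leS c (poly_leZ 0 IH) (poly_leZ 0 IH))) => x.
by ring.
Qed.

Lemma poly_leW k q : poly_le k q -> poly_le k.+1 q.
Proof.
elim: k q => [q /poly_le0P[c h]|k IH q /poly_leS_inv[c [q1 [q2 [h1 h2 h]]]]].
  by apply: (poly_le_ext _ (poly_le_cst 1 c)) => x; rewrite h.
by apply: (poly_le_ext _ (poly_leS c (IH _ h1) (IH _ h2))) => x; rewrite h.
Qed.

Lemma poly_leMaff k (c a b : R) q : poly_le k q ->
  poly_le k.+1 (fun x => (c + a * x.1 + b * x.2) * q x).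
Proof.
move=> hq; have := poly_leD (poly_leW (poly_leZ c hq)) (poly_leS 0 (poly_leZ a hq) (poly_leZ b hq)).
by apply: poly_le_ext => x; ring.
Qed.

Lemma poly_le_line k q : poly_le k q ->
  forall x z, exists2 p : {poly R}, (size p <= k.+1)%N & forall s, q (x + s *: z) = p.[s].
Proof.
elim: k q => [q /poly_le0P[c h]|k IH q /poly_leS_inv[c [q1 [q2 [h1 h2 h]]]]] x z.
  by exists c%:P => [|s]; rewrite ?h ?hornerC// size_polyC; case: eqP.
have [p1 s1 e1] := IH _ h1 x z; have [p2 s2 e2] := IH _ h2 x z.
exists (c%:P + (x.1%:P + z.1 *: 'X) * p1 + (x.2%:P + z.2 *: 'X) * p2).
  have S (u v : R) (p : {poly R}) : (size p <= k.+1)%N -> (size ((u%:P + v *: 'X) * p)%R <= k.+2)%N.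
    move=> sp; apply: (leq_trans (size_polyMleq _ _)).
    have : (size (u%:P + v *: 'X)%R <= 2)%N.
      rewrite (leq_trans (size_polyD _ _))// geq_max size_polyC (leq_trans (leq_b1 _))//=.
      by rewrite (leq_trans (size_scale_leq _ _))// size_polyX.
    by move: sp; lia.
  rewrite (leq_trans (size_polyD _ _))// geq_max S// andbT.
  rewrite (leq_trans (size_polyD _ _))// geq_max S// andbT.
  by rewrite size_polyC; case: eqP.
by move=> s; rewrite h e1 e2 !hornerE/= /GRing.scale/=; ring.
Qed.

Lemma poly_le_continuous k q : poly_le k q -> continuous q.
Proof.
elim: k q => [q /poly_le0P[c h]|k IH q /poly_leS_inv[c [q1 [q2 [h1 h2 h]]]]].
  by rewrite (_ : q = cst c); [exact: cst_continuous|apply/funext].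
have -> : q = (fun x => c + x.1 * q1 x + x.2 * q2 x) by apply/funext.
move=> x; apply: cvgD.
  apply: cvgD; first exact: cvg_cst.
  by apply: cvgM; [exact: cvg_fst|exact: IH].
by apply: cvgM; [exact: cvg_snd|exact: IH].
Qed.
End Poly.

Section Poly2.
Variable R : realType.
Implicit Types (q : R * R -> R) (x z : R * R).

Lemma is_derive_fst x z : is_derive x z (fst : R * R -> R) z.1.
Proof.
have E : (fun h : R => h^-1 *: (((fst : R * R -> R) \o shift x) (h *: z) - x.1)) @ 0^' --> z.1.
  apply: (@cvg_trans _ ((fun h : R => z.1) @ 0^')); last exact: cvg_cst.
  apply: near_eq_cvg; near=> h; rewrite /= addrK scalerA mulVf ?scale1r//.
  by near: h; exact: nbhs_dnbhs_neq.
by split; [apply/cvg_ex; exists z.1|apply: (cvg_lim _ E)].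
Unshelve. all: end_near.
Qed.

Lemma is_derive_snd x z : is_derive x z (snd : R * R -> R) z.2.
Proof.
have E : (fun h : R => h^-1 *: (((snd : R * R -> R) \o shift x) (h *: z) - x.2)) @ 0^' --> z.2.
  apply: (@cvg_trans _ ((fun h : R => z.2) @ 0^')); last exact: cvg_cst.
  apply: near_eq_cvg; near=> h; rewrite /= addrK scalerA mulVf ?scale1r//.
  by near: h; exact: nbhs_dnbhs_neq.
by split; [apply/cvg_ex; exists z.2|apply: (cvg_lim _ E)].
Unshelve. all: end_near.
Qed.

Lemma poly_le_derive k q : poly_le k q ->
  exists qx qy, [/\ poly_le k qx, poly_le k qy &
    forall x z, is_derive x z q (z.1 * qx x + z.2 * qy x)].
Proof.
elim: k q => [q /poly_le0P[c h]|k IH q /poly_leS_inv[c [q1 [q2 [h1 h2 h]]]]].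
  exists (fun=> 0), (fun=> 0); split; [exact: poly_le_cst|exact: poly_le_cst|].
  move=> x z; rewrite (_ : q = cst c); last exact/funext.
  by apply: is_derive_eq; rewrite !mulr0 addr0.
have [q1x [q1y [h1x h1y d1]]] := IH _ h1.
have [q2x [q2y [h2x h2y d2]]] := IH _ h2.
exists (fun x => q1 x + (0 + x.1 * q1x x + x.2 * q2x x)),
       (fun x => q2 x + (0 + x.1 * q1y x + x.2 * q2y x)).
split; [exact/poly_leD/poly_leS/h2x/h1x/poly_leW|exact/poly_leD/poly_leS/h2y/h1y/poly_leW|].
move=> x z; rewrite (_ : q = cst c + ((fst : R * R -> R) * q1 + (snd : R * R -> R) * q2)); last first.
  by apply/funext => y; rewrite h -addrA.
have := is_derive_fst x z; have := is_derive_snd x z; have := d1 x z; have := d2 x z.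
move=> ? ? ? ?; apply: is_derive_eq; rewrite /GRing.scale/=; ring.
Qed.

(** On the line through x and y the polynomial has infinitely many zeros near x. *)
Lemma poly_le0_everywhere k q x (e : R) : poly_le k q -> 0 < e ->
  (forall y, `|x.1 - y.1| < e -> `|x.2 - y.2| < e -> q y = 0) -> forall y, q y = 0.
Proof.
move=> hq e0 q0 y; have [p sp hp] := poly_le_line hq x (y - x).
suff p0 : p = 0 by have := hp 1; rewrite p0 horner0 scale1r addrC subrK.
pose M := 1 + `|(y - x).1| + `|(y - x).2|.
have M0 : 0 < M by rewrite /M -addrA ltr_pwDl// addr_ge0.
(* Parameters of k + 1 points on the line so close to x that q vanishes there. *)
pose s i : R := e / M / (i.+2)%:R.
have s0 i : 0 < s i by rewrite /s !divr_gt0.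
have sM i (u : R) : `|u| <= M -> `|s i * u| < e.
  move=> uM; rewrite normrM (gtr0_norm (s0 i)).
  apply: (@le_lt_trans _ _ (s i * M)); first by rewrite ler_wpM2l// ltW.
  by rewrite /s mulrAC divfK ?gt_eqF// ltr_pdivrMr// ltr_pMr// ltr1n.
apply: (@roots_geq_poly_eq0 _ p (mkseq s k.+1)) => //; last by rewrite size_mkseq.
  apply/allP => _ /mapP[i _ ->]; rewrite /root -hp q0 ?eqxx//=.
  - by rewrite opprD addrA subrr sub0r normrN; apply: sM; rewrite /M /=; have := normr_ge0 (y.2 - x.2); lra.
  - by rewrite opprD addrA subrr sub0r normrN; apply: sM; rewrite /M /=; have := normr_ge0 (y.1 - x.1); lra.
rewrite map_inj_uniq ?iota_uniq// => i j /mulfI => /(_ _) h.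
have : i.+2%:R = j.+2%:R :> R by apply/invr_inj/h; rewrite mulf_neq0 ?invr_eq0 ?gt_eqF.
by move/eqP; rewrite eqr_nat => /eqP [].
Qed.

Lemma poly_lipschitz (p : {poly R}) (B : R) : exists2 C : R, 0 <= C &
  forall x y : R, `|x| <= B -> `|y| <= B -> `|p.[x]| <= C /\ `|p.[x] - p.[y]| <= C * `|x - y|.
Proof.
elim/poly_ind: p => [|p c [C C0 IH]].
  by exists 0 => // x y _ _; rewrite !horner0 subrr normr0 mul0r.
exists (C * `|B| + `|c| + C); first by rewrite addr_ge0// addr_ge0// mulr_ge0.
move=> x y hx hy; have [h1 h2] := IH x y hx hy; have [h3 _] := IH y x hy hx.
have xB : `|x| <= `|B| by rewrite (le_trans hx)// ler_norm.
rewrite !hornerE; split.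
  rewrite (le_trans (ler_normD _ _))// -addrA lerD// ?lerDl//.
  by rewrite normrM ler_pM.
have -> : p.[x] * x + c - (p.[y] * y + c) = (p.[x] - p.[y]) * x + p.[y] * (x - y) by ring.
rewrite (le_trans (ler_normD _ _))// !normrM !mulrDl.
apply: (@le_trans _ _ (C * `|B| * `|x - y| + C * `|x - y|)).
  apply: lerD; last by apply: ler_wpM2r.
  by rewrite mulrAC; apply: ler_pM.
by rewrite lerD2r lerDl mulr_ge0.
Qed.

(** Interpolate in a and in b separately, at k + 1 points between 0 and 1/2:
    the grid lies in the reference triangle, and the increments of g are bounded
    by those of the interpolation basis times the largest value of g on the
    grid, reached at (a0, b0).  The constant is uniform in O, U, V, which makes
    every later estimate on a triangle independent of its size and shape. *)
Lemma poly_increment_bound (k : nat) (B : R) : (0 < k)%N ->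
  exists2 L : R, 0 < L & forall q, poly_le k q -> forall O U V : R * R,
    exists a0 b0 : R, [/\ 0 <= a0, 0 <= b0, a0 + b0 <= 1 &
    forall a b a' b', `|a| <= B -> `|b| <= B -> `|a'| <= B -> `|b'| <= B ->
      let g a b := q (O + a *: U + b *: V) in
      `|g a b - g a' b'| <= L * `|g a0 b0| * (`|a - a'| + `|b - b'|)].
Proof.
(* The interpolation points, at most 1/2 for i <= k. *)
move=> k0; pose s i : R := i%:R / (2 * k%:R).
have kn0 : k%:R != 0 :> R by rewrite pnatr_eq0 -lt0n.
have s_inj : injective s.
  move=> i j /mulIf h; apply/eqP; rewrite -(eqr_nat R); apply/eqP/h.
  by rewrite invr_eq0 mulf_neq0// pnatr_eq0.
pose l (i : 'I_k.+1) : {poly R} := tnth (lagrange k.+1 s) i.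
have lE (p : {poly R}) (t : R) : (size p <= k.+1)%N -> p.[t] = \sum_(i < k.+1) p.[s i] * (l i).[t].
  move=> sp; rewrite {1}(lagrange_gen (ltn0Sn k) s_inj sp) horner_sum.
  by apply: eq_bigr => i _; rewrite hornerM hornerC.
have [C C0 hC] : exists2 C : R, 0 <= C & forall i (x y : R), `|x| <= B -> `|y| <= B ->
     `|(l i).[x]| <= C /\ `|(l i).[x] - (l i).[y]| <= C * `|x - y|.
  have h i := cid2 (poly_lipschitz (l i) B).
  exists (\sum_i s2val (h i)).
    by apply: sumr_ge0 => i _; case: (h i).
  move=> i x y hx hy; case: (s2valP' (h i) x y hx hy) => h1 h2.
  have hi : s2val (h i) <= \sum_i s2val (h i).
    by rewrite (bigD1 i)//= lerDl sumr_ge0// => j _; case: (h j).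
  by split; [exact: le_trans hi|apply: (le_trans h2); exact: ler_wpM2r].
exists (\sum_(i < k.+1) \sum_(j < k.+1) (C * C) + 1).
  by rewrite ltr_wpDl// sumr_ge0// => i _; rewrite sumr_ge0// => j _; rewrite mulr_ge0.
move=> q hq O U V; pose g a b := q (O + a *: U + b *: V).
have gE a b : g a b = \sum_(i < k.+1) \sum_(j < k.+1) g (s i) (s j) * (l i).[a] * (l j).[b].
  have [p sp ep] := poly_le_line hq (O + b *: V) U.
  have -> : g a b = p.[a] by rewrite -ep /g addrAC.
  rewrite lE//; apply: eq_bigr => i _.
  have [p' sp' ep'] := poly_le_line hq (O + s i *: U) V.
  have -> : p.[s i] = p'.[b] by rewrite -ep -ep' addrAC.
  rewrite lE// mulr_suml; apply: eq_bigr => j _.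
  by rewrite -ep' /g mulrAC.
pose m := [arg max_(p > (ord0, ord0) : 'I_k.+1 * 'I_k.+1) `|g (s p.1) (s p.2)|]%O.
have mP (i j : 'I_k.+1) : `|g (s i) (s j)| <= `|g (s m.1) (s m.2)|.
  by rewrite /m; case: Order.TotalTheory.arg_maxP => // p _ /(_ (i, j)); exact.
have s_ge0 i : 0 <= s i by rewrite /s divr_ge0// mulr_ge0.
have s_le (i : 'I_k.+1) : s i <= 1 / 2.
  rewrite /s ler_pdivrMr ?mulr_gt0 ?ltr0n//.
  by rewrite mulrA divfK ?pnatr_eq0// mul1r ler_nat -ltnS.
exists (s m.1), (s m.2); split => //.
  by have := s_le m.1; have := s_le m.2; lra.
move=> a b a' b' ha hb ha' hb'.
change (`|g a b - g a' b'| <= (\sum_(i < k.+1) \sum_(j < k.+1) (C * C) + 1) *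
  `|g (s m.1) (s m.2)| * (`|a - a'| + `|b - b'|)).
set M := `|g _ (s m.2)|; set d := `|a - a'| + `|b - b'|.
rewrite !gE -sumrB.
rewrite (le_trans (ler_norm_sum _ _ _))//.
apply: (@le_trans _ _ (\sum_(i < k.+1) \sum_(j < k.+1) (C * C * M * d))).
  apply: ler_sum => i _; rewrite -sumrB (le_trans (ler_norm_sum _ _ _))//.
  apply: ler_sum => j _.
  have -> : g (s i) (s j) * (l i).[a] * (l j).[b] - g (s i) (s j) * (l i).[a'] * (l j).[b']
    = g (s i) (s j) * (((l i).[a] - (l i).[a']) * (l j).[b] + (l i).[a'] * ((l j).[b] - (l j).[b'])) by ring.
  rewrite normrM (_ : C * C * M * d = M * (C * C * d)); last by ring.
  apply: ler_pM => //.
  rewrite (le_trans (ler_normD _ _))// !normrM /d mulrDr.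
  have [_ h1] := hC i _ _ ha ha'; have [h2 _] := hC j _ _ hb hb'.
  have [h3 _] := hC i _ _ ha' ha; have [_ h4] := hC j _ _ hb hb'.
  apply: lerD; last by rewrite -mulrA; apply: ler_pM.
  by rewrite mulrAC; apply: ler_pM.
set S := \sum_(i < k.+1) \sum_(j < k.+1) (C * C).
have -> : \sum_(i < k.+1) \sum_(j < k.+1) (C * C * M * d) = S * M * d.
  by rewrite /S !mulr_suml; apply: eq_bigr => i _; rewrite ?mulr_suml.
rewrite -!mulrA ler_wpM2r ?lerDl// mulr_ge0 /M ?normr_ge0//.
by rewrite /d addr_ge0.
Qed.
End Poly2.

(** * Barycentric coordinates *)
Section Tri.
Variable R : realType.
Implicit Types (x y z : R * R).

Definition cross (u v : R * R) : R := u.1 * v.2 - u.2 * v.1.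

Lemma ord3P (j j' : 'I_3) : [\/ j' = j, j' = ordS j | j' = ord_pred j].
Proof.
by case: j => [[|[|[|//]]] p]; case: j' => [[|[|[|//]]] p'];
  do [by constructor 1; apply/val_inj|by constructor 2; apply/val_inj|by constructor 3; apply/val_inj].
Qed.

Lemma ordSS (j : 'I_3) : ordS (ordS j) = ord_pred j.
Proof. by case: j => [[|[|[|//]]] p]; apply/val_inj. Qed.

Lemma ord_predpred (j : 'I_3) : ord_pred (ord_pred j) = ordS j.
Proof. by case: j => [[|[|[|//]]] p]; apply/val_inj. Qed.

Lemma neq_ordS (j : 'I_3) : (j == ordS j) = false.
Proof. by case: j => [[|[|[|//]]] p]. Qed.

Lemma neq_ord_pred (j : 'I_3) : (j == ord_pred j) = false.
Proof. by case: j => [[|[|[|//]]] p]. Qed.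

(** Sums over the vertices, written from any of them, to match the cyclic
    definition of the edges. *)
Lemma sum3E (V : zmodType) (F : 'I_3 -> V) (j : 'I_3) :
  \sum_j' F j' = F j + F (ordS j) + F (ord_pred j).
Proof.
have E : \sum_j' F j' = F ord0 + F (ordS ord0) + F (ord_pred ord0).
  rewrite !big_ord_recl big_ord0 addr0 addrA.
  by congr (F _ + F _ + F _); apply: ord_inj.

rewrite E; case: (ord3P ord0 j) => -> //.
  rewrite ordSS ordSK; by rewrite [RHS]addrC addrA.
by rewrite ord_predpred ord_predK -[RHS]addrA [RHS]addrC.
Qed.

Variable M : mesh R.
Variable i : 'I_(ntri M).
Local Notation V := (vtx i).

(** Twice the signed area. *)
Definition tdet : R := cross (V (ordS ord0) - V ord0) (V (ord_pred ord0) - V ord0).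

Lemma tdetE j : tdet = cross (endA i j - V j) (endB i j - V j).
Proof.
rewrite /tdet /endA /endB; case: (ord3P ord0 j) => -> //.
  by rewrite ordSS ordSK /cross/=; ring.
by rewrite ord_predpred ord_predK /cross/=; ring.
Qed.

(** Barycentric coordinate of x at the vertex j: the ratio of the signed areas
    of two triangles with base edge i j.  As a formula it is affine on the whole
    plane. *)
Definition lam j x : R := cross (endB i j - endA i j) (x - endA i j) / tdet.

Lemma lam_ordS j x : lam (ordS j) x = cross (V j - endB i j) (x - endB i j) / tdet.
Proof. by rewrite /lam /endA /endB ordSS ordSK. Qed.

Lemma lam_ord_pred j x : lam (ord_pred j) x = cross (endA i j - V j) (x - V j) / tdet.
Proof. by rewrite /lam /endA /endB ord_predpred ord_predK. Qed.

Lemma lam_aff j x y (s : R) : lam j (x + s *: (y - x)) = (1 - s) * lam j x + s * lam j y.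
Proof. by rewrite /lam /cross /= /GRing.scale/=; ring. Qed.

Lemma lam_lin j : exists g : R * R, exists c : R, (tdet != 0 -> g != 0) /\ forall x, lam j x = c + g.1 * x.1 + g.2 * x.2.
Proof.
exists (- (endB i j - endA i j).2 / tdet, (endB i j - endA i j).1 / tdet).
exists (- cross (endB i j - endA i j) (endA i j) / tdet); split; last first.
  by move=> x; rewrite /lam /cross/=; ring.
move=> D0; apply/eqP => -[] /eqP; rewrite mulf_eq0 invr_eq0 (negbTE D0) orbF oppr_eq0 => /eqP h1.
move=> /eqP; rewrite mulf_eq0 invr_eq0 (negbTE D0) orbF => /eqP h2.
move: D0; rewrite (tdetE j) /cross/=; rewrite (_ : _ - _ =
   ((endB i j).2 - (endA i j).2) * ((endA i j).1 - (V j).1) - ((endB i j).1 - (endA i j).1) * ((endA i j).2 - (V j).2)).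
  by rewrite h1 h2 !mul0r subrr eqxx.
by ring.
Qed.

Hypothesis D0 : tdet != 0.

Lemma lam_sum x : \sum_j lam j x = 1.
Proof.
rewrite (sum3E _ ord0) lam_ordS lam_ord_pred /lam -!mulrDl.
apply: (mulIf D0); rewrite divfK// mul1r [RHS](tdetE ord0) /cross/=; ring.
Qed.

Lemma lam_comb x : \sum_j lam j x *: V j = x.
Proof.
rewrite (sum3E _ ord0) lam_ordS lam_ord_pred /lam.
apply: (scalerI D0); rewrite !scalerDr !scalerA ![tdet * (_ / _)]mulrCA divff// !mulr1.
rewrite (tdetE ord0) /endA /endB /cross [LHS]surjective_pairing [RHS]surjective_pairing /=.
by congr pair; rewrite /GRing.scale/=; ring.
Qed.

Lemma lam_bary (l : 'I_3 -> R) j : \sum_j l j = 1 -> lam j (\sum_j l j *: V j) = l j.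
Proof.
rewrite !(sum3E _ j) => l1.
apply: (mulIf D0); rewrite divfK// [in RHS](tdetE j).
have -> : l j = 1 - l (ordS j) - l (ord_pred j) by rewrite -l1; ring.
by rewrite /endA /endB /cross/= /GRing.scale/=; ring.
Qed.

Lemma triP x : tri i x <-> forall j, 0 <= lam j x.
Proof.
split=> [[l [l0 l1 ->]] j|h]; first by rewrite lam_bary.
by exists (lam^~ x); split => //; rewrite ?lam_sum ?lam_comb.
Qed.

Lemma lam_vtx j j' : lam j (V j') = (j == j')%:R.
Proof.
have -> : V j' = \sum_k (k == j')%:R *: V k.
  by rewrite (bigD1 j')//= eqxx scale1r big1 ?addr0// => k /negbTE ->; rewrite scale0r.
rewrite lam_bary// (bigD1 j')//= eqxx big1 ?addr0// => k /negbTE -> //.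
Qed.

Lemma lam_le1 x j : tri i x -> lam j x <= 1.
Proof.
move=> /triP h; rewrite -(lam_sum x) (bigD1 j)//= lerDl; exact: sumr_ge0.
Qed.

Lemma tri_vtx j : tri i (V j).
Proof. by apply/triP => j'; rewrite lam_vtx. Qed.

Lemma tri_convex x y s : tri i x -> tri i y -> 0 <= s <= 1 -> tri i (x + s *: (y - x)).
Proof.
move=> /triP hx /triP hy /andP[s0 s1]; apply/triP => j; rewrite lam_aff.
by rewrite addr_ge0// mulr_ge0// subr_ge0.
Qed.

Lemma edgeP j x : edge i j x <-> tri i x /\ lam j x = 0.
Proof.
split=> [[s /=]|[/triP h lj]].
  rewrite in_itv/= => s01 <-; split; first by apply: tri_convex => //; exact: tri_vtx.
  rewrite /pt_on lam_aff !lam_vtx.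
  by rewrite neq_ordS neq_ord_pred !mulr0 addr0.
exists (lam (ord_pred j) x).
  rewrite /= in_itv/= h/= lam_le1//; exact/triP.
have := lam_sum x; have := lam_comb x; rewrite !(sum3E _ j) lj scale0r !add0r => e1 e2.
rewrite /pt_on -[RHS]e1 -(_ : 1 - lam (ord_pred j) x = lam (ordS j) x); last by rewrite -e2; ring.
by rewrite scalerBl scalerBr scale1r /endA /endB addrA addrAC.
Qed.

(** The coordinates at the ends of the edge opposite to the vertex j are the
    affine coordinates with origin at this vertex. *)
Lemma lam_rep j x : x = V j + lam (ordS j) x *: (endA i j - V j) + lam (ord_pred j) x *: (endB i j - V j).
Proof.
have := lam_sum x; have := lam_comb x; rewrite !(sum3E _ j) => e1 e2.
rewrite -[LHS]e1 (_ : lam j x = 1 - lam (ordS j) x - lam (ord_pred j) x); last by rewrite -e2; ring.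
by rewrite !scalerBl !scalerBr scale1r /endA /endB; ring.
Qed.

Lemma lam_of_rep j a b : let x := V j + a *: (endA i j - V j) + b *: (endB i j - V j) in
  [/\ lam j x = 1 - a - b, lam (ordS j) x = a & lam (ord_pred j) x = b].
Proof.
move=> x; rewrite lam_ordS lam_ord_pred /lam; split.
- by apply: (mulIf D0); rewrite divfK// (tdetE j) /x /endA /endB /cross/= /GRing.scale/=; ring.
- by apply: (mulIf D0); rewrite divfK// (tdetE j) /x /endA /endB /cross/= /GRing.scale/=; ring.
- by apply: (mulIf D0); rewrite divfK// (tdetE j) /x /endA /endB /cross/= /GRing.scale/=; ring.
Qed.

End Tri.

(** * Topology of a mesh of triangles *)
Section MeshTop.
Variable R : realType.
Implicit Types (x y z : R * R).
Variable M : mesh R.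

Definition Umesh : set (R * R) := [set x | exists i : 'I_(ntri M), tri i x].

Lemma nbhs_line x (d : R * R) (A : set (R * R)) : nbhs x A ->
  exists2 e : R, 0 < e & forall s, `|s| < e -> A (x + s *: d).
Proof.
move=> /nbhs_prodP[e e0 he].
pose K := 1 + `|d.1| + `|d.2|.
have K0 : 0 < K by rewrite /K -addrA ltr_pwDl// addr_ge0.
exists (e / K); first by rewrite divr_gt0.
move=> s hs; have hs' : `|s| * K < e by rewrite -ltr_pdivlMr.
have := normr_ge0 d.1; have := normr_ge0 d.2 => d2 d1.
apply: he; rewrite /= opprD addrA subrr sub0r normrN normrM; apply: le_lt_trans hs';
  apply: ler_wpM2l => //; rewrite /K; lra.
Qed.

(** A flat triangle lies in a line through its vertices, which has no interior. *)
Lemma interior_tdet (i : 'I_(ntri M)) : interior (tri i) !=set0 -> tdet i != 0.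
Proof.
move=> [c hc]; apply/eqP => D0.
have inS (d : R * R) : exists2 e : R, 0 < e & tri i (c + e *: d).
  have [e e0 he] := nbhs_line d hc; exists (e / 2); first by rewrite divr_gt0.
  by apply: he; rewrite gtr0_norm ?divr_gt0//; lra.
pose U1 := vtx i (ordS ord0) - vtx i ord0; pose U2 := vtx i (ord_pred ord0) - vtx i ord0.
have flat x : tri i x -> exists l1 l2, x = vtx i ord0 + l1 *: U1 + l2 *: U2 /\
   cross U1 (x - vtx i ord0) = 0 /\ cross U2 (x - vtx i ord0) = 0.
  move=> [l [_]]; rewrite !(sum3E _ ord0) => l1 xE; exists (l (ordS ord0)), (l (ord_pred ord0)).
  have xE' : x = vtx i ord0 + l (ordS ord0) *: U1 + l (ord_pred ord0) *: U2.
    rewrite xE (_ : l ord0 = 1 - l (ordS ord0) - l (ord_pred ord0)); last by rewrite -l1; ring.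
    by rewrite !scalerBl !scalerBr scale1r; ring.
  split => //; rewrite xE'.
  have e1 : cross U1 (vtx i ord0 + l (ordS ord0) *: U1 + l (ord_pred ord0) *: U2 - vtx i ord0) = l (ord_pred ord0) * cross U1 U2.
    by rewrite /cross/= /GRing.scale/=; ring.
  have e2 : cross U2 (vtx i ord0 + l (ordS ord0) *: U1 + l (ord_pred ord0) *: U2 - vtx i ord0) = - l (ordS ord0) * cross U1 U2.
    by rewrite /cross/= /GRing.scale/=; ring.
  by rewrite e1 e2 (_ : cross U1 U2 = 0)// !mulr0.
have ci : tri i c by exact: interior_subset.
have cr (U : R * R) : (forall x, tri i x -> cross U (x - vtx i ord0) = 0) -> U = 0.
  move=> h.
  have hd (d : R * R) : cross U d = 0.
    have [e e0 /h] := inS d; have := h _ ci.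
    rewrite (_ : cross U (c + e *: d - vtx i ord0) = cross U (c - vtx i ord0) + e * cross U d).
      by move=> ->; rewrite add0r => /eqP; rewrite mulf_eq0 gt_eqF//= => /eqP.
    by rewrite /cross/= /GRing.scale/=; ring.
  have := hd (1, 0); have := hd (0, 1); rewrite /cross/= !mulr0 !mulr1 sub0r subr0 => h1 /eqP.
  by rewrite oppr_eq0 => /eqP h2; rewrite [LHS]surjective_pairing h1 h2.
have U10 : U1 = 0 by apply: cr => x /flat[? [? [_ []]]].
have U20 : U2 = 0 by apply: cr => x /flat[? [? [_ []]]].
have [e e0 he] := inS (1, 0).
have [? [? []]] := flat _ he; have [? [? []]] := flat _ ci.
rewrite U10 U20 !scaler0 !addr0 => cE _ cE' _.
move: cE'; rewrite cE => /(congr1 fst) /= /eqP.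
by rewrite -subr_eq0 addrAC subrr add0r /GRing.scale/= mulr1 gt_eqF.
Qed.

Lemma lam_continuous (i : 'I_(ntri M)) j : continuous (lam i j).
Proof.
have [g [c [_ h]]] := lam_lin i j.
rewrite (_ : lam i j = (fun x => c + g.1 * x.1 + g.2 * x.2)); last exact/funext.
move=> x; apply: cvgD; first apply: cvgD; first exact: cvg_cst.
  by apply: cvgM; [exact: cvg_cst|exact: cvg_fst].
by apply: cvgM; [exact: cvg_cst|exact: cvg_snd].
Qed.

Lemma lam_gt0_nbhs (i : 'I_(ntri M)) j x : 0 < lam i j x -> \forall y \near x, 0 < lam i j y.
Proof. by move=> h; exact: (cvgr_gt _ (@lam_continuous i j x)). Qed.

Lemma lam_lt0_nbhs (i : 'I_(ntri M)) j x : lam i j x < 0 -> \forall y \near x, lam i j y < 0.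
Proof. by move=> h; exact: (cvgr_lt _ (@lam_continuous i j x)). Qed.

(** For a nondegenerate triangle this is its interior; as a set given by strict
    inequalities it is open by construction. *)
Definition otri (i : 'I_(ntri M)) : set (R * R) := [set x | forall j, 0 < lam i j x].

Lemma open_otri i : open (otri i).
Proof.
rewrite openE => x h; have := @filter_forall (R * R)%type 'I_3 (fun j y => 0 < lam i j y) (nbhs x) _.
by apply => j; exact: lam_gt0_nbhs.
Qed.

Hypothesis nd : forall i : 'I_(ntri M), tdet i != 0.

Lemma otri_tri i x : otri i x -> tri i x.
Proof. by move=> h; apply/triP => // j; exact: ltW. Qed.

Lemma closed_tri (i : 'I_(ntri M)) : closed (tri i).
Proof.
rewrite -openC openE => x nx.
have [j hj] : exists j, lam i j x < 0.
  apply: contrapT => h; apply: nx; apply/triP => // j; rewrite leNgt; apply/negP => hj.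
  by apply: h; exists j.
apply: filterS (lam_lt0_nbhs hj) => y hy /(triP (nd i)) /(_ j).
by rewrite leNgt hy.
Qed.

Lemma closed_Umesh : closed Umesh.
Proof.
have -> : Umesh = \bigcup_(i in [set: 'I_(ntri M)]) tri i.
  by apply/seteqP; split => x [i]; [move=> ?; exists i|move=> _ ?; exists i].
by apply: closed_bigcup => [|i _]; [exact: finite_finset|exact: closed_tri].
Qed.

Lemma otri_Omegah i x : otri i x -> Omegah M x.
Proof.
move=> h; rewrite /Omegah /interior.
by apply: filterS (open_otri h) => y /otri_tri hy; exists i.
Qed.

Lemma tri_near_otri (i : 'I_(ntri M)) x : tri i x -> forall s, 0 < s <= 1 ->
  otri i (x + s *: ((\sum_j 3^-1 *: vtx i j) - x)).
Proof.
move=> /(triP (nd i)) h s /andP[s0 s1] j; rewrite lam_aff lam_bary//.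
  by rewrite ltr_wpDl// ?mulr_gt0 ?invr_gt0// mulr_ge0// subr_ge0.
by rewrite (sum3E _ ord0); lra.
Qed.

Lemma closure_Omegah : closure (Omegah M) = Umesh.
Proof.
apply/seteqP; split.
  rewrite [X in _ `<=` X](closure_id _).1; last exact: closed_Umesh.
  by apply: closure_subset; exact: interior_subset.
move=> x [i hi] A /(nbhs_line ((\sum_j 3^-1 *: vtx i j) - x)) [e e0 he].
pose s := Num.min (e / 2) 1.
have s0 : 0 < s by rewrite lt_min ltr01 divr_gt0.
exists (x + s *: ((\sum_j 3^-1 *: vtx i j) - x)); split.
  by apply: (otri_Omegah (i := i)); apply: tri_near_otri; rewrite // s0 ge_min lexx orbT.
apply: he; rewrite gtr0_norm// /s gt_min; apply/orP; left; lra.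
Qed.

(** The polygon, defined as an interior, is its own interior, and its closure is
    the union of the triangles because each of them is the closure of otri. *)
Lemma GammahP x : Gammah M x <-> Umesh x /\ ~ Omegah M x.
Proof. by rewrite /Gammah /bdry closure_Omegah /Omegah (interior_id _).1//; exact: open_interior. Qed.

(** An affine function is determined by its values at the vertices of i. *)
Lemma lam_affcomb (i i' : 'I_(ntri M)) j' x :
  lam i' j' x = \sum_k lam i k x * lam i' j' (vtx i k).
Proof.
have [g [c [_ h]]] := lam_lin i' j'.
have e1 := lam_sum (nd i) x; have e2 := lam_comb (nd i) x.
rewrite h -[in LHS]e2 -[c]mulr1 -[in LHS]e1.
have -> : \sum_k lam i k x * lam i' j' (vtx i k) = \sum_k lam i k x * (c + g.1 * (vtx i k).1 + g.2 * (vtx i k).2).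
  by apply: eq_bigr => k _; rewrite h.
by rewrite !(sum3E _ ord0) /= /GRing.scale/=; ring.
Qed.

Lemma lam_inj (i : 'I_(ntri M)) x y : (forall j, lam i j x = lam i j y) -> x = y.
Proof.
move=> h; rewrite -(lam_comb (nd i) x) -(lam_comb (nd i) y).
by apply: eq_bigr => j _; rewrite h.
Qed.
End MeshTop.

(** * Boundary edges of a conforming mesh *)
Section Conf.
Variable R : realType.
Implicit Types (x y z : R * R).
Variable M : mesh R.
Hypothesis cM : conforming M.

Lemma conf_nd (i : 'I_(ntri M)) : tdet i != 0.
Proof. by apply: interior_tdet; case: cM => + _; exact. Qed.
Local Notation nd := conf_nd.

Lemma tri_nbhs (i : 'I_(ntri M)) j x : 0 < lam i (ordS j) x -> 0 < lam i (ord_pred j) x ->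
  \forall y \near x, 0 <= lam i j y -> tri i y.
Proof.
move=> h1 h2; have := lam_gt0_nbhs h1; have := lam_gt0_nbhs h2.
apply: filterS2 => y y2 y1 y0; apply/(triP (nd i)) => k.
by case: (ord3P j k) => ->; rewrite ?(ltW y1)// ltW.
Qed.

(** Two triangles with a common edge lie on opposite sides of it, otherwise they
    would meet outside the edge; together they cover a neighbourhood of x. *)
Lemma shared_edge_interior (i i' : 'I_(ntri M)) j j' x :
  edge i j = edge i' j' -> tri i `&` tri i' = edge i j ->
  edge i j x -> 0 < lam i (ordS j) x -> 0 < lam i (ord_pred j) x -> Omegah M x.
Proof.
move=> eij tij ex xA xB.
pose A := endA i j; pose B := endB i j.
have lamA k : lam i k A = (k == ordS j)%:R by exact: (lam_vtx (nd i)).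
have lamB k : lam i k B = (k == ord_pred j)%:R by exact: (lam_vtx (nd i)).
have eA : edge i j A.
  by apply/(edgeP (nd i)); split; [exact: tri_vtx (nd i) _|rewrite lamA neq_ordS].
have eB : edge i j B.
  by apply/(edgeP (nd i)); split; [exact: tri_vtx (nd i) _|rewrite lamB neq_ord_pred].
have [tA' lA'] : tri i' A /\ lam i' j' A = 0 by apply/(edgeP (nd i')); rewrite -eij.
have [tB' lB'] : tri i' B /\ lam i' j' B = 0 by apply/(edgeP (nd i')); rewrite -eij.
have [tx' lx'] : tri i' x /\ lam i' j' x = 0 by apply/(edgeP (nd i')); rewrite -eij.
have [tx lx] : tri i x /\ lam i j x = 0 by apply/(edgeP (nd i)).
(* The two coordinates vanish on the common edge, hence are proportional. *)
pose kap := lam i' j' (vtx i j).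
have lamE y : lam i' j' y = lam i j y * kap.
  by rewrite (lam_affcomb nd i) (sum3E _ j) -/A -/B -/kap lA' lB' !mulr0 !addr0.
pose O' := vtx i' j'.
have lamO' : lam i j O' * kap = 1 by rewrite -lamE (lam_vtx (nd i')) eqxx.
(* Otherwise a point of i' slightly off the edge towards O' would lie in i too. *)
have k0 : kap < 0.
  rewrite ltNge; apply/negP => k_ge0.
  have lO'0 : 0 < lam i j O'.
    rewrite ltNge; apply/negP => h; have : lam i j O' * kap <= 0 by apply: mulr_le0_ge0.
    by rewrite lamO' ler10.
  have [e e0 he] := nbhs_line (O' - x) (tri_nbhs xA xB).
  pose s := Num.min (e / 2) 1.
  have s0 : 0 < s by rewrite lt_min ltr01 divr_gt0.
  have s1 : s <= 1 by rewrite ge_min lexx orbT.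
  have se : `|s| < e by rewrite gtr0_norm// gt_min; apply/orP; left; lra.
  have ly : lam i j (x + s *: (O' - x)) = s * lam i j O' by rewrite lam_aff lx mulr0 add0r.
  have ty : tri i (x + s *: (O' - x)) by apply: he; rewrite // ly mulr_ge0 ?ltW.
  have ty' : tri i' (x + s *: (O' - x)).
    by apply: (tri_convex (nd i')) => //; [exact: tri_vtx (nd i') _|rewrite s1 ltW].
  have /(edgeP (nd i))[_] : edge i j (x + s *: (O' - x)) by rewrite -tij.
  by move=> /eqP; rewrite ly mulf_eq0 !gt_eqF.
have xE k : lam i' k x = lam i (ordS j) x * lam i' k A + lam i (ord_pred j) x * lam i' k B.
  by rewrite (lam_affcomb nd i) (sum3E _ j) lx mul0r add0r.
have AB : A <> B.
  move=> eqAB; have := lamA (ordS j); rewrite eqAB lamB eqxx.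
  by rewrite -ordSS neq_ordS => /eqP; rewrite eq_sym oner_eq0.
(* The ends of the edge of i are those of the edge of i', so x is relatively
   interior to the latter. *)
have pos k : k != j' -> 0 < lam i' k x.
  move=> kj; have /(triP (nd i')) hA := tA'; have /(triP (nd i')) hB := tB'.
  have /(triP (nd i')) hx := tx'; rewrite lt_neqAle hx andbT; apply/eqP => l0.
  move: l0; rewrite xE => /esym/eqP; rewrite (paddr_eq0 (mulr_ge0 (ltW xA) (hA k)) (mulr_ge0 (ltW xB) (hB k))).
  rewrite (mulf_eq0 (lam i (ordS j) x)) (mulf_eq0 (lam i (ord_pred j) x)).
  rewrite (gt_eqF xA) (gt_eqF xB)/= => /andP[/eqP a0 /eqP b0].
  apply: AB; apply: (lam_inj nd (i := i')) => k'.
  have sA := lam_sum (nd i') A; have sB := lam_sum (nd i') B.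
  move: sA sB; rewrite !(sum3E _ j') lA' lB' !add0r.
  case: (ord3P j' k) a0 b0 kj => ->; rewrite ?eqxx// => a0 b0 _; rewrite a0 b0 ?add0r ?addr0 => sA sB;
  by case: (ord3P j' k') => ->; rewrite ?lA' ?lB' ?a0 ?b0 ?sA ?sB.
have p1 : 0 < lam i' (ordS j') x by apply: pos; rewrite eq_sym neq_ordS.
have p2 : 0 < lam i' (ord_pred j') x by apply: pos; rewrite eq_sym neq_ord_pred.
rewrite /Omegah /interior; have := tri_nbhs xA xB; have := tri_nbhs p1 p2.
apply: filterS2 => y h' h; have [l0|l0] := leP 0 (lam i j y).
  by exists i; exact: h.
by exists i'; apply: h'; rewrite lamE mulr_le0// ltW.
Qed.

Lemma midpoint_lam (i : 'I_(ntri M)) j : let x := endA i j + 2^-1 *: (endB i j - endA i j) in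
  [/\ edge i j x, 0 < lam i (ordS j) x & 0 < lam i (ord_pred j) x].
Proof.
move=> x; split.
- by exists 2^-1 => //=; rewrite in_itv/=; apply/andP; split; lra.
- rewrite lam_aff !(lam_vtx (nd i)) eqxx -ordSS neq_ordS /= mulr1 mulr0; lra.
rewrite lam_aff !(lam_vtx (nd i)) eqxx -ordSS eq_sym neq_ordS /= mulr1 mulr0; lra.
Qed.

(** Another triangle through x would have to share the edge, which is not
    possible on the boundary, or meet i in a vertex or in another edge.  Hence a
    function supported in i which vanishes on the two other edges is continuous. *)
Lemma boundary_edge_isolated (i i' : 'I_(ntri M)) j x : in_Sh i j -> i != i' ->
  tri i x -> tri i' x -> lam i (ordS j) x = 0 \/ lam i (ord_pred j) x = 0.
Proof.
move=> Sh ii' tx tx'; have [_ /(_ _ _ ii')] := cM; case.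
- by move=> h; have : (tri i `&` tri i') x by []; rewrite h.
- move=> [k [k' [_ h]]]; have : (tri i `&` tri i') x by []; rewrite h => ->.
  rewrite !(lam_vtx (nd i)); case: (eqVneq (ordS j) k) => [<-|_]; last by left.
  by right; rewrite -ordSS eq_sym neq_ordS.
move=> [k [k' [ekk tkk]]].
have [kj|kj] := eqVneq k j.
  have [ex x1 x2] := midpoint_lam i j.
  have : Gammah M (endA i j + 2^-1 *: (endB i j - endA i j)) by exact: Sh.
  move=> /(GammahP nd)[_]; case.
  by rewrite -kj in ex x1 x2 *; apply: shared_edge_interior ekk tkk ex x1 x2.
have : (tri i `&` tri i') x by []; rewrite tkk => /(edgeP (nd i)) [_].
by case: (ord3P j k) kj => ->; rewrite ?eqxx// => _ ->; [left|right].
Qed.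

(** If a point of the edge were interior to the polygon, some relatively interior
    point would be too, so a second triangle would be needed on the other side;
    by conformity it shares the whole edge, and x would be interior. *)
Lemma boundary_relint_Sh (i : 'I_(ntri M)) j x : Gammah M x -> edge i j x ->
  0 < lam i (ordS j) x -> 0 < lam i (ord_pred j) x -> in_Sh i j.
Proof.
move=> Gx ex x1 x2 y0 ey0; apply: contrapT => nGy0.
have Oy0 : Omegah M y0.
  apply: contrapT => nO; apply: nGy0; apply/(GammahP nd); split => //.
  by exists i; case/(edgeP (nd i)) : ey0.
(* move y0 into the relative interior *)
have [y [Oy ey y1 y2]] : exists y, [/\ Omegah M y, edge i j y, 0 < lam i (ordS j) y & 0 < lam i (ord_pred j) y].
  have oO : open (Omegah M) by exact: open_interior.
  have [e e0 he] := nbhs_line (x - y0) (open_nbhs_nbhs (conj oO Oy0)).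
  pose s := Num.min (e / 2) 1.
  have s0 : 0 < s by rewrite lt_min ltr01 divr_gt0.
  have s1 : s <= 1 by rewrite ge_min lexx orbT.
  have se : `|s| < e by rewrite gtr0_norm// gt_min; apply/orP; left; lra.
  have [ty0 ly0] := (edgeP (nd i) j y0).1 ey0; have [tx lx] := (edgeP (nd i) j x).1 ex.
  have /(triP (nd i)) hy0 := ty0.
  exists (y0 + s *: (x - y0)); split; first exact: he.
  - apply/(edgeP (nd i)); split; first by apply: (tri_convex (nd i)); rewrite // s1 ltW.
    by rewrite lam_aff lx ly0 !mulr0 addr0.
  - by rewrite lam_aff; apply: ltr_wpDl; [apply: mulr_ge0; [rewrite subr_ge0|exact: hy0]|exact: mulr_gt0].
  - by rewrite lam_aff; apply: ltr_wpDl; [apply: mulr_ge0; [rewrite subr_ge0|exact: hy0]|exact: mulr_gt0].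
have [ty ly] := (edgeP (nd i) j y).1 ey.
(* The points beyond the edge near y are in the polygon and not in i. *)
have [i' [ii' ty']] : exists i', i != i' /\ tri i' y.
  apply: contrapT => no.
  have : \forall z \near y, forall i', i != i' -> ~ tri i' z.
    have := @filter_forall (R * R)%type _ (fun i' z => i != i' -> ~ tri i' z) (nbhs y) _.
    apply => i'; have [e|ii'] := eqVneq i i'; first by near=> z => /eqP.
    have : nbhs y (~` tri i').
      apply: open_nbhs_nbhs; split; first exact/closed_openC/closed_tri/nd.
      by move=> h; apply: no; exists i'.
    by apply: filterS => z nz _.
  move=> nO; have [e e0 he] := nbhs_line (y - vtx i j) (filterI nO Oy).
  have e2 : 0 < e / 2 by rewrite divr_gt0.
  have [|h1 [i' h2]] := he (e / 2); first by rewrite gtr0_norm//; lra.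
  have [ii'|ii'] := eqVneq i i'; last exact: (h1 i').
  move: h2; rewrite -ii' => /(triP (nd i)) /(_ j).
  have -> : y + (e / 2) *: (y - vtx i j) = y + (- (e / 2)) *: (vtx i j - y).
    by rewrite scaleNr -scalerN opprB.
  by rewrite lam_aff ly mulr0 add0r (lam_vtx (nd i)) eqxx mulr1 oppr_ge0 leNgt e2.
have [_ /(_ _ _ ii')] := cM; case.
- by move=> h; have : (tri i `&` tri i') y by []; rewrite h.
- move=> [k [k' [_ h]]]; have : (tri i `&` tri i') y by []; rewrite h => yE.
  move: y1 y2; rewrite yE !(lam_vtx (nd i)).
  case: (eqVneq (ordS j) k) => [<-|_]; last by rewrite ltxx.
  by rewrite -ordSS eq_sym neq_ordS ltxx.
move=> [k [k' [ekk tkk]]].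
have : (tri i `&` tri i') y by []; rewrite tkk => /(edgeP (nd i)) [_ lk].
have kj : k = j.
  by case: (ord3P j k) lk => -> // lk; move: y1 y2; rewrite lk ltxx.
move: Gx => /(GammahP nd)[_]; apply.
by rewrite kj in ekk tkk; apply: shared_edge_interior ekk tkk ex x1 x2.
Unshelve. all: end_near.
Qed.

(** A nonzero linear functional is maximal at a vertex, and never at an interior
    point, so at a boundary vertex.  Applied to the coordinates, this puts the
    polygon in any box that contains Gamma. *)
Lemma Umesh_halfplane (d : R * R) (B : R) :
  d != 0 ->
  (forall (i : 'I_(ntri M)) j, Gammah M (vtx i j) -> d.1 * (vtx i j).1 + d.2 * (vtx i j).2 <= B) ->
  forall x, Umesh M x -> d.1 * x.1 + d.2 * x.2 <= B.
Proof.
move=> d0 hB x [i0 tx0].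
pose f y := d.1 * y.1 + d.2 * y.2.
pose m := [arg max_(p > (i0, ord0) : 'I_(ntri M) * 'I_3) f (vtx p.1 p.2)]%O.
have mP (i : 'I_(ntri M)) j : f (vtx i j) <= f (vtx m.1 m.2).
  by rewrite /m; case: Order.TotalTheory.arg_maxP => // p _ /(_ (i, j)); exact.
have fU y : @Umesh R M y -> f y <= f (vtx m.1 m.2).
  move=> [i ty]; have /(triP (nd i)) hy := ty.
  have e1 := lam_sum (nd i) y; have e2 := lam_comb (nd i) y.
  have -> : f y = \sum_j lam i j y * f (vtx i j).
    by rewrite -[in LHS]e2 !(sum3E _ ord0) /f /= /GRing.scale/=; ring.
  rewrite -[leRHS]mul1r -e1 mulr_suml; apply: ler_sum => j _.
  by apply: ler_wpM2l; [exact: hy|exact: mP].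
rewrite -/(f x); apply: (le_trans (fU x _)); first by exists i0.
apply: hB; apply/(GammahP nd); split; first by exists m.1; exact: tri_vtx (nd _) _.
move=> /(nbhs_line d)[e e0 he].
have [|i ti] := he (e / 2); first by rewrite gtr0_norm ?divr_gt0//; lra.
have := fU _ (ex_intro _ i ti).
have -> : f (vtx m.1 m.2 + (e / 2) *: d) = f (vtx m.1 m.2) + (e / 2) * (d.1 ^+ 2 + d.2 ^+ 2).
  by rewrite /f/= /GRing.scale/=; ring.
rewrite leNgt ltrDl mulr_gt0 ?divr_gt0//.
rewrite lt_neqAle addr_ge0 ?sqr_ge0// andbT eq_sym.
rewrite paddr_eq0 ?sqr_ge0// !sqrf_eq0; apply: contra d0 => /andP[/eqP d1 /eqP d2].
by rewrite [d]surjective_pairing d1 d2.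
Qed.
End Conf.

(** * Charts of a smooth boundary *)
Section Chart.
Variable R : realType.
Implicit Types (x y z p t : R * R).

(** The Euclidean norm, whereas `|x| is the maximum of the coordinates. *)
Definition enorm x : R := Num.sqrt (x.1 ^+ 2 + x.2 ^+ 2).

Lemma edistE x y : edist x y = enorm (x - y). Proof. by []. Qed.

Lemma enorm_ge0 x : 0 <= enorm x. Proof. exact: sqrtr_ge0. Qed.

Lemma enorm_sqr x : enorm x ^+ 2 = x.1 ^+ 2 + x.2 ^+ 2.
Proof. by rewrite sqr_sqrtr// addr_ge0// sqr_ge0. Qed.

Lemma enormN x : enorm (- x) = enorm x. Proof. by rewrite /enorm /= !sqrrN. Qed.

Lemma enormZ a x : enorm (a *: x) = `|a| * enorm x.
Proof. by rewrite /enorm /= /GRing.scale/= !exprMn -mulrDr sqrtrM ?sqr_ge0// sqrtr_sqr. Qed.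

Lemma enorm_eq0 x : enorm x = 0 -> x = 0.
Proof.
move=> h; have := enorm_sqr x; rewrite h expr0n/= => /esym/eqP.
rewrite paddr_eq0 ?sqr_ge0// !sqrf_eq0 => /andP[/eqP e1 /eqP e2].
by rewrite [x]surjective_pairing e1 e2.
Qed.

Lemma dot_le_enorm x y : `|x.1 * y.1 + x.2 * y.2| <= enorm x * enorm y.
Proof.
rewrite -ler_sqr ?nnegrE ?mulr_ge0 ?enorm_ge0//.
rewrite exprMn !enorm_sqr real_normK ?num_real// -subr_ge0.
by rewrite (_ : _ - _ = (x.1 * y.2 - x.2 * y.1) ^+ 2) ?sqr_ge0//; ring.
Qed.

Lemma cross_le_enorm x y : `|cross x y| <= enorm x * enorm y.
Proof.
have := dot_le_enorm x (y.2, - y.1); rewrite /cross /enorm /= sqrrN addrC mulrN.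
by rewrite [y.2 ^+ 2 + _]addrC [- _ + _]addrC.
Qed.

Lemma enorm_triangle x y : enorm (x + y) <= enorm x + enorm y.
Proof.
rewrite -ler_sqr ?nnegrE ?addr_ge0 ?enorm_ge0// sqrrD !enorm_sqr /=.
have := ler_norm (x.1 * y.1 + x.2 * y.2); have := dot_le_enorm x y; set n := `|_|; lra.
Qed.

Lemma edistC x y : edist x y = edist y x.
Proof. by rewrite !edistE -enormN opprB. Qed.

Lemma edist_triangle y x z : edist x z <= edist x y + edist y z.
Proof. by rewrite !edistE (le_trans _ (enorm_triangle _ _))// addrA subrK. Qed.

Lemma enorm_le_sum x : enorm x <= `|x.1| + `|x.2|.
Proof.
rewrite -ler_sqr ?nnegrE ?addr_ge0 ?enorm_ge0// enorm_sqr sqrrD !real_normK ?num_real//.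
by rewrite -addrA lerD2l lerDr mulrn_wge0// mulr_ge0.
Qed.

Lemma nbhs_edist p (r : R) : 0 < r -> \forall x \near p, edist p x < r.
Proof.
move=> r0; apply/nbhs_prodP; exists (r / 2); first by rewrite divr_gt0.
move=> y h1 h2; rewrite edistE (le_lt_trans (enorm_le_sum _))//=; lra.
Qed.

(** The coordinates of x along the two axes of frame p t. *)
Definition frame_s p t x : R := (x.1 - p.1) * t.1 + (x.2 - p.2) * t.2.
Definition frame_u p t x : R := - (x.1 - p.1) * t.2 + (x.2 - p.2) * t.1.

Lemma unitP t : edist 0 t = 1 -> t.1 ^+ 2 + t.2 ^+ 2 = 1.
Proof. by move=> h; rewrite -(enorm_sqr t) -enormN -[- t]sub0r -edistE h expr1n. Qed.

Lemma frame_coord p t x : edist 0 t = 1 -> frame p t (frame_s p t x) (frame_u p t x) = x.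
Proof.
move=> /unitP h; rewrite [RHS]surjective_pairing [LHS]surjective_pairing.
rewrite /frame /rot90 /frame_s /frame_u /= /GRing.scale/=; congr pair.
  transitivity (p.1 + (x.1 - p.1) * (t.1 ^+ 2 + t.2 ^+ 2)); first by ring.
  by rewrite h; ring.
transitivity (p.2 + (x.2 - p.2) * (t.1 ^+ 2 + t.2 ^+ 2)); first by ring.
by rewrite h; ring.
Qed.

Lemma frame_s_le p t x y : edist 0 t = 1 -> `|frame_s p t x - frame_s p t y| <= edist x y.
Proof.
move=> h; have t1 : enorm t = 1 by rewrite -h edistE sub0r enormN.
by have := dot_le_enorm (x - y) t; rewrite t1 mulr1 edistE; apply: le_trans; rewrite le_eqVlt; apply/orP; left; apply/eqP; congr `|_|; rewrite /frame_s/=; ring.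
Qed.

Lemma frame_s0 p t : frame_s p t p = 0. Proof. by rewrite /frame_s; ring. Qed.

Lemma bdry_closed (A : set (R * R)) : closed (bdry A).
Proof.
apply: closedI; first exact: closed_closure.
by apply: open_closedC; exact: open_interior.
Qed.

Lemma bdry_compact (A : set (R * R)) : bounded_set A -> compact (bdry A) /\ exists D : R, bdry A `<=` box D.
Proof.
move=> [B [_ hB]].
pose D := `|B| + 1.
have AD : A `<=` box D.
  move=> x Ax; have : `|x| <= D by apply: (hB D) => //; rewrite /D (le_lt_trans (ler_norm B))// ltrDl.
  by rewrite prod_normE ge_max => /andP[h1 h2]; apply/boxP.
have cK : compact (box D : set (R * R)).
  by apply: compact_setX; exact: segment_compact.
have AD' : bdry A `<=` box D.
  move=> x [+ _]; have := @closure_subset _ _ _ AD; move=> /[apply].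
  by rewrite -(closure_id _).1//; apply: compact_closed => //; exact: norm_hausdorff.
split; last by exists D.
by apply: subclosed_compact cK _ => //; exact: bdry_closed.
Qed.

Section oneChart.
Variables (Omega : set (R * R)) (p t : R * R) (r : R) (phi : R -> R).
Hypotheses (oO : open Omega) (t1 : edist 0 t = 1) (cphi : continuous phi).
Hypothesis chart : forall s u, disc p r (frame p t s u) -> (Omega (frame p t s u) <-> phi s < u).

(** A boundary point of the epigraph of phi cannot lie strictly below the graph,
    by continuity, nor in the open set Omega; conversely moving up from the graph
    leads into Omega. *)
Lemma bdry_chart x : edist p x < r -> (bdry Omega x <-> frame_u p t x = phi (frame_s p t x)).
Proof.
move=> xr; have xE := frame_coord p x t1.
have hO y : edist p y < r -> Omega y <-> phi (frame_s p t y) < frame_u p t y.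
  by move=> yr; rewrite -{1}(frame_coord p y t1); apply: chart; rewrite frame_coord.
have bO y : bdry Omega y <-> closure Omega y /\ ~ Omega y.
  by rewrite /bdry (interior_id _).1.
have cs : continuous (frame_s p t).
  move=> y; rewrite /frame_s; apply: cvgD; apply: cvgM; try exact: cvg_cst; apply: cvgB; try exact: cvg_cst.
    exact: cvg_fst.
  exact: cvg_snd.
have cu : continuous (frame_u p t).
  move=> y; rewrite /frame_u; apply: cvgD; apply: cvgM; try exact: cvg_cst; last first.
    by apply: cvgB; [exact: cvg_snd|exact: cvg_cst].
  by apply: cvgN; apply: cvgB; [exact: cvg_fst|exact: cvg_cst].
rewrite bO; split.
  move=> [clx nOx]; apply/eqP; rewrite eq_le; apply/andP; split.
    by rewrite leNgt; apply/negP => h; apply: nOx; apply/hO.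
  rewrite leNgt; apply/negP => h.
  have : \forall y \near x, frame_u p t y - phi (frame_s p t y) < 0.
    have c : (fun y => frame_u p t y - phi (frame_s p t y)) @ x --> frame_u p t x - phi (frame_s p t x).
      by apply: cvgB; [exact: cu|exact: (continuous_comp (cs x) (@cphi _))].
    by apply: (cvgr_lt _ c); rewrite subr_lt0.
  have near_r : \forall y \near x, edist p y < r.
    have := nbhs_edist x (r := r - edist p x); rewrite subr_gt0 => /(_ xr).
    by apply: filterS => y hy; rewrite (le_lt_trans (edist_triangle x _ _))//; lra.
  move=> h2; have [y [Oy [hy hr]]] := clx _ (filterI h2 near_r).
  by move: Oy => /(hO _ hr); rewrite -subr_gt0 => h3; move: hy; lra.
move=> e; split; last by move=> /(hO _ xr); rewrite e ltxx.
move=> A /nbhs_line; move=> /(_ (rot90 t))[ep ep0 he].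
pose s := Num.min (ep / 2) ((r - edist p x) / 2).
have s0 : 0 < s by rewrite lt_min !divr_gt0// subr_gt0.
have se : `|s| < ep by rewrite gtr0_norm// gt_min; apply/orP; left; lra.
exists (x + s *: rot90 t); split; last exact: he.
have nr : enorm (rot90 t) = 1.
  by rewrite /enorm /rot90/= sqrrN addrC (unitP t1) sqrtr1.
have hr : edist p (x + s *: rot90 t) < r.
  rewrite (le_lt_trans (edist_triangle x _ _))// edistE edistE opprD addrA subrr sub0r enormN enormZ nr mulr1.
  rewrite gtr0_norm// -edistE.
  have : s <= (r - edist p x) / 2 by rewrite ge_min lexx orbT.
  by lra.
apply/(hO _ hr).
have -> : frame_s p t (x + s *: rot90 t) = frame_s p t x by rewrite /frame_s /rot90/= /GRing.scale/=; ring.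
have -> : frame_u p t (x + s *: rot90 t) = frame_u p t x + s * (t.1 ^+ 2 + t.2 ^+ 2).
  by rewrite /frame_u /rot90/= /GRing.scale/=; ring.
by rewrite (unitP t1) e mulr1 ltrDl.
Qed.
End oneChart.
End Chart.

(** * Intersections of transversal lines with the boundary *)
Section Nodes.
Variable R : realType.
Implicit Types (x y z p t A B N O P : R * R).

Lemma Cn1_C1 n (phi : R -> R) : (0 < n)%N -> Cn1 n phi ->
  (forall s, derivable phi s 1) /\ continuous (derive1 phi).
Proof.
case: n => // n _ [d c]; split; first by move=> s; exact: (d 0%N).
case: n d c => [|n] d c; first by rewrite -derive1n1.
have d1 := d 1%N isT; rewrite derive1n1 in d1.
by move=> x; apply: differentiable_continuous; exact/derivable1_diffP.
Qed.

(** The mean value theorem, with a slope that is close to the one at 0. *)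
Lemma C1_slope (phi : R -> R) (eta : R) :
  (forall s, derivable phi s 1) -> continuous (derive1 phi) -> 0 < eta ->
  exists2 rho, 0 < rho & forall s s', `|s| < rho -> `|s'| < rho ->
    `|phi s - phi s' - derive1 phi 0 * (s - s')| <= eta * `|s - s'|.
Proof.
move=> d c e0.
have /nbhs_ballP[rho /= r0 hr] : \forall s \near (0 : R), `|derive1 phi 0 - derive1 phi s| < eta.
  by have /cvgrPdist_lt := c 0; apply.
exists rho => // s s' hs hs'.
wlog ss' : s s' hs hs' / s' <= s.
  move=> H; have [|/ltW] := leP s' s; first exact: H.
  move=> /H -/(_ hs' hs) h; rewrite [`|s - s'|]distrC (_ : phi s - _ - _ =
    - (phi s' - phi s - derive1 phi 0 * (s' - s))) ?normrN//; ring.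
have [->|ne] := eqVneq s' s; first by rewrite !subrr mulr0 subrr normr0 mulr0.
have lt : s' < s by rewrite lt_neqAle ne.
have [w xs ->] := @MVT _ phi (derive1 phi) s' s lt
  (fun w _ => DeriveDef (d w) (esym (derive1E phi w)))
  (continuous_subspaceT (fun w => differentiable_continuous ((derivable1_diffP phi w).1 (d w)))).
rewrite -mulrBl normrM ler_wpM2r// distrC ltW//.
apply: hr; rewrite /ball/= sub0r normrN.
move: xs; rewrite in_itv/= => /andP[x1 x2].
by move: hs hs'; rewrite !ltr_norml => /andP[h1 h2] /andP[h3 h4]; apply/andP; split; lra.
Qed.

Section local.
Variables (Omega : set (R * R)) (p t : R * R) (r : R) (phi : R -> R).
Hypotheses (oO : open Omega) (t1 : edist 0 t = 1) (r0 : 0 < r).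
Hypotheses (dphi : forall s, derivable phi s 1) (cphi' : continuous (derive1 phi)).
Hypothesis chart : forall s u, disc p r (frame p t s u) -> (Omega (frame p t s u) <-> phi s < u).
Local Notation Gam := (bdry Omega).

Let cphi : continuous phi.
Proof. by move=> x; apply: differentiable_continuous; exact/derivable1_diffP. Qed.

(** In the chart, F measures the height above Gamma along the ray t |-> N + t z.
    Up to an error eta times the step, F is affine of slope ell, and
    transversality keeps ell away from zero: this gives at most one zero.  As A
    and B lie on the graph, F 0 is at most of order eta |B - A|, so F changes
    sign within a distance eps |B - A|. *)
Lemma nodes_chart (kap eps : R) : 0 < kap -> 0 < eps ->
  exists2 rho : R, 0 < rho & forall A B tau z, Gam A -> Gam B -> edist p A < rho ->
    edist A B < rho -> A <> B -> 0 <= tau <= 1 ->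
    kap * enorm z * enorm (B - A) <= `|cross z (B - A)| -> z <> 0 ->
    let N := A + tau *: (B - A) in
    exists sg : R, [/\ Gam (N + sg *: z), `|sg| * enorm z <= eps * enorm (B - A) &
      forall sg', Gam (N + sg' *: z) -> `|sg'| <= `|sg| -> sg' = sg].
Proof.
move=> k0 e0.
(* With kap / 4, the slope ell dominates the error by a factor 3; with
   eps kap / 4, the zero is at a distance at most eps |B - A|. *)
pose eta := Num.min (kap / 4) (eps * kap / 4).
have eta0 : 0 < eta by rewrite lt_min !divr_gt0// mulr_gt0.
have etak : eta <= kap / 4 by rewrite ge_min lexx.
have etae : eta <= eps * kap / 4 by rewrite ge_min lexx orbT.
have [rho1 rho10 slope] := C1_slope dphi cphi' eta0.
set m := derive1 phi 0 in slope.
pose rho2 := Num.min rho1 r.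
have rho20 : 0 < rho2 by rewrite lt_min rho10.
(* With A at distance rho from p and steps of size rho and eps rho from A, one
   stays at distance rho2 from p. *)
exists (rho2 / (2 + eps)); first by rewrite divr_gt0// addr_gt0.
set rho := rho2 / _.
have rhoE : rho * (2 + eps) = rho2 by rewrite /rho divfK// gt_eqF// addr_gt0.
have rho0 : 0 < rho by rewrite /rho divr_gt0// addr_gt0.
move=> A B tau z GA GB pA AB neAB /andP[tau0 tau1] trans z0 N.
have bch x : edist p x < r -> Gam x <-> frame_u p t x = phi (frame_s p t x).
  exact: (bdry_chart oO t1 cphi chart).
have rr : rho2 <= r by rewrite ge_min lexx orbT.
have rr1 : rho2 <= rho1 by rewrite ge_min lexx.
have fs_small x : edist p x < rho2 -> `|frame_s p t x| < rho1.
  by move=> h; rewrite -[frame_s p t x]subr0 -(frame_s0 p t) (le_lt_trans (frame_s_le _ _ _ t1))// edistC; lra.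
have nz0 : 0 < enorm z.
  by rewrite lt_neqAle enorm_ge0 andbT; apply/eqP => /esym/enorm_eq0.
have er0 : 0 < eps * rho by rewrite mulr_gt0.
have pA2 : edist p A < rho2 by rewrite -rhoE; lra.
have pB2 : edist p B < rho2.
  by rewrite (le_lt_trans (edist_triangle A _ _))// -rhoE; lra.
have pr x : edist p x < rho2 -> edist p x < r by move=> h; lra.
have eA := (bch A (pr _ pA2)).1 GA; have eB := (bch B (pr _ pB2)).1 GB.
pose Ds := frame_s p t B - frame_s p t A; pose e := frame_u p t B - frame_u p t A - m * Ds.
have he : `|e| <= eta * `|Ds| by rewrite /e eA eB; apply: slope; exact: fs_small.
pose zs := z.1 * t.1 + z.2 * t.2; pose zu := - z.1 * t.2 + z.2 * t.1.
have zsz : `|zs| <= enorm z.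
  have nt : enorm t = 1 by rewrite -enormN -[- t]sub0r -edistE.
  by have := dot_le_enorm z t; rewrite nt mulr1.
have Dsle : `|Ds| <= enorm (B - A) by rewrite -edistE; exact: frame_s_le.
have Ds0 : Ds != 0.
  apply/eqP => D0; apply: neAB; rewrite -(frame_coord p A t1) -(frame_coord p B t1).
  have eq1 : frame_s p t A = frame_s p t B by apply/eqP; rewrite eq_sym -subr_eq0; apply/eqP.
  by rewrite eA eB eq1.
have nDs : 0 < `|Ds| by rewrite normr_gt0.
pose ell := zu - m * zs.
(* The cross product in the frame of the chart, where B - A = (Ds, m Ds + e). *)
have crossE : cross z (B - A) = - Ds * ell + zs * e.
  transitivity (zs * (frame_u p t B - frame_u p t A) - zu * Ds); last by rewrite /e /ell; ring.
  by rewrite -[LHS]mulr1 -(unitP t1) /zs /zu /Ds /frame_s /frame_u /cross/=; ring.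
have hell : (kap - eta) * enorm z <= `|ell|.
  rewrite -(ler_pM2l nDs).
  have h1 : `|cross z (B - A)| <= `|Ds| * `|ell| + enorm z * (eta * `|Ds|).
    rewrite crossE (le_trans (ler_normD _ _))// !normrM normrN lerD2l.
    by apply: ler_pM.
  have h2 : kap * enorm z * `|Ds| <= kap * enorm z * enorm (B - A).
    by apply: ler_wpM2l => //; rewrite mulr_ge0 ?enorm_ge0 ?ltW.
  have := le_trans h2 (le_trans trans h1).
  by rewrite [`|Ds| * ((kap - eta) * _)]mulrC !mulrBl lerBlDr [eta * enorm z * _]mulrAC [eta * _ * _]mulrC.
(* Height of the point of the ray above the graph. *)
pose F sg := frame_u p t (N + sg *: z) - phi (frame_s p t (N + sg *: z)).
have fsN sg : frame_s p t (N + sg *: z) = frame_s p t A + tau * Ds + sg * zs.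
  by rewrite /Ds /frame_s /zs /N /= /GRing.scale/=; ring.
have fuN sg : frame_u p t (N + sg *: z) = frame_u p t A + tau * (frame_u p t B - frame_u p t A) + sg * zu.
  by rewrite /zu /N /frame_u /= /GRing.scale/=; ring.
have NA : edist A N <= edist A B.
  rewrite !edistE /N opprD addrA subrr sub0r enormN enormZ -[A - B]opprB enormN ger0_norm//.
  by rewrite ler_piMl// enorm_ge0.
have pN2 (sg : R) : `|sg| * enorm z <= eps * enorm (B - A) -> edist p (N + sg *: z) < rho2.
  move=> h; rewrite (le_lt_trans (edist_triangle A _ _))//.
  have h1 : edist A (N + sg *: z) <= edist A B + eps * edist A B.
    rewrite (le_trans (edist_triangle N _ _))// lerD//.
    by rewrite edistE opprD addrA subrr sub0r enormN enormZ edistC [in leRHS]edistE.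
  have h2 : eps * edist A B <= eps * rho by rewrite ler_wpM2l// ltW.
  by rewrite -rhoE; lra.
have Fdiff (sg sg' : R) : `|sg| * enorm z <= eps * enorm (B - A) -> `|sg'| * enorm z <= eps * enorm (B - A) ->
   `|F sg - F sg' - (sg - sg') * ell| <= eta * (`|sg - sg'| * enorm z).
  move=> h h'.
  have -> : F sg - F sg' - (sg - sg') * ell =
    - (phi (frame_s p t (N + sg *: z)) - phi (frame_s p t (N + sg' *: z)) - m * (frame_s p t (N + sg *: z) - frame_s p t (N + sg' *: z))).
    by rewrite /F !fuN !fsN /ell; ring.
  rewrite normrN (le_trans (slope _ _ _ _))//; [exact/fs_small/pN2|exact/fs_small/pN2|].
  rewrite (ler_wpM2l (ltW eta0))// !fsN (_ : _ - _ = (sg - sg') * zs); last by ring.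
  by rewrite normrM ler_wpM2l.
have z_ok : `|0 : R| * enorm z <= eps * enorm (B - A) by rewrite normr0 mul0r mulr_ge0 ?enorm_ge0 ?ltW.
have F0 : `|F 0| <= 2 * eta * `|Ds|.
  have -> : F 0 = tau * e - (phi (frame_s p t (N + 0 *: z)) - phi (frame_s p t A) - m * (frame_s p t (N + 0 *: z) - frame_s p t A)).
    by rewrite /F fuN /e -eA !fsN /Ds; ring.
  have h2 : `|phi (frame_s p t (N + 0 *: z)) - phi (frame_s p t A) - m * (frame_s p t (N + 0 *: z) - frame_s p t A)| <= eta * `|Ds|.
    rewrite (le_trans (slope _ _ _ _))//; [exact/fs_small/pN2|exact/fs_small|].
    rewrite (ler_wpM2l (ltW eta0))// fsN (_ : _ - _ = tau * Ds); last by ring.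
    by rewrite normrM ger0_norm// ler_piMl.
  have h1 : `|tau * e| <= eta * `|Ds| by rewrite normrM ger0_norm// (le_trans _ he)// ler_piMl.
  rewrite (le_trans (ler_normB _ _))//.
  by have := lerD h1 h2; lra.
(* F 0 is at most 2 eta |Ds|, and the slope exceeds kap / 2 times enorm z. *)
pose s1 := 4 * eta * `|Ds| / (kap * enorm z).
have s1E : s1 * enorm z = 4 * eta * `|Ds| / kap.
  by rewrite /s1; field; rewrite !gt_eqF.
have s10 : 0 < s1 by rewrite /s1 divr_gt0// !mulr_gt0.
have s1z : s1 * enorm z <= eps * enorm (B - A).
  rewrite s1E ler_pdivrMr//.
  apply: (@le_trans _ _ ((eps * kap) * `|Ds|)).
    by rewrite ler_wpM2r//; lra.
  by rewrite mulrAC (ler_wpM2r (ltW k0))// (ler_wpM2l (ltW e0)).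
have root : exists2 sg, `|sg| <= s1 & F sg = 0.
  have hp : `|s1| * enorm z <= eps * enorm (B - A) by rewrite gtr0_norm.
  have hm : `|- s1| * enorm z <= eps * enorm (B - A) by rewrite normrN gtr0_norm.
  have d1 := Fdiff _ _ hp z_ok; have d2 := Fdiff _ _ hm z_ok.
  rewrite subr0 (gtr0_norm s10) in d1; rewrite subr0 normrN (gtr0_norm s10) in d2.
  have big : 2 * eta * `|Ds| + eta * (s1 * enorm z) <= s1 * `|ell|.
    apply: (@le_trans _ _ (s1 * ((kap - eta) * enorm z))); last by rewrite ler_wpM2l// ltW.
    rewrite [X in _ <= X]mulrCA s1E -lerBrDr -mulrBl.
    have -> : 2 * eta * `|Ds| = (kap / 2) * (4 * eta * `|Ds| / kap) by field; rewrite gt_eqF.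
    apply: ler_wpM2r; last by lra.
    by rewrite divr_ge0// ?(ltW k0)// !mulr_ge0// ltW.
  have cF : {within `[- s1, s1], continuous F}.
    apply: continuous_subspaceT => x.
    rewrite /F; apply: cvgB.
      rewrite (_ : (fun sg => frame_u p t (N + sg *: z)) = (fun sg => frame_u p t A + tau * (frame_u p t B - frame_u p t A) + sg * zu)); last exact/funext/fuN.
      by rewrite fuN; apply: cvgD; [exact: cvg_cst|apply: cvgM; [exact: cvg_id|exact: cvg_cst]].
    rewrite (_ : (fun sg => phi (frame_s p t (N + sg *: z))) = (fun sg => phi (frame_s p t A + tau * Ds + sg * zs))); last first.
      by apply/funext => s; rewrite fsN.
    rewrite fsN; apply: (@continuous_comp _ _ _ (fun sg : R => frame_s p t A + tau * Ds + sg * zs) phi); last exact: cphi.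
    by apply: cvgD; [exact: cvg_cst|apply: cvgM; [exact: cvg_id|exact: cvg_cst]].
  have sgn : Num.min (F (- s1)) (F s1) <= 0 <= Num.max (F (- s1)) (F s1).
    move: d1 d2 F0 big; rewrite !ler_norml mulNr => /andP[d1 d1'] /andP[d2 d2'] /andP[f0 f0'].
    have [l0|l0] := ger0P ell => big.
      by rewrite ge_min le_max; apply/andP; split; apply/orP; [left|right]; lra.
    rewrite mulrN in big.
    by rewrite ge_min le_max; apply/andP; split; apply/orP; [right|left]; lra.
  have [c] := IVT (ge0_cp (ltW s10)).2 cF sgn.
  by rewrite in_itv/= -ler_norml => cs1 c0; exists c.
have [sg sgs1 Fsg] := root.
have ok (sg' : R) : `|sg'| <= s1 -> `|sg'| * enorm z <= eps * enorm (B - A).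
  by move=> h; rewrite (le_trans _ s1z)// ler_wpM2r// ltW.
exists sg; split.
- have hpr := pr _ (pN2 _ (ok _ sgs1)); have [_ h] := bch _ hpr; apply: h; apply/eqP; rewrite -subr_eq0; apply/eqP; exact: Fsg.
- exact: (ok _ sgs1).
move=> sg' Gsg' le'.
have s's1 := le_trans le' sgs1.
have Fsg' : F sg' = 0 by rewrite /F ((bch _ (pr _ (pN2 _ (ok _ s's1)))).1 Gsg') subrr.
have := Fdiff _ _ (ok _ s's1) (ok _ sgs1).
rewrite Fsg Fsg' subrr sub0r normrN normrM => h.
apply/eqP; rewrite -subr_eq0 -normr_eq0 eq_le normr_ge0 andbT leNgt; apply/negP => d0.
have : `|sg' - sg| * ((kap - eta) * enorm z) <= `|sg' - sg| * (eta * enorm z).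
  apply: (le_trans _ (le_trans h _)); first by rewrite ler_wpM2l.
  by rewrite mulrCA.
by rewrite ler_pM2l// ler_pM2r// leNgt => /negP; apply; lra.
Qed.
End local.

(** The bound of nodes_chart near each boundary point is made uniform by
    compactness of the boundary. *)
Lemma boundary_nodes (k : nat) (Omega : set (R * R)) : (2 <= k)%N -> domain Omega ->
  smooth_boundary k Omega -> forall kap eps : R, 0 < kap -> 0 < eps ->
  exists2 del : R, 0 < del & forall A B tau z, bdry Omega A -> bdry Omega B ->
    edist A B < del -> A <> B -> 0 <= tau <= 1 ->
    kap * enorm z * enorm (B - A) <= `|cross z (B - A)| -> z <> 0 ->
    let N := A + tau *: (B - A) in
    exists sg : R, [/\ bdry Omega (N + sg *: z), `|sg| * enorm z <= eps * enorm (B - A) &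
      forall sg', bdry Omega (N + sg' *: z) -> `|sg'| <= `|sg| -> sg' = sg].
Proof.
move=> k2 [oO _ _ bO] sO kap eps k0 e0.
have [cG _] := bdry_compact bO.
pose P (del : R) A := forall B tau z, bdry Omega A -> bdry Omega B ->
    edist A B < del -> A <> B -> 0 <= tau <= 1 ->
    kap * enorm z * enorm (B - A) <= `|cross z (B - A)| -> z <> 0 ->
    let N := A + tau *: (B - A) in
    exists sg : R, [/\ bdry Omega (N + sg *: z), `|sg| * enorm z <= eps * enorm (B - A) &
      forall sg', bdry Omega (N + sg' *: z) -> `|sg'| <= `|sg| -> sg' = sg].
have H : \forall del \near 0^'+, bdry Omega `<=` P del.
  apply: ((compact_near_coveringP _).1 cG).
  move=> p Gp; have [t [r [phi [t1 r0 Cphi _ chart]]]] := sO p Gp.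
  have k1 : (0 < k.-1)%N by case: k k2 {sO Cphi} => [|[|]].
  have [dphi cphi'] := Cn1_C1 k1 Cphi.
  have [rho rho0 H] := nodes_chart oO t1 r0 dphi cphi' chart k0 e0.
  exists ([set A | edist p A < rho], [set del : R | del < rho]) => /=.
    by split; [exact: nbhs_edist|exact: nbhs_right_lt].
  move=> [A del] [/= pA dr] B tau z GA GB AB; apply: H => //; exact: lt_trans AB dr.
have /filter_ex[del [del0 h]] : \forall del \near (0 : R)^'+, 0 < del /\ bdry Omega `<=` P del.
  by apply: filterS2 (nbhs_right_gt 0) H.
by exists del => // A B tau z GA; exact: (h A GA).
Qed.
End Nodes.

(** * Integration over the open triangles of a mesh *)
Section MeshInt.
Variable R : realType.
Local Notation rT := (measurableTypeR R).
Local Notation area := (@area R).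
Implicit Types (x y z : R * R) (f g : R * R -> R).
Variable M : mesh R.
Hypothesis cM : conforming M.
Local Notation nd := (conf_nd cM).

(** Integrals over the polygon are computed on this union of open triangles: it
    differs from the polygon by a null set, and a piecewise polynomial is
    differentiable at each of its points. *)
Definition cells : set (rT * rT) := \big[setU/set0]_(i <- enum 'I_(ntri M)) (otri i : set (rT * rT)).

Lemma cellsP x : cells x <-> exists i : 'I_(ntri M), otri i x.
Proof.
rewrite /cells -bigcup_seq; split => [[i _ h]|[i h]]; first by exists i.
by exists i => //=; rewrite mem_enum.
Qed.

Lemma measurable_otri (i : 'I_(ntri M)) : measurable (otri i : set (rT * rT)).
Proof. apply: open_measurable2; exact: open_otri. Qed.

Lemma measurable_cells : measurable cells.
Proof. by apply: bigsetU_measurable => i _; exact: measurable_otri. Qed.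

Lemma lam_null (i : 'I_(ntri M)) j :
  let L := [set x : rT * rT | lam i j x = 0] in measurable L /\ area L = 0%E.
Proof.
move=> L; have [g [c [g0 h]]] := lam_lin i j.
have LE : L = [set x : rT * rT | g.1 * x.1 + g.2 * x.2 = - c].
  apply/seteqP; split => x /=; rewrite /L/= h => e.
    by apply/eqP; rewrite -subr_eq0 opprK addrC addrA e.
  by rewrite -addrA e subrr.
split; last first.
  rewrite LE; apply: area_line; move: (g0 (nd i)); apply: contraNT.
  by rewrite negb_or !negbK => /andP[/eqP e1 /eqP e2]; rewrite [g]surjective_pairing e1 e2.
have -> : L = ~` (~` L) by rewrite setCK.
apply: measurableC; apply: open_measurable2.
rewrite openE => x /= nx; rewrite /L /= in nx.
have [l0|l0] := ltP 0 (lam i j x).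
  by apply: filterS (lam_gt0_nbhs l0) => y hy; rewrite /L /= => e; rewrite e ltxx in hy.
have l1 : lam i j x < 0 by rewrite lt_neqAle l0 andbT; apply/eqP.
by apply: filterS (lam_lt0_nbhs l1) => y hy; rewrite /L /= => e; rewrite e ltxx in hy.
Qed.

(** All lines through the edges, in place of the edges: they have simpler
    equations and are still negligible. *)
Definition edge_lines : set (rT * rT) :=
  \big[setU/set0]_(p <- enum {: 'I_(ntri M) * 'I_3}) [set x : rT * rT | lam p.1 p.2 x = 0].

Lemma edge_linesP x : edge_lines x <-> exists i j, lam (M := M) i j x = 0.
Proof.
rewrite /edge_lines -bigcup_seq; split => [[[i j] _ h]|[i [j h]]]; first by exists i, j.
by exists (i, j) => //=; rewrite mem_enum.
Qed.

Lemma edge_lines_null : measurable edge_lines /\ area edge_lines = 0%E.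
Proof.
rewrite /edge_lines; apply: (big_ind (fun A : set (rT * rT) => measurable A /\ area A = 0%E)).
- by split => //; rewrite measure0.
- by move=> A B [mA A0] [mB B0]; split; [exact: measurableU|rewrite measureU0].
- by move=> p _; exact: lam_null.
Qed.

Lemma Umesh_cells x : Umesh M x -> ~ edge_lines x -> cells x.
Proof.
move=> [i ti] nN; apply/cellsP; exists i => j; have /(triP (nd i)) h := ti.
rewrite lt_neqAle h andbT; apply/eqP => e; apply: nN; apply/edge_linesP.
by exists i, j.
Qed.

Lemma cells_Omegah x : cells x -> Omegah M x.
Proof. by move=> /cellsP[i]; exact: otri_Omegah nd _ _. Qed.

Lemma int_Omegah f : \int[area]_(x in Omegah M) f x = \int[area]_(x in cells) f x.
Proof.
have [mN N0] := edge_lines_null.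
rewrite /Rintegral; congr fine; apply: (integral_off_null mN N0) => x nN.
rewrite !patchE; have [Ux|nU] := pselect (cells x).
  by rewrite !mem_set//; exact: cells_Omegah.
rewrite !memNset//; apply: contra_not nU => Ox; apply: Umesh_cells => //.
exact: interior_subset.
Qed.

Lemma otri_disjoint (i i' : 'I_(ntri M)) x : otri i x -> otri i' x -> i = i'.
Proof.
move=> h h'; apply/eqP; apply: contrapT => /negP ii'.
have t := otri_tri nd h; have t' := otri_tri nd h'.
have [_ /(_ _ _ ii')] := cM; case.
- by move=> e; have : (tri i `&` tri i') x by []; rewrite e.
- move=> [k [k' [_ e]]]; have : (tri i `&` tri i') x by []; rewrite e => xE.
  by have := h (ordS k); rewrite xE (lam_vtx (nd i)) eq_sym neq_ordS ltxx.
move=> [k [k' [_ e]]]; have : (tri i `&` tri i') x by []; rewrite e => /(edgeP (nd i))[_ l0].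
by have := h k; rewrite l0 ltxx.
Qed.

Lemma Umesh_bounded : exists2 D : R, 0 < D & Umesh M `<=` box D.
Proof.
pose D := \sum_(p : 'I_(ntri M) * 'I_3) (`|(vtx p.1 p.2).1| + `|(vtx p.1 p.2).2|) + 1.
have D0 (p : 'I_(ntri M) * 'I_3) : `|(vtx p.1 p.2).1| + `|(vtx p.1 p.2).2| <= D.
  rewrite /D (bigD1 p)//= -addrA lerDl; apply: addr_ge0 => //.
  by apply: sumr_ge0 => q _; exact: addr_ge0.
exists D.
  by rewrite /D ltr_wpDl//; apply: sumr_ge0 => p _; exact: addr_ge0.
move=> x [i ti]; have /(triP (nd i)) h := ti.
have e1 := lam_sum (nd i) x; have e2 := lam_comb (nd i) x.
apply/boxP; rewrite -e2.
have K (F : R * R -> R) : (forall y z, F (y + z) = F y + F z) -> (forall (a : R) y, F (a *: y) = a * F y) ->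
   (forall j, `|F (vtx i j)| <= D) -> `|F (\sum_j lam i j x *: vtx i j)| <= D.
  move=> FD FZ FB; rewrite (sum3E _ ord0) !FD !FZ.
  have -> : D = lam i ord0 x * D + lam i (ordS ord0) x * D + lam i (ord_pred ord0) x * D.
    move: e1; rewrite (sum3E _ ord0) => e1'.
    by rewrite -[LHS]mul1r -[in LHS]e1'; ring.
  rewrite (le_trans (ler_normD _ _))// lerD//.
    rewrite (le_trans (ler_normD _ _))// lerD// normrM ger0_norm//; exact: ler_wpM2l.
  rewrite normrM ger0_norm//; exact: ler_wpM2l.
by split; apply: K => // j; apply: le_trans (D0 (i, j)); rewrite ?lerDl ?lerDr.
Qed.

(** These functions are integrable on the bounded set cells and are closed under
    products, so the integrability of every integrand below follows from its
    shape. *)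
Definition bmeas (f : R * R -> R) :=
  measurable_fun cells (f : rT * rT -> rT) /\ exists B : R, forall x, cells x -> `|f x| <= B.

Lemma area_cells : (area cells < +oo)%E.
Proof.
have [D _ hD] := Umesh_bounded.
apply: (le_lt_trans _ (area_box_fin D)); apply: le_measure; rewrite ?inE.
- exact: measurable_cells.
- exact: measurable_box.
- by move=> x Ux; apply: hD; exact: (interior_subset (cells_Omegah Ux)).
Qed.

Lemma bmeas_integrable f : bmeas f -> area.-integrable cells (EFin \o f).
Proof.
move=> [mf [B hB]]; apply: measurable_bounded_integrable => //.
- exact: measurable_cells.
- exact: area_cells.
- exists B; split; first exact: num_real.
  by move=> C BC x Ux; apply: le_trans (hB _ Ux) (ltW BC).
Qed.

Lemma bmeas_ext f g : (forall x, cells x -> f x = g x) -> bmeas f -> bmeas g.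
Proof.
move=> e [mf [B hB]]; split; last by exists B => x Ux; rewrite -e// hB.
by apply: eq_measurable_fun mf => x; rewrite inE => Ux; exact: e.
Qed.

Lemma bmeasD f g : bmeas f -> bmeas g -> bmeas (fun x => f x + g x).
Proof.
move=> [mf [B hB]] [mg [C hC]]; split; first exact: measurable_funD.
by exists (B + C) => x Ux; rewrite (le_trans (ler_normD _ _))// lerD ?hB ?hC.
Qed.

Lemma bmeasM f g : bmeas f -> bmeas g -> bmeas (fun x => f x * g x).
Proof.
move=> [mf [B hB]] [mg [C hC]]; split; first exact: measurable_funM.
by exists (B * C) => x Ux; rewrite normrM ler_pM ?hB ?hC.
Qed.

Lemma bmeas_cst (c : R) : bmeas (fun=> c).
Proof. by split; [exact: measurable_cst|exists `|c|]. Qed.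

Lemma bmeasX f : bmeas f -> bmeas (fun x => f x ^+ 2).
Proof. by move=> h; apply: bmeas_ext (bmeasM h h) => x _; rewrite expr2. Qed.

Lemma bmeas_pw f : (forall i : 'I_(ntri M), exists2 c, continuous c & forall x, otri i x -> f x = c x) -> bmeas f.
Proof.
move=> h; split.
  move=> mU Y mY.
  have -> : cells `&` f @^-1` Y = \big[setU/set0]_(i <- enum 'I_(ntri M)) ((otri i : set (rT * rT)) `&` f @^-1` Y).
    by rewrite /cells -!bigcup_seq setI_bigcupl.
  apply: bigsetU_measurable => i _; have [c cc e] := h i.
  have -> : (otri i : set (rT * rT)) `&` f @^-1` Y = (otri i : set (rT * rT)) `&` c @^-1` Y.
    by apply/seteqP; split => x [/= h1]; rewrite e.
  have := @measurable_funTS _ _ _ _ (otri i : set (rT * rT)) c (continuous_measurable2 cc).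
  by apply => //; exact: measurable_otri.
have [D D0 hD] := Umesh_bounded.
have hB (i : 'I_(ntri M)) : exists B : R, forall x, otri i x -> `|f x| <= B.
  have [c cc e] := h i; have [B _ hB] := continuous_box_bounded D cc.
  by exists B => x hx; rewrite e// hB//; apply: hD; exists i; exact: (otri_tri nd hx).
pose B i := `|projT1 (cid (hB i))|.
exists (\sum_i B i) => x /cellsP[i hx].
apply: (@le_trans _ _ (B i)).
  by apply: (le_trans (projT2 (cid (hB i)) x hx)); exact: ler_norm.
by rewrite (bigD1 i)//= lerDl; apply: sumr_ge0 => ? _; exact: normr_ge0.
Qed.

Lemma bmeas_continuous f : continuous f -> bmeas f.
Proof. by move=> cf; apply: bmeas_pw => i; exists f. Qed.

Definition int_cells f : R := \int[area]_(x in cells) f x.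

Lemma int_cells_ext f g : (forall x, cells x -> f x = g x) -> int_cells f = int_cells g.
Proof. by move=> e; apply: eq_Rintegral => x; rewrite inE => /e. Qed.

Lemma int_cellsD f g : bmeas f -> bmeas g -> int_cells (fun x => f x + g x) = int_cells f + int_cells g.
Proof. by move=> hf hg; apply: RintegralD; [exact: measurable_cells|exact: bmeas_integrable|exact: bmeas_integrable]. Qed.

Lemma int_cellsZ (c : R) f : bmeas f -> int_cells (fun x => c * f x) = c * int_cells f.
Proof. by move=> hf; apply: RintegralZl; [exact: measurable_cells|exact: bmeas_integrable]. Qed.

Lemma int_cells_le f g : bmeas f -> bmeas g -> (forall x, cells x -> f x <= g x) -> int_cells f <= int_cells g.
Proof. by move=> hf hg h; apply: le_Rintegral => //; [exact: measurable_cells|exact: bmeas_integrable|exact: bmeas_integrable]. Qed.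

Lemma int_cells_ge0 f : (forall x, cells x -> 0 <= f x) -> 0 <= int_cells f.
Proof. by move=> h; apply: Rintegral_ge0 => x /h. Qed.

Lemma int_cells_sum f : bmeas f -> int_cells f = \sum_(i : 'I_(ntri M)) \int[area]_(x in (otri i : set (rT * rT))) f x.
Proof.
move=> hf; rewrite /int_cells /Rintegral /cells integral_bigsetU_EFin //=.
- rewrite -sum_fine ?big_enum//= => i _.
  apply: integrable_fin_num; first exact: measurable_otri.
  apply: (integrableS measurable_cells) => //; [exact: measurable_otri| |exact: bmeas_integrable].
  by move=> x hx; apply/cellsP; exists i.
- by move=> i; exact: measurable_otri.
- exact: enum_uniq.
- by move=> i i' _ _ [x [h h']]; exact: otri_disjoint h h'.
- by apply/measurable_EFinP; case: hf.
Qed.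

(** The discriminant of a nonnegative quadratic form; the case a = 0 has to be
    treated apart. *)
Lemma quad_CS (a b c : R) : 0 <= a -> (forall t, 0 <= t ^+ 2 * a + 2 * t * b + c) -> b ^+ 2 <= a * c.
Proof.
move=> a0 h; have [a_eq|an0] := eqVneq a 0.
  rewrite a_eq mul0r; have [->|b0] := eqVneq b 0; first by rewrite expr0n.
  have := h (- (c + 1) / (2 * b)); rewrite a_eq mulr0 add0r.
  rewrite (_ : 2 * _ * b + c = -1); last by field.
  by rewrite oppr_ge0 ler10.
have := h (- b / a); rewrite (_ : _ + c = (a * c - b ^+ 2) / a); last by field.
by rewrite pmulr_lge0 ?subr_ge0// invr_gt0 lt_neqAle eq_sym an0.
Qed.

Lemma int_cells_CS f g : bmeas f -> bmeas g -> (int_cells (fun x => f x * g x)) ^+ 2 <= int_cells (fun x => f x ^+ 2) * int_cells (fun x => g x ^+ 2).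
Proof.
move=> hf hg; apply: quad_CS; first by apply: int_cells_ge0 => x _; exact: sqr_ge0.
move=> t.
have -> : t ^+ 2 * int_cells (fun x => f x ^+ 2) + 2 * t * int_cells (fun x => f x * g x) + int_cells (fun x => g x ^+ 2)
    = int_cells (fun x => t ^+ 2 * f x ^+ 2 + 2 * t * (f x * g x) + g x ^+ 2).
  rewrite int_cellsD ?int_cellsD ?int_cellsZ //; try exact: bmeasX; try exact: bmeasM;
    try (by apply: bmeasM; [exact: bmeas_cst|exact: bmeasX]); try (by apply: bmeasM; [exact: bmeas_cst|exact: bmeasM]).
  by apply: bmeasD; apply: bmeasM; [exact: bmeas_cst|exact: bmeasX|exact: bmeas_cst|exact: bmeasM].
apply: int_cells_ge0 => x _; rewrite (_ : _ + _ = (t * f x + g x) ^+ 2) ?sqr_ge0//; ring.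
Qed.
End MeshInt.

(** * Functions glued from finitely many closed pieces *)
Section Cover.
Variable R : realType.
Implicit Types (x y z : R * R) (f g : R * R -> R).

Lemma closed_cover_continuous (I : finType) (A : set (R * R)) (C : I -> set (R * R)) (H : I -> R * R -> R) G :
  (forall i, closed (C i)) -> (forall i, continuous (H i)) ->
  (forall i x, C i x -> G x = H i x) -> (forall x, A x -> exists i, C i x) -> {within A, continuous G}.
Proof.
move=> cC cH GH cov; apply/subspace_continuousP => x Ax; apply/cvgrPdist_lt => eps e0.
have : \forall y \near x, forall i, C i y -> `|G x - G y| < eps.
  have := @filter_forall (R * R)%type I (fun i y => C i y -> `|G x - G y| < eps) (nbhs x) _.
  apply => i; have [Cx|nCx] := pselect (C i x).
    have /cvgrPdist_lt/(_ _ e0) := cH i x.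
    by apply: filterS => y h Cy; rewrite (GH _ _ Cx) (GH _ _ Cy).
  have : nbhs x (~` C i) by apply: open_nbhs_nbhs; split; [exact: closed_openC|].
  by apply: filterS => y nC /nC.
by apply: filterS => y h Ay; have [i Ci] := cov y Ay; exact: (h i).
Qed.

Lemma line_continuous (e x : R * R) : continuous (fun t : R => t *: e + x).
Proof. by move=> t; apply: cvgD; [apply: cvgZr_tmp; exact: cvg_id|exact: cvg_cst]. Qed.

(** The traces on a line of the closed sets form a closed cover of it, so the
    one-dimensional result applies. *)
Lemma closed_cover_lip_dir (I : finType) (C : I -> set (R * R)) (H : I -> R * R -> R) G (e : R * R) (L : R) :
  (forall i, closed (C i)) ->
  (forall i x, C i x -> G x = H i x) -> (forall x, exists i, C i x) ->
  (forall i x t, C i x -> C i (t *: e + x) -> `|H i (t *: e + x) - H i x| <= L * `|t|) ->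
  forall x t, `|G (t *: e + x) - G x| <= L * `|t|.
Proof.
move=> cC GH cov LH x t.
pose h (s : R) := G (s *: e + x).
have key : forall a b, a <= b -> `|h b - h a| <= L * (b - a).
  move=> a b ab.
  apply: (@closed_cover_lipschitz R I (fun i => (fun s : R => s *: e + x) @^-1` (C i))) => //.
  - by move=> i; apply: closed_comp => [t' _|]; [exact: line_continuous|exact: cC].
  - move=> i s s' /= Cs Cs'; rewrite /h (GH _ _ Cs) (GH _ _ Cs').
    have E : s *: e + x = (s - s') *: e + (s' *: e + x) by rewrite scalerBl addrA subrK.
    by move: Cs; rewrite E => Cs; exact: LH.
  - by move=> s _; have [i Ci] := cov (s *: e + x); exists i.
have h0 : h 0 = G x by rewrite /h scale0r add0r.
rewrite -h0 -/(h t); have [t0|/ltW t0] := leP 0 t.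
  by have := key _ _ t0; rewrite subr0 (ger0_norm t0).
by have := key _ _ t0; rewrite sub0r distrC (ler0_norm t0).
Qed.

Lemma is_derive_line (H : R * R -> R) z x (t d : R) : is_derive (t *: z + x) z H d ->
  is_derive t 1 (fun s => H (s *: z + x)) d.
Proof.
move=> [dH dE]; set h := fun s => _.
have E : (fun u : R => u^-1 *: ((h \o shift t) (u *: 1) - h t)) =
         (fun u : R => u^-1 *: ((H \o shift (t *: z + x)) (u *: z) - H (t *: z + x))).
  apply/funext => u; rewrite /h /=; congr (_ *: (H _ - _)).
  by rewrite /GRing.scale/= mulr1 -[LHS]/(((u + t) *: z + x)) scalerDl addrA.
by split; rewrite /derivable ?/derive E.
Qed.

Lemma segment_lipschitz (H dH : R * R -> R) z x (s B : R) :
  (forall y, is_derive y z H (dH y)) ->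
  (forall r, 0 <= r <= 1 -> `|dH ((r * s) *: z + x)| <= B) -> `|H (s *: z + x) - H x| <= B * `|s|.
Proof.
move=> dHH hB; pose h t := H (t *: z + x).
have dh (t : R) : is_derive t 1 h (dH (t *: z + x)) by exact: is_derive_line.
have ch : continuous h.
  by move=> t; apply: differentiable_continuous; apply/derivable1_diffP; case: (dh t).
have bnd (t : R) : (0 <= t <= s) || (s <= t <= 0) -> `|dH (t *: z + x)| <= B.
  move=> ht; have [s0|s0] := eqVneq s 0.
    have -> : t = 0 by move: ht; rewrite s0 => /orP[]/andP[? ?]; apply/eqP; rewrite eq_le; apply/andP.
    by have := hB 0; rewrite mul0r lexx ler01; exact.
  rewrite -[t](divfK s0); apply: hB.
  case/orP: ht => /andP[h1 h2].
    have t1 : 0 < s by rewrite lt_neqAle eq_sym s0 (le_trans h1).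
    by rewrite divr_ge0 ?(ltW t1)//= ler_pdivrMr// mul1r.
  have t1 : s < 0 by rewrite lt_neqAle s0 (le_trans h1).
  by rewrite mulr_le0 ?invr_le0 ?(ltW t1)//= ler_ndivrMr// mul1r.
have h0 : h 0 = H x by rewrite /h scale0r add0r.
rewrite -h0 -/(h s); have [s0|s0] := leP 0 s.
  have [c cs ->] := @MVT_segment _ h (fun t => dH (t *: z + x)) 0 s s0 (fun t _ => dh t) (continuous_subspaceT ch).
  rewrite subr0 normrM ler_wpM2r// bnd//.
  by move: cs; rewrite in_itv/= => ->.
have [c cs E] := @MVT_segment _ h (fun t => dH (t *: z + x)) s 0 (ltW s0) (fun t _ => dh t) (continuous_subspaceT ch).
rewrite distrC E sub0r normrM normrN ler_wpM2r// bnd//.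
by move: cs; rewrite in_itv/= => ->; rewrite orbT.
Qed.

Lemma box_lipschitz (H dH : R * R -> R) (e : R * R) (D : R) :
  (forall x, is_derive x e H (dH x)) -> continuous dH ->
  exists2 L : R, 0 <= L & forall x t, box D x -> box D (t *: e + x) -> `|H (t *: e + x) - H x| <= L * `|t|.
Proof.
move=> dHH cdH; have [L L0 hL] := continuous_box_bounded D cdH; exists L; first exact: ltW.
move=> x t /boxP[b1 b2] /boxP[b3 b4]; apply: segment_lipschitz dHH _ => s /andP[s0 s1]; apply/hL/boxP.
rewrite /= /GRing.scale/= in b3 b4 *.
have cv (u w : R) : `|u| <= D -> `|t * w + u| <= D -> `|s * t * w + u| <= D.
  move=> h1 h2; have -> : s * t * w + u = (1 - s) * u + s * (t * w + u) by ring.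
  have s10 : 0 <= 1 - s by rewrite subr_ge0.
  have := ler_wpM2l s10 h1; have := ler_wpM2l s0 h2 => h3 h4.
  by rewrite (le_trans (ler_normD _ _))// !normrM !(ger0_norm s0) (ger0_norm s10); lra.
by split; exact: cv.
Qed.
End Cover.

(** * Piecewise polynomials and integration by parts *)
Section PW.
Variable R : realType.
Local Notation rT := (measurableTypeR R).
Local Notation area := (@area R).
Implicit Types (x y z : R * R) (f g v w u : R * R -> R).
Variable M : mesh R.
Hypothesis cM : conforming M.
Local Notation nd := (conf_nd cM).
Variable k : nat.

Definition pwp w := forall i : 'I_(ntri M), exists2 q, poly_le k q & (forall x, tri i x -> w x = q x).

Lemma otri_near (i : 'I_(ntri M)) x (P : R * R -> Prop) : otri i x -> (forall y, tri i y -> P y) ->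
  \forall y \near x, P y.
Proof.
move=> ox h; apply: filterS (open_nbhs_nbhs (conj (@open_otri R M i) ox)).
by move=> y /(otri_tri nd); exact: h.
Qed.

Lemma pwp_local w : pwp w -> forall i : 'I_(ntri M), exists q qx qy,
  [/\ poly_le k q, poly_le k qx & poly_le k qy] /\
  [/\ forall x, tri i x -> w x = q x,
   forall x z, is_derive x z q (z.1 * qx x + z.2 * qy x),
   forall x z, otri i x -> is_derive x z w (z.1 * qx x + z.2 * qy x) &
   forall x, otri i x -> dx w x = qx x /\ dy w x = qy x].
Proof.
move=> hw i; have [q hq e] := hw i; have [qx [qy [hx hy hd]]] := poly_le_derive hq.
exists q, qx, qy; split; split => //.
  move=> x z ox; apply: near_eq_is_derive (hd x z).
  by apply: otri_near ox _ => y /e ->.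
move=> x ox.
have E z : 'D_z w x = z.1 * qx x + z.2 * qy x.
  have [_ <-] := hd x z; apply: near_eq_derive.
  by apply: otri_near ox _ => y /e ->.
by rewrite /dx /dy !E /= !mul1r !mul0r addr0 add0r.
Qed.

Lemma bmeas_pwp w : pwp w -> bmeas M w.
Proof.
move=> hw; apply: bmeas_pw => // i; have [q [qx [qy [[hq _ _] [e _ _ _]]]]] := pwp_local hw i.
by exists q; [exact: poly_le_continuous hq|move=> x /(otri_tri nd); exact: e].
Qed.

Lemma bmeas_dx w : pwp w -> bmeas M (dx w).
Proof.
move=> hw; apply: bmeas_pw => // i; have [q [qx [qy [[_ hq _] [_ _ _ e]]]]] := pwp_local hw i.
by exists qx; [exact: poly_le_continuous hq|move=> x /e[]].
Qed.

Lemma bmeas_dy w : pwp w -> bmeas M (dy w).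
Proof.
move=> hw; apply: bmeas_pw => // i; have [q [qx [qy [[_ _ hq] [_ _ _ e]]]]] := pwp_local hw i.
by exists qy; [exact: poly_le_continuous hq|move=> x /e[]].
Qed.

Lemma pwpD w u : pwp w -> pwp u -> pwp (fun x => w x + u x).
Proof.
move=> hw hu i; have [q hq e] := hw i; have [q' hq' e'] := hu i.
by exists (fun x => q x + q' x); [exact: poly_leD|move=> x tx; rewrite e ?e'].
Qed.

Lemma pwpZ (c : R) w : pwp w -> pwp (fun x => c * w x).
Proof.
move=> hw i; have [q hq e] := hw i.
by exists (fun x => c * q x); [exact: poly_leZ|move=> x tx; rewrite e].
Qed.

Lemma pwpB w u : pwp w -> pwp u -> pwp (fun x => w x - u x).
Proof.
move=> hw hu i; have [q hq e] := pwpD hw (pwpZ (-1) hu) i.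
by exists q => // x tx; rewrite -e// mulN1r.
Qed.

Lemma is_derive_pwp w : pwp w -> forall x, cells M x -> forall z, is_derive x z w (z.1 * dx w x + z.2 * dy w x).
Proof.
move=> hw x /cellsP[i ox] z; have [q [qx [qy [_ [_ _ hd e]]]]] := pwp_local hw i.
by have [-> ->] := e _ ox; exact: hd.
Qed.

Lemma dxD w u x : pwp w -> pwp u -> cells M x ->
  dx (fun x => w x + u x) x = dx w x + dx u x /\ dy (fun x => w x + u x) x = dy w x + dy u x.
Proof.
move=> hw hu Ux; have := is_derive_pwp hw Ux; have := is_derive_pwp hu Ux => h1 h2.
have h3 z := is_deriveD (h2 z) (h1 z).
split; rewrite /dx /dy -[LHS]/('D__ (w + u) x); [have [_ ->] := h3 (1, 0)|have [_ ->] := h3 (0, 1)].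
  by rewrite /= !mul1r !mul0r !addr0.
by rewrite /= !mul1r !mul0r !add0r.
Qed.

Lemma dxZ (c : R) w x : pwp w -> cells M x ->
  dx (fun x => c * w x) x = c * dx w x /\ dy (fun x => c * w x) x = c * dy w x.
Proof.
move=> hw Ux; have h z := is_deriveZ c (is_derive_pwp hw Ux z).
split; rewrite /dx /dy -[LHS]/('D__ (c \*: w) x); [have [_ ->] := h (1, 0)|have [_ ->] := h (0, 1)].
  by rewrite /= !mul1r !mul0r !addr0.
by rewrite /= !mul1r !mul0r !add0r.
Qed.

Lemma dxB w u x : pwp w -> pwp u -> cells M x ->
  dx (fun x => w x - u x) x = dx w x - dx u x /\ dy (fun x => w x - u x) x = dy w x - dy u x.
Proof.
move=> hw hu Ux; have := is_derive_pwp hw Ux; have := is_derive_pwp hu Ux => h1 h2.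
have h3 z := is_deriveB (h2 z) (h1 z).
split; rewrite /dx /dy -[LHS]/('D__ (w - u) x); [have [_ ->] := h3 (1, 0)|have [_ ->] := h3 (0, 1)].
  by rewrite /= !mul1r !mul0r !addr0.
by rewrite /= !mul1r !mul0r !add0r.
Qed.

(** The function beta v^2 extended by zero is glued from smooth functions on the
    closed triangles and zero on the closed complement of the polygon.  It is
    thus Lipschitz in the direction e and differentiable off the lines through
    the edges, so the integral of its derivative vanishes. *)
Lemma mesh_ibp (beta dbeta : R * R -> R) (e : R * R) v :
  continuous beta -> continuous dbeta -> (forall x, is_derive x e beta (dbeta x)) ->
  pwp v -> (forall x, Gammah M x -> v x = 0) ->
  int_cells M (fun x => dbeta x * v x ^+ 2 + beta x * (2 * v x * (e.1 * dx v x + e.2 * dy v x))) = 0.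
Proof.
move=> cb cdb hb hv v0.
pose dG0 x := dbeta x * v x ^+ 2 + beta x * (2 * v x * (e.1 * dx v x + e.2 * dy v x)).
have loc i := cid (pwp_local hv i).
pose q i := projT1 (loc i).
have hq i : exists qx qy, [/\ poly_le k (q i), poly_le k qx & poly_le k qy] /\
  [/\ forall x, tri i x -> v x = q i x,
   forall x z, is_derive x z (q i) (z.1 * qx x + z.2 * qy x),
   forall x z, otri i x -> is_derive x z v (z.1 * qx x + z.2 * qy x) &
   forall x, otri i x -> dx v x = qx x /\ dy v x = qy x].
  exact: projT2 (loc i).
have [D D0 UD] := Umesh_bounded cM.
pose G x := if `[< Umesh M x >] then beta x * v x ^+ 2 else 0.
(* The closed triangles and the complement of the polygon cover the plane. *)
pose C (o : option 'I_(ntri M)) : set (R * R) := if o is Some i then tri i else ~` Omegah M.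
pose H (o : option 'I_(ntri M)) : R * R -> R := if o is Some i then (fun x => beta x * q i x ^+ 2) else cst 0.
have cC o : closed (C o).
  by case: o => [i|] /=; [exact: closed_tri nd _|apply: open_closedC; exact: open_interior].
have cq i : continuous (q i) by have [? [? [[/poly_le_continuous]]]] := hq i.
have cH o : continuous (H o).
  case: o => [i|] x; last exact: cvg_cst.
  by apply: cvgM; [exact: cb|apply: cvgM; exact: cq].
have GH o x : C o x -> G x = H o x.
  case: o => [i|] /=.
    move=> tx; rewrite /G ifT; last by apply/asboolP; exists i.
    by have [? [? [_ [-> //]]]] := hq i.
  move=> nO; rewrite /G; case: ifPn => // /asboolP Ux.
  rewrite v0 ?expr0n ?mulr0//; exact/(GammahP nd).
have cov x : exists o, C o x.
  have [[i ti]|nU] := pselect (Umesh M x); first by exists (Some i).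
  by exists None => /= /interior_subset.
have cG : continuous G.
  by apply/continuous_subspace_setT; apply: (closed_cover_continuous cC cH GH) => x _; exact: cov.
have lipo o : exists2 L : R, 0 <= L & forall x t, C o x -> C o (t *: e + x) -> `|H o (t *: e + x) - H o x| <= L * `|t|.
  case: o => [i|]; last first.
    by exists 0 => // x t _ _; rewrite /= subrr normr0 mul0r.
  have [qx [qy [[_ hx hy] [_ hd _ _]]]] := hq i.
  pose dH x := dbeta x * q i x ^+ 2 + beta x * (2 * q i x * (e.1 * qx x + e.2 * qy x)).
  have dHH x : is_derive x e (H (Some i)) (dH x).
    have := hb x; have := hd x e => ? ?.
    rewrite -[H _]/(beta * (q i ^+ 2)); apply: is_derive_eq.
    by rewrite /dH /GRing.scale/= expr1 -[(q i ^+ 2) x]/(q i x ^+ 2); ring.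
  have cdH : continuous dH.
    have cx := poly_le_continuous hx; have cy := poly_le_continuous hy.
    move=> x; apply: cvgD; apply: cvgM; try exact: cdb; try exact: cb; first by apply: cvgM; exact: cq.
    apply: cvgM; first by apply: cvgM; [exact: cvg_cst|exact: cq].
    by apply: cvgD; apply: cvgM; try exact: cvg_cst; [exact: cx|exact: cy].
  have [L L0 hL] := box_lipschitz D dHH cdH; exists L => // x t tx tt.
  by apply: hL; [exact: (UD _ (ex_intro _ i tx))|exact: (UD _ (ex_intro _ i tt))].
have [L [L0 lipG]] : exists L : R, 0 <= L /\ forall x t, `|G (t *: e + x) - G x| <= L * `|t|.
  pose Lo o := s2val (cid2 (lipo o)).
  have Lo0 o : 0 <= Lo o by rewrite /Lo; case: (cid2 _).
  exists (\sum_o Lo o); split; first by apply: sumr_ge0 => o _; exact: Lo0.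
  apply: (closed_cover_lip_dir cC GH cov) => o x t Cx Ct.
  apply: (le_trans (s2valP' (cid2 (lipo o)) x t Cx Ct)); apply: ler_wpM2r => //.
  by rewrite -/(Lo o) (bigD1 o)//= lerDl sumr_ge0.
have [mN N0] := edge_lines_null cM.
have G0 x : ~ box D x -> G x = 0.
  by move=> nb; rewrite /G; case: ifPn => // /asboolP /UD.
have bdG : bmeas M dG0.
  have bv := bmeas_pwp hv; have b1 := bmeas_dx hv; have b2 := bmeas_dy hv.
  apply: bmeasD; apply: bmeasM; try exact: bmeas_continuous; first exact: bmeasX.
  apply: bmeasM; first by apply: bmeasM => //; exact: bmeas_cst.
  by apply: bmeasD; apply: bmeasM => //; exact: bmeas_cst.
pose dG := dG0 \_ (cells M).
have mdG : measurable_fun [set: rT * rT] (dG : rT * rT -> rT).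
  by apply: (iffLR (measurable_restrictT _ (measurable_cells M))); case: bdG.
have derG x : ~ edge_lines M x -> is_derive x e G (dG x).
  move=> nN; have [Ux|nU] := pselect (cells M x).
    rewrite /dG patchE mem_set//.
    have [i ox] := (cellsP M x).1 Ux; have [qx [qy [_ [eq hd hdv ed]]]] := hq i.
    have : is_derive x e (beta * (q i ^+ 2)) (dG0 x).
      have := hb x; have := hd x e => ? ?; apply: is_derive_eq.
      have [ax ay] := ed _ ox; rewrite /GRing.scale/= expr1 -[(q i ^+ 2) x]/(q i x ^+ 2) /dG0 (eq _ (otri_tri nd ox)) ax ay; ring.
    apply: near_eq_is_derive; apply: (otri_near ox) => y ty.
    rewrite /G ifT; last by apply/asboolP; exists i.
    by rewrite (eq _ ty).
  rewrite /dG patchE memNset//.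
  have nUm : ~ Umesh M x by move=> /Umesh_cells h; apply: nU; exact: h.
  have : is_derive x e (cst 0 : R * R -> R) 0 by exact: is_derive_cst.
  apply: near_eq_is_derive.
  have : nbhs x (~` Umesh M).
    by apply: open_nbhs_nbhs; split => //; apply: closed_openC; exact: (closed_Umesh nd).
  by apply: filterS => y ny; rewrite /G; case: ifPn => // /asboolP.
have [_] := integral_deriv0 cG G0 lipG mN N0 mdG derG.
rewrite /int_cells Rintegral_mkcond -/dG0 -/dG /Rintegral => ->//.
Qed.
End PW.

(** * Poincare inequality and stability of the form *)
Section Arith.
Variable R : realType.
Implicit Types a b c : R.

Lemma sqr_le_of_norm a b : `|a| <= b -> a ^+ 2 <= b ^+ 2.
Proof.
move=> h; have b0 : 0 <= b by exact: le_trans (normr_ge0 a) h.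
by rewrite -[a ^+ 2]real_normK ?num_real// lerXn2r// nnegrE.
Qed.

(** The constant is 4 rather than 2 so that its product with the constant of
    Poincare's inequality is a square. *)
Lemma convection_bound p q gx gy (B : R) : `|p| <= B -> `|q| <= B ->
  (p * gx + q * gy) ^+ 2 <= 4 * B ^+ 2 * (gx ^+ 2 + gy ^+ 2).
Proof.
move=> /sqr_le_of_norm hp /sqr_le_of_norm hq.
have p1 : p ^+ 2 * gx ^+ 2 <= B ^+ 2 * gx ^+ 2 by rewrite ler_wpM2r ?sqr_ge0.
have p2 : q ^+ 2 * gy ^+ 2 <= B ^+ 2 * gy ^+ 2 by rewrite ler_wpM2r ?sqr_ge0.
have := sqr_ge0 (p * gx - q * gy).
have n1 : 0 <= B ^+ 2 * gx ^+ 2 by rewrite mulr_ge0 ?sqr_ge0.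
have n2 : 0 <= B ^+ 2 * gy ^+ 2 by rewrite mulr_ge0 ?sqr_ge0.
have -> : (p * gx - q * gy) ^+ 2 = p ^+ 2 * gx ^+ 2 + q ^+ 2 * gy ^+ 2 - 2 * (p * gx * (q * gy)) by ring.
have -> : (p * gx + q * gy) ^+ 2 = p ^+ 2 * gx ^+ 2 + q ^+ 2 * gy ^+ 2 + 2 * (p * gx * (q * gy)) by ring.
by rewrite mulrDr -!mulrA; move: p1 p2 n1 n2; lra.
Qed.

(** The constants are chosen so that half of the square of v is absorbed by the
    left-hand side of Poincare's inequality. *)
Lemma poincare_young (D t v gx gy : R) : `|t| <= D ->
  -1 * (t * (2 * v * gx)) <= 2^-1 * v ^+ 2 + 2 * D ^+ 2 * (gx ^+ 2 + gy ^+ 2).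
Proof.
move=> /sqr_le_of_norm hx.
have h1 : t ^+ 2 * gx ^+ 2 <= D ^+ 2 * (gx ^+ 2 + gy ^+ 2).
  by apply: ler_pM; rewrite ?sqr_ge0// lerDl sqr_ge0.
have := sqr_ge0 (v + 2 * t * gx).
rewrite (_ : (v + 2 * t * gx) ^+ 2 = v ^+ 2 + 4 * (t * v * gx) + 4 * (t ^+ 2 * gx ^+ 2)); last by ring.
rewrite (_ : -1 * _ = - 2 * (t * v * gx)); last by ring.
by move: h1; rewrite -[2 * D ^+ 2 * _]mulrA; lra.
Qed.

Lemma poincare_arith (a c d e : R) : a + c = 0 -> -1 * c <= 2^-1 * a + 2 * e * d -> a <= 4 * e * d.
Proof. by rewrite -!mulrA; set q := e * d; lra. Qed.

(** Here X, Y, Z are the gradient norms of w, v and w - v, and I1, I2 the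
    diffusion and convection integrals of (w - v, v). *)
Lemma infsup_arith (nu th B D X Y Z I1 I2 : R) :
  0 < nu -> 0 <= X -> 0 <= Y -> 0 <= Z -> 0 <= D -> 0 <= B -> 0 <= th ->
  th * (2 * nu + 4 * B * D) <= nu / 2 -> Z <= th * X -> X <= Y + Z ->
  `|I1| <= Z * Y -> `|I2| <= 4 * B * D * (Z * Y) ->
  nu / 2 * (X * Y) <= nu * Y ^+ 2 + nu * I1 + I2 /\ (1 - th) * X <= Y.
Proof.
move=> nu0 X0 Y0 Z0 D0 B0 th0 thle hwv tri_ineq CS1 CS2.
have YX : (1 - th) * X <= Y by rewrite mulrBl mul1r; lra.
split => //.
have ZY : Z * Y <= th * X * Y by apply: ler_wpM2r.
have l1 : nu * `|I1| <= nu * (th * X * Y).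
  by apply: ler_wpM2l; [exact: ltW|exact: le_trans CS1 ZY].
have l2 : `|I2| <= 4 * B * D * (th * X * Y).
  by apply: (le_trans CS2); apply: ler_wpM2l => //; rewrite !mulr_ge0.
have l3 : nu * ((1 - th) * X * Y) <= nu * Y ^+ 2.
  by apply: ler_wpM2l; [exact: ltW|rewrite expr2; apply: ler_wpM2r].
have l4 : th * (2 * nu + 4 * B * D) * (X * Y) <= nu / 2 * (X * Y).
  by apply: ler_wpM2r => //; exact: mulr_ge0.
have a1 : - (nu * `|I1|) <= nu * I1.
  by rewrite -mulrN; apply: ler_wpM2l; [exact: ltW|have := ler_norm (- I1); rewrite normrN; lra].
have a2 : - `|I2| <= I2 by have := ler_norm (- I2); rewrite normrN; lra.
move: l1 l2 l3 l4 a1 a2; lra.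
Qed.
End Arith.

Section Energy.
Variable R : realType.
Implicit Types (x y z : R * R) (f g v w u : R * R -> R).
Variable M : mesh R.
Hypothesis cM : conforming M.
Variable k : nat.
Local Notation pwp := (pwp M k).
Local Notation bmeas := (bmeas M).
Local Notation int_cells := (int_cells M).

(** The Cauchy-Schwarz inequality for the inner product of gradients. *)
Lemma int_cells_CS2 f1 f2 g1 g2 : bmeas f1 -> bmeas f2 -> bmeas g1 -> bmeas g2 ->
  `|int_cells (fun x => f1 x * g1 x + f2 x * g2 x)| <=
   Num.sqrt (int_cells (fun x => f1 x ^+ 2 + f2 x ^+ 2)) * Num.sqrt (int_cells (fun x => g1 x ^+ 2 + g2 x ^+ 2)).
Proof.
move=> b1 b2 c1 c2.
have h0 (a1 a2 : R * R -> R) : 0 <= int_cells (fun x => a1 x ^+ 2 + a2 x ^+ 2).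
  by apply: int_cells_ge0 => x _; rewrite addr_ge0 ?sqr_ge0.
rewrite -ler_sqr ?nnegrE ?mulr_ge0 ?sqrtr_ge0// real_normK ?num_real// exprMn !sqr_sqrtr//.
apply: quad_CS => // t.
have bs (a1 a2 : R * R -> R) : bmeas a1 -> bmeas a2 -> bmeas (fun x => a1 x ^+ 2 + a2 x ^+ 2).
  by move=> ? ?; apply: bmeasD; exact: bmeasX.
have bp (a1 a2 d1 d2 : R * R -> R) : bmeas a1 -> bmeas a2 -> bmeas d1 -> bmeas d2 -> bmeas (fun x => a1 x * d1 x + a2 x * d2 x).
  by move=> ? ? ? ?; apply: bmeasD; exact: bmeasM.
have m1 := bmeasM (bmeas_cst M (t ^+ 2)) (bs _ _ b1 b2).
have m2 := bmeasM (bmeas_cst M (2 * t)) (bp _ _ _ _ b1 b2 c1 c2).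
rewrite -(int_cellsZ cM (t ^+ 2) (bs _ _ b1 b2)) -(int_cellsZ cM (2 * t) (bp _ _ _ _ b1 b2 c1 c2)).
rewrite -(int_cellsD cM m1 m2) -(int_cellsD cM (bmeasD m1 m2) (bs _ _ c1 c2)).
rewrite (@int_cells_ext _ _ _ (fun x => (t * f1 x + g1 x) ^+ 2 + (t * f2 x + g2 x) ^+ 2)); first exact: h0.
by move=> x _; ring.
Qed.

Lemma int_cells_sq_ge0 f1 f2 : 0 <= int_cells (fun x => f1 x ^+ 2 + f2 x ^+ 2).
Proof. by apply: int_cells_ge0 => x _; apply: addr_ge0; exact: sqr_ge0. Qed.

Lemma grad_normE w : grad_norm M w = Num.sqrt (int_cells (fun x => dx w x ^+ 2 + dy w x ^+ 2)).
Proof. by rewrite /grad_norm int_Omegah. Qed.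

Lemma grad_norm_sqr w : grad_norm M w ^+ 2 = int_cells (fun x => dx w x ^+ 2 + dy w x ^+ 2).
Proof. by rewrite grad_normE; apply: sqr_sqrtr; exact: int_cells_sq_ge0. Qed.

Lemma grad_norm_ge0 w : 0 <= grad_norm M w. Proof. exact: sqrtr_ge0. Qed.

(** Integrate by parts the derivative of x.1 v^2 along the first axis. *)
Lemma poincare v (D : R) : pwp v -> (forall x, Gammah M x -> v x = 0) -> (forall x, cells M x -> `|x.1| <= D) ->
  int_cells (fun x => v x ^+ 2) <= 4 * D ^+ 2 * int_cells (fun x => dx v x ^+ 2 + dy v x ^+ 2).
Proof.
move=> hv v0 hD.
have bv := bmeas_pwp cM hv; have b1 := bmeas_dx cM hv; have b2 := bmeas_dy cM hv.
have cf : continuous (fst : R * R -> R) by move=> x; exact: cvg_fst.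
have bf := bmeas_continuous cM cf.
have E := @mesh_ibp R M cM k (fst : R * R -> R) (cst 1) (1, 0) v cf (fun x => cvg_cst _)
   (fun x => is_derive_fst x (1, 0)) hv v0.
have bE : bmeas (fun x => x.1 * (2 * v x * dx v x)).
  exact: (bmeasM bf (bmeasM (bmeasM (bmeas_cst M 2) bv) b1)).
have E' : int_cells (fun x => v x ^+ 2) + int_cells (fun x => x.1 * (2 * v x * dx v x)) = 0.
  rewrite -(int_cellsD cM (bmeasX bv) bE).
  by rewrite -[RHS]E; apply: int_cells_ext => x _ /=; ring.
have Y : int_cells (fun x => (-1) * (x.1 * (2 * v x * dx v x))) <=
  int_cells (fun x => 2^-1 * v x ^+ 2 + 2 * D ^+ 2 * (dx v x ^+ 2 + dy v x ^+ 2)).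
  apply: (int_cells_le cM (bmeasM (bmeas_cst M _) bE)).
    exact: (bmeasD (bmeasM (bmeas_cst _ _) (bmeasX bv)) (bmeasM (bmeas_cst _ _) (bmeasD (bmeasX b1) (bmeasX b2)))).
  by move=> x Ux; apply: poincare_young; exact: hD.
have bq := bmeasD (bmeasX b1) (bmeasX b2).
rewrite (int_cellsZ cM _ bE) (int_cellsD cM (bmeasM (bmeas_cst _ _) (bmeasX bv)) (bmeasM (bmeas_cst _ _) bq)) in Y.
rewrite (int_cellsZ cM _ (bmeasX bv)) (int_cellsZ cM _ bq) in Y.
exact: poincare_arith E' Y.
Qed.

Lemma Cn_continuous n (g : R * R -> R) : Cn n g -> continuous g.
Proof. by case: n => [[]|n []]. Qed.

(** Twice the integrand plus v^2 div b is div (b v^2), whose integral is zero by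
    mesh_ibp along both axes. *)
Lemma convection_skew (b : R * R -> R * R) n v : Cn n.+1 (fst \o b) /\ Cn n.+1 (snd \o b) -> solenoidal b ->
  pwp v -> (forall x, Gammah M x -> v x = 0) ->
  int_cells (fun x => ((b x).1 * dx v x + (b x).2 * dy v x) * v x) = 0.
Proof.
move=> [[c1 [d1 [cx1 cy1]]] [c2 [d2 [cx2 cy2]]]] hdiv hv v0.
have bv := bmeas_pwp cM hv; have bdx := bmeas_dx cM hv; have bdy := bmeas_dy cM hv.
have b1 := bmeas_continuous cM c1; have b2 := bmeas_continuous cM c2.
have bb1 := bmeas_continuous cM (Cn_continuous cx1); have bb2 := bmeas_continuous cM (Cn_continuous cy2).
have E1 := mesh_ibp cM c1 (Cn_continuous cx1) (fun x => DeriveDef (d1 x).1 erefl) hv v0.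
have E2 := mesh_ibp cM c2 (Cn_continuous cy2) (fun x => DeriveDef (d2 x).2 erefl) hv v0.
have h2 : 2 * int_cells (fun x => ((b x).1 * dx v x + (b x).2 * dy v x) * v x) = 0.
  rewrite -(int_cellsZ cM 2 (bmeasM (bmeasD (bmeasM b1 bdx) (bmeasM b2 bdy)) bv)).
  have m (beta dbeta : R * R -> R) (e : R * R) (hb1 : bmeas beta) (hb2 : bmeas dbeta) :=
    bmeasD (bmeasM hb2 (bmeasX bv)) (bmeasM hb1 (bmeasM (bmeasM (bmeas_cst M 2) bv) (bmeasD (bmeasM (bmeas_cst M e.1) bdx) (bmeasM (bmeas_cst M e.2) bdy)))).
  rewrite -[RHS]addr0 -[X in _ = X + _]E1 -[X in _ = _ + X]E2.
  rewrite -(int_cellsD cM (m _ _ (1, 0) b1 bb1) (m _ _ (0, 1) b2 bb2)).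
  - apply: int_cells_ext => x _ /=; have := hdiv x.
    move=> /eqP; rewrite addr_eq0 => /eqP ->; ring.
by move/eqP: h2; rewrite mulf_eq0 pnatr_eq0/= => /eqP.
Qed.

(** Write w = v + z.  The form is nu |grad v|^2 plus the terms in (z, v), because
    the convection term of (v, v) vanishes; Poincare's inequality for v bounds
    the convection term of (z, v), and th is small enough to leave half of the
    leading term. *)
Lemma infsup_of_close (nu : R) (b : R * R -> R * R) n w v (D B th : R) :
  0 < nu -> Cn n.+1 (fst \o b) /\ Cn n.+1 (snd \o b) -> solenoidal b ->
  pwp w -> pwp v -> (forall x, Gammah M x -> v x = 0) ->
  (forall x, cells M x -> `|x.1| <= D) ->
  (forall x, cells M x -> `|(b x).1| <= B /\ `|(b x).2| <= B) -> 0 <= D -> 0 <= B ->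
  0 <= th -> th * (2 * nu + 4 * B * D) <= nu / 2 ->
  grad_norm M (fun x => w x - v x) <= th * grad_norm M w ->
  nu / 2 * (grad_norm M w * grad_norm M v) <= ah nu b M w v /\ (1 - th) * grad_norm M w <= grad_norm M v.
Proof.
move=> nu0 hb hdiv hw hv v0 hD hB D0 B0 th0 thle hwv.
have hz := pwpB hw hv; set z := (fun x => w x - v x) in hz hwv.
have bv := bmeas_pwp cM hv; have bdx := bmeas_dx cM hv; have bdy := bmeas_dy cM hv.
have bzx := bmeas_dx cM hz; have bzy := bmeas_dy cM hz.
have b1 : bmeas (fun x => (b x).1) by exact: (bmeas_continuous cM (Cn_continuous hb.1)).
have b2 : bmeas (fun x => (b x).2) by exact: (bmeas_continuous cM (Cn_continuous hb.2)).
have dw x : cells M x -> dx w x = dx v x + dx z x /\ dy w x = dy v x + dy z x.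
  by move=> Ux; have [-> ->] := dxB cM hw hv Ux; split; ring.
set X := grad_norm M w in hwv *; set Y := grad_norm M v; set Z := grad_norm M z in hwv.
have XX : X ^+ 2 = int_cells (fun x => dx w x ^+ 2 + dy w x ^+ 2) := grad_norm_sqr w.
have YY : Y ^+ 2 = int_cells (fun x => dx v x ^+ 2 + dy v x ^+ 2) := grad_norm_sqr v.
have ZZ : Z ^+ 2 = int_cells (fun x => dx z x ^+ 2 + dy z x ^+ 2) := grad_norm_sqr z.
have X0 : 0 <= X := grad_norm_ge0 w.
have Y0 : 0 <= Y := grad_norm_ge0 v.
have Z0 : 0 <= Z := grad_norm_ge0 z.
have bg (a1 a2 d1 d2 : R * R -> R) : bmeas a1 -> bmeas a2 -> bmeas d1 -> bmeas d2 -> bmeas (fun x => a1 x * d1 x + a2 x * d2 x).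
  by move=> ? ? ? ?; apply: bmeasD; exact: bmeasM.
have bs (a1 a2 : R * R -> R) : bmeas a1 -> bmeas a2 -> bmeas (fun x => a1 x ^+ 2 + a2 x ^+ 2).
  by move=> ? ?; apply: bmeasD; exact: bmeasX.
pose I1 := int_cells (fun x => dx z x * dx v x + dy z x * dy v x).
have CS1 : `|I1| <= Z * Y.
  by rewrite /Z /Y !grad_normE; exact: (int_cells_CS2 bzx bzy bdx bdy).
clearbody X Y Z.
have tri_ineq : X <= Y + Z.
  rewrite -ler_sqr ?nnegrE ?addr_ge0// sqrrD XX.
  have -> : int_cells (fun x => dx w x ^+ 2 + dy w x ^+ 2) = Y ^+ 2 + 2 * I1 + Z ^+ 2.
    have m1 := bg _ _ _ _ bzx bzy bdx bdy; have m2 := bmeasM (bmeas_cst M 2) m1.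
    rewrite YY ZZ /I1 -(int_cellsZ cM 2 m1) -(int_cellsD cM (bs _ _ bdx bdy) m2).
    rewrite -(int_cellsD cM (bmeasD (bs _ _ bdx bdy) m2) (bs _ _ bzx bzy)).
    by apply: int_cells_ext => x Ux; have [-> ->] := dw _ Ux; ring.
  have : I1 <= Z * Y by rewrite (le_trans (ler_norm _)).
  by clear; move: I1 => I; rewrite [Z * Y]mulrC mulr2n; lra.
pose I2 := int_cells (fun x => ((b x).1 * dx z x + (b x).2 * dy z x) * v x).
have bbz : bmeas (fun x => (b x).1 * dx z x + (b x).2 * dy z x) by exact: bg.
have CS2 : `|I2| <= 4 * B * D * (Z * Y).
  have h1 : I2 ^+ 2 <= (4 * B ^+ 2 * Z ^+ 2) * (4 * D ^+ 2 * Y ^+ 2).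
    apply: (le_trans (int_cells_CS cM bbz bv)); apply: ler_pM.
    - by apply: int_cells_ge0 => x _; exact: sqr_ge0.
    - by apply: int_cells_ge0 => x _; exact: sqr_ge0.
    - rewrite ZZ -(int_cellsZ cM _ (bs _ _ bzx bzy)).
      apply: (int_cells_le cM (bmeasX bbz) (bmeasM (bmeas_cst M _) (bs _ _ bzx bzy))).
      by move=> x Ux; have [B1 B2] := hB _ Ux; exact: convection_bound.
    - by rewrite YY; exact: (poincare hv v0 hD).
  rewrite -ler_sqr ?nnegrE ?mulr_ge0// real_normK ?num_real// (le_trans h1)//.
  by rewrite le_eqVlt; apply/orP; left; apply/eqP; ring.
have skew := convection_skew hb hdiv hv v0.
have ahE : ah nu b M w v = nu * Y ^+ 2 + nu * I1 + I2.
  have m1' := bs _ _ bdx bdy; have m1 := bmeasM (bmeas_cst M nu) m1'.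
  have m2' := bg _ _ _ _ bzx bzy bdx bdy; have m2 := bmeasM (bmeas_cst M nu) m2'.
  have m3 := bmeasM bbz bv; have m4 := bmeasM (bg _ _ _ _ b1 b2 bdx bdy) bv.
  have S := int_cellsD cM (bmeasD (bmeasD m1 m2) m3) m4.
  rewrite (int_cellsD cM (bmeasD m1 m2) m3) (int_cellsD cM m1 m2) (int_cellsZ cM nu m1') (int_cellsZ cM nu m2') -YY in S.
  rewrite -[RHS]addr0 -[X in _ = _ + X]skew -[RHS]S /ah (int_Omegah cM).
  by apply: int_cells_ext => x Ux; have [-> ->] := dw _ Ux; ring.
rewrite ahE; exact: (infsup_arith nu0 X0 Y0 Z0 D0 B0 th0 thle hwv tri_ineq CS1 CS2).
Qed.
End Energy.

(** * Scaling estimates for polynomials on a triangle *)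
Section TriPoly.
Variable R : realType.
Local Notation rT := (measurableTypeR R).
Local Notation area := (@area R).
Implicit Types (x y z : R * R).

(** Affine coordinates with origin at the vertex j, for which the triangle is
    the set a >= 0, b >= 0, a + b <= 1.  They are also used outside the triangle,
    where the nodes on the curved boundary may lie. *)
Definition tri_pt (M : mesh R) (i : 'I_(ntri M)) j (a b : R) : R * R :=
  vtx i j + a *: (endA i j - vtx i j) + b *: (endB i j - vtx i j).

Definition tri_area (M : mesh R) (i : 'I_(ntri M)) : R := fine (area (otri i : set (rT * rT))).

Lemma area_otri_fin (M : mesh R) (cM : conforming M) (i : 'I_(ntri M)) :
  (area (otri i : set (rT * rT)) < +oo)%E.
Proof.
apply: (le_lt_trans _ (area_cells cM)); apply: le_measure; rewrite ?inE.
- exact: measurable_otri.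
- exact: measurable_cells.
- by move=> x ox; apply/cellsP; exists i.
Qed.

Lemma tri_area_ge0 (M : mesh R) (i : 'I_(ntri M)) : 0 <= tri_area i.
Proof. by rewrite /tri_area fine_ge0. Qed.

Lemma area_homothety_fine (z : R * R) (r : R) (A : set (rT * rT)) : 0 < r -> measurable A ->
  fine (area ((fun x : rT * rT => (z + r *: x)%R) @^-1` A)) = r ^- 2 * fine (area A).
Proof.
move=> r0 mA; have := area_homothety z r0 mA.
set X := area _; set Y := area A => h.
have r2 : 0 < r ^+ 2 by rewrite exprn_gt0.
have -> : X = ((r ^- 2)%:E * Y)%E.
  by rewrite -h muleA -EFinM mulVf ?gt_eqF// mul1e.
case: Y {h} => [y| |]; first by rewrite -EFinM.
  by rewrite gt0_muley ?lte_fin ?invr_gt0//= mulr0.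
by rewrite gt0_muleNy ?lte_fin ?invr_gt0//= mulr0.
Qed.

(** The homothety of centre x0 and ratio th maps the triangle into itself, and
    the area of its image is th^2 times that of the triangle. *)
Lemma otri_lower (M : mesh R) (cM : conforming M) (i : 'I_(ntri M)) (g : R * R -> R) x0 (th m : R) :
  continuous g -> tri i x0 -> 0 < th <= 1 -> 0 <= m ->
  (forall y, otri i y -> m <= g (x0 + th *: (y - x0)) ^+ 2) ->
  th ^+ 2 * m * tri_area i <= \int[area]_(x in (otri i : set (rT * rT))) (g x ^+ 2).
Proof.
move=> cg tx0 /andP[th0 th1] m0 hm.
have nd := conf_nd cM.
have mo := measurable_otri i.
pose I : set (rT * rT) := (fun x : rT * rT => (x0 - th^-1 *: x0) + th^-1 *: x) @^-1` (otri i).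
have mI : measurable I.
  by rewrite -[I]setTI; apply: measurable_aff2.
have yE x : x0 + th *: ((x0 - th^-1 *: x0 + th^-1 *: x) - x0) = x.
  by rewrite addrAC [x0 - _]addrC addrK scalerDr scalerN !scalerA divff ?gt_eqF// !scale1r addrA subrr add0r.
have Io : I `<=` (otri i : set (rT * rT)).
  move=> x Ix; have := Ix; rewrite /I /= => ox j; rewrite -(yE x) lam_aff.
  have /(triP (nd i)) hx0 := tx0.
  apply: ltr_wpDl; last by apply: mulr_gt0 => //; exact: ox.
  by apply: mulr_ge0; [rewrite subr_ge0|exact: hx0].
have ig : area.-integrable (otri i : set (rT * rT)) (EFin \o (fun x => g x ^+ 2)).
  apply: (integrableS (measurable_cells M) mo).
    by move=> x ox; apply/cellsP; exists i.
  by apply: bmeas_integrable => //; apply: bmeasX; exact: bmeas_continuous.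
have igI : area.-integrable I (EFin \o (fun x => g x ^+ 2)) by exact: (integrableS mo mI Io ig).
have icI : area.-integrable I (EFin \o (fun=> m : R)).
  apply: measurable_bounded_integrable => //.
    by apply: le_lt_trans (area_otri_fin cM i); apply: le_measure; rewrite ?inE.
  by exists `|m|; split; [exact: num_real|move=> B mB x _; exact: ltW].
apply: (@le_trans _ _ (\int[area]_(x in I) (g x ^+ 2))).
  have -> : th ^+ 2 * m * tri_area i = \int[area]_(x in I) m.
    have th'0 : 0 < th^-1 by rewrite invr_gt0.
    rewrite (Rintegral_cst area mI) (area_homothety_fine _ th'0 mo).
    by rewrite exprVn invrK -/(tri_area i); ring.
  apply: le_Rintegral => // x Ix; rewrite -(yE x); exact: hm.
rewrite /Rintegral fine_le//; [exact: integrable_fin_num|exact: integrable_fin_num|].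
apply: ge0_subset_integral => //.
- by apply: (measurable_int area).
- by move=> x _; rewrite lee_fin sqr_ge0.
Qed.

Lemma otri_upper (M : mesh R) (cM : conforming M) (i : 'I_(ntri M)) (g : R * R -> R) (m : R) :
  bmeas M g -> (forall x, otri i x -> g x <= m) ->
  \int[area]_(x in (otri i : set (rT * rT))) g x <= m * tri_area i.
Proof.
move=> bg hm; have mo := measurable_otri i.
have sub : (otri i : set (rT * rT)) `<=` cells M by move=> x ox; apply/cellsP; exists i.
rewrite -Rintegral_cst//; apply: le_Rintegral => //.
  exact: (integrableS (measurable_cells M) mo sub (bmeas_integrable cM bg)).
exact: (integrableS (measurable_cells M) mo sub (bmeas_integrable cM (bmeas_cst M m))).
Qed.

Lemma tri_pt_in (M : mesh R) (cM : conforming M) (i : 'I_(ntri M)) j a b : 0 <= a -> 0 <= b -> a + b <= 1 -> tri i (tri_pt i j a b).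
Proof.
move=> a0 b0 ab; apply/(triP (conf_nd cM i)) => k.
have [e1 e2 e3] := lam_of_rep (conf_nd cM i) j a b.
by case: (ord3P j k) => ->; rewrite /tri_pt ?e1 ?e2 ?e3//; lra.
Qed.

Lemma tri_coords (M : mesh R) (cM : conforming M) (i : 'I_(ntri M)) j x : tri i x ->
  exists a b, [/\ 0 <= a, 0 <= b, a + b <= 1 & x = tri_pt i j a b].
Proof.
move=> tx; have /(triP (conf_nd cM i)) h := tx.
exists (lam i (ordS j) x), (lam i (ord_pred j) x); split => //; last exact: (lam_rep (conf_nd cM i)).
have := lam_sum (conf_nd cM i) x; rewrite (sum3E _ j); have := h j; lra.
Qed.

(** Two forms of the equivalence of norms on polynomials of degree k, with
    constants that depend on k only.  For the first, g varies by at most half of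
    g x0 on a homothetic image of the triangle with centre x0 and a ratio th
    fixed by k, which bounds the integral of g^2 from below.  The bound 2 on the
    coordinates leaves room for points beyond the edge. *)
Lemma tri_poly_estimates (k : nat) : (0 < k)%N -> exists2 K : R, 0 < K & exists2 c : R, 0 < c &
  (forall (M : mesh R) (cM : conforming M) (i : 'I_(ntri M)) j g, poly_le k g ->
    exists x0, [/\ tri i x0, (forall a b, `|a| <= 2 -> `|b| <= 2 -> `|g (tri_pt i j a b)| <= K * `|g x0|) &
      c * `|g x0| ^+ 2 * tri_area i <= \int[area]_(x in (otri i : set (rT * rT))) (g x ^+ 2)]) /\
  (forall (M : mesh R) (cM : conforming M) (i : 'I_(ntri M)) j g S, poly_le k g -> (forall x, tri i x -> `|g x| <= S) ->
    forall a b a' b', `|a| <= 2 -> `|b| <= 2 -> `|a'| <= 2 -> `|b'| <= 2 ->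
    `|g (tri_pt i j a b) - g (tri_pt i j a' b')| <= K * S * (`|a - a'| + `|b - b'|)).
Proof.
move=> k0; have [L L0 hL] := @poly_increment_bound R k 2 k0.
(* On the homothetic image with ratio th, g varies by at most 2 L th |g x0|. *)
pose th := (4 * L + 1)^-1.
have th0 : 0 < th by rewrite invr_gt0 addr_gt0// mulr_gt0.
have th1 : th <= 1 by rewrite invf_le1 ?addr_gt0 ?mulr_gt0// lerDr mulr_ge0// ltW.
have thL : 2 * L * th <= 2^-1.
  by rewrite /th ler_pdivrMr ?addr_gt0 ?mulr_gt0//; lra.
exists (1 + 6 * L); first by rewrite addr_gt0// mulr_gt0.
exists (th ^+ 2 / 4); first by rewrite divr_gt0// exprn_gt0.
split.
  move=> M cM i j g hg.
  have [a0 [b0 [ha0 hb0 hab H]]] := hL g hg (vtx i j) (endA i j - vtx i j) (endB i j - vtx i j).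
  have a02 : `|a0| <= 2 by rewrite ger0_norm//; lra.
  have b02 : `|b0| <= 2 by rewrite ger0_norm//; lra.
  have tx0 := tri_pt_in cM i j ha0 hb0 hab.
  exists (tri_pt i j a0 b0); split => //.
    move=> a b ha hb; have := H a b a0 b0 ha hb a02 b02; rewrite /= -/(tri_pt i j a b) -/(tri_pt i j a0 b0) => h.
    have d : `|a - a0| + `|b - b0| <= 6.
      rewrite (_ : 6 = (2 + 1) + (2 + 1)); last by ring.
      apply: lerD; rewrite (le_trans (ler_normB _ _))// lerD// ger0_norm//; lra.
    have -> : g (tri_pt i j a b) = g (tri_pt i j a0 b0) + (g (tri_pt i j a b) - g (tri_pt i j a0 b0)) by ring.
    rewrite (le_trans (ler_normD _ _))// mulrDl mul1r lerD2l (le_trans h)//.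
    rewrite [6 * L]mulrC [leRHS]mulrAC; apply: ler_wpM2l => //.
    by apply: mulr_ge0 => //; exact: ltW.
  rewrite (_ : _ * _ * tri_area i = th ^+ 2 * (`|g (tri_pt i j a0 b0)| ^+ 2 / 4) * tri_area i); last by ring.
  apply: (otri_lower cM (poly_le_continuous hg) tx0); [by rewrite th0|by rewrite divr_ge0// sqr_ge0|].
  move=> y oy; have [a [b [a_ge0 b_ge0 ab ->]]] := tri_coords cM j (otri_tri (conf_nd cM) oy).
  have -> : tri_pt i j a0 b0 + th *: (tri_pt i j a b - tri_pt i j a0 b0) = tri_pt i j (a0 + th * (a - a0)) (b0 + th * (b - b0)).
    rewrite /tri_pt [LHS]surjective_pairing [RHS]surjective_pairing /=.
    by congr pair; rewrite /GRing.scale/=; ring.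
  set a1 := a0 + _; set b1 := b0 + _.
  have th10 : 0 <= 1 - th by rewrite subr_ge0.
  have a1E : a1 = (1 - th) * a0 + th * a by rewrite /a1; ring.
  have b1E : b1 = (1 - th) * b0 + th * b by rewrite /b1; ring.
  have cv (u w : R) : 0 <= u -> u <= 1 -> 0 <= w -> w <= 1 -> `|(1 - th) * u + th * w| <= 2.
    move=> u0 u1 w0 w1; have p1 := mulr_ge0 th10 u0; have p2 := mulr_ge0 (ltW th0) w0.
    have p3 := ler_wpM2l th10 u1; have p4 := ler_wpM2l (ltW th0) w1.
    by rewrite ger0_norm; lra.
  have ha1 : `|a1| <= 2 by rewrite a1E; apply: cv => //; lra.
  have hb1 : `|b1| <= 2 by rewrite b1E; apply: cv => //; lra.
  have := H a1 b1 a0 b0 ha1 hb1 a02 b02; rewrite /= -/(tri_pt i j a1 b1) -/(tri_pt i j a0 b0).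
  have -> : a1 - a0 = th * (a - a0) by rewrite /a1; ring.
  have -> : b1 - b0 = th * (b - b0) by rewrite /b1; ring.
  rewrite !normrM (gtr0_norm th0).
  set g1 := g _; set g0 := g (tri_pt i j a0 b0) => h.
  have d : `|a - a0| + `|b - b0| <= 2.
    by rewrite (_ : 2 = 1 + 1)//; apply: lerD; rewrite ler_norml; apply/andP; split; lra.
  have h2 : `|g1 - g0| <= `|g0| / 2.
    apply: (le_trans h); rewrite -mulrDr.
    apply: (@le_trans _ _ (L * `|g0| * (th * 2))).
      by apply: ler_wpM2l; [apply: mulr_ge0 => //; exact: ltW|apply: ler_wpM2l => //; exact: ltW].
    rewrite (_ : L * `|g0| * (th * 2) = `|g0| * (2 * L * th)); last by ring.
    exact: ler_wpM2l.
  have h3 : `|g0| / 2 <= `|g1|.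
    have : `|g0| <= `|g1| + `|g1 - g0|.
      by rewrite -[X in `|X| <= _](subKr g1) (le_trans (ler_normB _ _)).
    by lra.
  have n0 : 0 <= `|g0| by [].
  have : (`|g0| / 2) ^+ 2 <= `|g1| ^+ 2 by rewrite lerXn2r// nnegrE ?divr_ge0.
  by rewrite real_normK ?num_real// expr_div_n (_ : 2 ^+ 2 = 4 :> R)//; ring.
move=> M cM i j g S hg hS a b a' b' ha hb ha' hb'.
have [a0 [b0 [ha0 hb0 hab H]]] := hL g hg (vtx i j) (endA i j - vtx i j) (endB i j - vtx i j).
have := H a b a' b' ha hb ha' hb'; rewrite /= -/(tri_pt i j a b) -/(tri_pt i j a' b') -/(tri_pt i j a0 b0) => h.
apply: (le_trans h); apply: ler_wpM2r; first exact: addr_ge0.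
have gS : `|g (tri_pt i j a0 b0)| <= S by apply: hS; exact: tri_pt_in.
apply: ler_pM => //; [exact: ltW|lra].
Qed.
End TriPoly.

(** * Shape regularity *)
Section Shape.
Variable R : realType.
Implicit Types (x y z : R * R).

Definition edgev (M : mesh R) (i : 'I_(ntri M)) (j : 'I_3) : R * R := endB i j - endA i j.

Lemma diam_ub (M : mesh R) (cM : conforming M) (i : 'I_(ntri M)) x y : tri i x -> tri i y ->
  edist x y <= Defs.diam (tri i).
Proof.
move=> tx ty; apply: ub_le_sup; last by exists (x, y).
have [D D0 UD] := Umesh_bounded cM.
exists (4 * D) => _ [[p q] [/= tp tq] <-].
have /boxP[p1 p2] := UD _ (ex_intro _ i tp); have /boxP[q1 q2] := UD _ (ex_intro _ i tq).
rewrite edistE (le_trans (enorm_le_sum _))//=.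
have := ler_normB p.1 q.1; have := ler_normB p.2 q.2; lra.
Qed.

Lemma lam_cross (M : mesh R) (i : 'I_(ntri M)) j x d : tdet i != 0 ->
  (lam i j (x + d) - lam i j x) * tdet i = cross (edgev i j) d.
Proof.
by move=> D0; rewrite /lam mulrBl !divfK// /cross /edgev/=; ring.
Qed.

(** A disc of radius r in the triangle contains a segment of length r in the
    direction normal to the edge (half of its diameter avoids the boundary of
    the disc), along which lam i j varies by at most 1. *)
Lemma indiam_le (M : mesh R) (cM : conforming M) (i : 'I_(ntri M)) j :
  indiam (tri i) * enorm (edgev i j) <= 2 * `|tdet i|.
Proof.
have D0 := conf_nd cM i.
set S := [set d | exists c, exists2 r, disc c r `<=` tri i & 0 < r /\ d = 2 * r].
have [e0|en0] := eqVneq (enorm (edgev i j)) 0; first by rewrite e0 mulr0 mulr_ge0.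
have epos : 0 < enorm (edgev i j) by rewrite lt_neqAle eq_sym en0 enorm_ge0.
have ubS d : S d -> d <= 2 * `|tdet i| / enorm (edgev i j).
  move=> [c [r sub [r0 ->]]]; rewrite ler_pdivlMr// -mulrA ler_pM2l//.
  (* Normal to the edge, of length r / 2, so that both c + n and c - n are in the
     disc. *)
  pose n := (r / (2 * enorm (edgev i j))) *: rot90 (edgev i j).
  have nrot : enorm (rot90 (edgev i j)) = enorm (edgev i j) by rewrite /enorm /rot90/= sqrrN addrC.
  have nn : enorm n = r / 2.
    by rewrite /n enormZ nrot ger0_norm ?divr_ge0 ?ltW// ?mulr_gt0//; field.
  have inT z : enorm z = r / 2 -> tri i (c + z).
    by move=> hz; apply: sub; rewrite /disc/= edistE opprD addrA subrr sub0r enormN hz; lra.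
  have t1 := inT n nn; have t2 : tri i (c - n) by apply: inT; rewrite enormN.
  have := lam_cross j (c - n) (n + n) D0; rewrite addrA subrK => h.
  have /(triP D0)/(_ j) l1 := t1; have l1' := lam_le1 D0 j t1.
  have /(triP D0)/(_ j) l2 := t2; have l2' := lam_le1 D0 j t2.
  have hc : cross (edgev i j) (n + n) = r * enorm (edgev i j).
    have -> : cross (edgev i j) (n + n) = r / enorm (edgev i j) * enorm (edgev i j) ^+ 2.
      by rewrite enorm_sqr /n /cross /rot90/= /GRing.scale/=; field.
    by field.
  have : `|cross (edgev i j) (n + n)| <= `|tdet i|.
    rewrite -h normrM ler_piMl// ler_norml; apply/andP; split; lra.
  by rewrite hc ger0_norm// mulr_ge0 ?ltW.
have [[d Sd]|nS] := pselect (S !=set0).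
  have : indiam (tri i) <= 2 * `|tdet i| / enorm (edgev i j) by apply: ge_sup => //; exists d.
  by rewrite ler_pdivlMr.
rewrite /indiam sup_out ?mul0r ?mulr_ge0//.
by move=> [h _]; apply: nS.
Qed.

(** Shape regularity in the form used below: it avoids suprema, and says that
    all angles are bounded from below. *)
Lemma shape_reg (M : mesh R) (cM : conforming M) (i : 'I_(ntri M)) (sigma : R) :
  Defs.diam (tri i) <= sigma * indiam (tri i) ->
  forall j j', enorm (edgev i j) * enorm (edgev i j') <= 2 * `|sigma| * `|tdet i|.
Proof.
move=> reg j j'; have nd := conf_nd cM i.
have h1 : enorm (edgev i j) <= Defs.diam (tri i).
  rewrite /edgev -edistE; apply: diam_ub => //; exact: tri_vtx nd _.
have h2 : enorm (edgev i j) <= `|sigma| * indiam (tri i).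
  apply: (le_trans h1); apply: (le_trans reg); apply: ler_wpM2r; last exact: ler_norm.
  have [[d Sd]|nS] := pselect ([set d | exists c, exists2 r, disc c r `<=` tri i & 0 < r /\ d = 2 * r] !=set0).
    have : 0 <= d by case: Sd => c [r _ [r0 ->]]; rewrite mulr_ge0// ltW.
    move=> d0; apply: (le_trans d0); apply: ub_le_sup => //.
    exists (Defs.diam (tri i) * 2) => _ [c [r sub [r0 ->]]].
    rewrite mulrC ler_pM2r//.
    have tc : tri i c by apply: sub; rewrite /disc/= edistE subrr /enorm/= expr0n addr0 sqrtr0.
    have t2 : tri i (c + (r / 2) *: (1, 0)).
      apply: sub; rewrite /disc/= edistE opprD addrA subrr sub0r enormN enormZ /enorm/= expr1n expr0n addr0 sqrtr1 mulr1.
      by rewrite gtr0_norm ?divr_gt0//; lra.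
    have t3 : tri i (c - (r / 2) *: (1, 0)).
      apply: sub; rewrite /disc/= edistE opprB addrCA subrr addr0 enormZ /enorm/= expr1n expr0n addr0 sqrtr1 mulr1.
      by rewrite gtr0_norm ?divr_gt0//; lra.
    have := diam_ub cM t2 t3; apply: le_trans.
    rewrite edistE opprD opprK addrACA subrr add0r -scalerDl enormZ /enorm/= expr1n expr0n addr0 sqrtr1 mulr1.
    by rewrite ger0_norm; lra.
  rewrite /indiam sup_out//; by move=> [h _]; apply: nS.
have := indiam_le cM i j' => h3.
apply: (@le_trans _ _ (`|sigma| * indiam (tri i) * enorm (edgev i j'))).
  by apply: ler_wpM2r => //; exact: enorm_ge0.
by rewrite -mulrA [2 * _]mulrC -[leRHS]mulrA; apply: ler_wpM2l.
Qed.

Lemma edgev_coord (M : mesh R) (i : 'I_(ntri M)) j :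
  enorm (endA i j - vtx i j) = enorm (edgev i (ord_pred j)) /\ enorm (endB i j - vtx i j) = enorm (edgev i (ordS j)).
Proof.
rewrite /edgev /endA /endB ord_predpred ord_predK ordSS ordSK; split => //.
by rewrite -enormN opprB.
Qed.

Lemma lip_derive_bound (r : R * R -> R) x (U : R * R) (d B : R) :
  is_derive x U r d -> (exists2 e : R, 0 < e & forall t, `|t| < e -> `|r (t *: U + x) - r x| <= B * `|t|) -> `|d| <= B.
Proof.
move=> [dr <-] [e e0 he].
have lim : (fun h : R => `|h^-1 *: ((r \o shift x) (h *: U) - r x)|) @ 0^' --> `|'D_U r x|.
  by apply: cvg_norm.
rewrite leNgt; apply/negP => lt.
have : \forall h \near (0:R)^', `|h^-1 *: ((r \o shift x) (h *: U) - r x)| <= B.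
  near=> h; rewrite /= normrM normfV.
  have h0 : h != 0 by near: h; exact: nbhs_dnbhs_neq.
  rewrite mulrC ler_pdivrMr ?normr_gt0//; apply: he.
  near: h; apply: nbhs_dnbhs; have := nbhsx_ballx (0 : R) e e0.
  by apply: filterS => h; rewrite /ball/= sub0r normrN.
have /cvgr_gt/(_ _ lt) := lim.
move=> h1 h2; have /filter_ex[h [h3 h4]] : \forall h \near (0 : R)^',
    B < `|h^-1 *: ((r \o shift x) (h *: U) - r x)| /\ `|h^-1 *: ((r \o shift x) (h *: U) - r x)| <= B.
  by apply: filterS2 h1 h2.
by move: h3; rewrite ltNge h4.
Unshelve. all: end_near.
Qed.
End Shape.

(** * Lagrange bubbles of an edge *)
Section Bubble.
Variable R : realType.
Implicit Types (x y z : R * R).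

(** The Lagrange polynomial of the node a = (k - m) / k, b = m / k: it vanishes
    on the lines k b = l for l < m and k a = l for l < k - m, that is, k lines
    that cover the other nodes of the edge a + b = 1 and, if 0 < m < k, the two
    other edges. *)
Definition ref_bubble (k m : nat) (a b : R) : R :=
  (\prod_(l < m) ((k%:R * b - l%:R) / (m%:R - l%:R))) *
  (\prod_(l < k - m) ((k%:R * a - l%:R) / ((k - m)%:R - l%:R))).

Lemma ref_bubble_b0 k m a : (0 < m)%N -> ref_bubble k m a 0 = 0.
Proof. by case: m => // m _; rewrite /ref_bubble big_ord_recl /= mulr0 subrr !mul0r. Qed.

Lemma ref_bubble_a0 k m b : (m < k)%N -> ref_bubble k m 0 b = 0.
Proof.
move=> mk; rewrite /ref_bubble; have : (0 < k - m)%N by rewrite subn_gt0.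
by case: (k - m)%N => // n _; rewrite [X in _ * X]big_ord_recl /= mulr0 subrr !mul0r mulr0.
Qed.

Lemma ref_bubble_node k m m' : (0 < m < k)%N -> (0 < m' < k)%N ->
  ref_bubble k m (1 - m'%:R / k%:R) (m'%:R / k%:R) = (m == m')%:R.
Proof.
move=> /andP[m0 mk] /andP[m'0 m'k].
have k0 : k%:R != 0 :> R by rewrite pnatr_eq0 -lt0n (leq_ltn_trans _ mk).
have e1 : k%:R * (m'%:R / k%:R) = m'%:R :> R by rewrite mulrC divfK.
have e2 : k%:R * (1 - m'%:R / k%:R) = (k - m')%:R :> R.
  by rewrite mulrBr mulr1 e1 natrB// ltnW.
rewrite /ref_bubble e1 e2; have [->|ne] := eqVneq m m'.
  rewrite !big1 ?mulr1// => l _; rewrite divff// subr_eq0 eqr_nat gtn_eqF//.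
have [lt|] := ltnP m' m.
  by rewrite (bigD1 (Ordinal lt))//= subrr !mul0r.
rewrite leq_eqVlt (negbTE ne) /= => lt.
have lt' : (k - m' < k - m)%N by rewrite ltn_sub2l.
by rewrite [X in _ * X](bigD1 (Ordinal lt'))//= subrr !mul0r mulr0.
Qed.

Lemma ref_bubble_bound k m (a b : R) : (0 < m < k)%N -> `|a| <= 1 -> `|b| <= 1 -> `|ref_bubble k m a b| <= (2 * k%:R) ^+ k.
Proof.
move=> /andP[m0 mk] ha hb.
have fac (n : nat) (u : R) (l : 'I_n) : (n <= k)%N -> `|u| <= 1 -> `|(k%:R * u - l%:R) / (n%:R - l%:R)| <= 2 * k%:R.
  move=> nk hu; rewrite normrM normfV.
  have ln := ltn_ord l.
  have d1 : 1 <= `|n%:R - l%:R| :> R.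
    by rewrite -natrB ?(ltnW ln)// normr_nat ler1n subn_gt0.
  rewrite ler_pdivrMr ?(lt_le_trans ltr01)//.
  have n1 : `|k%:R * u - l%:R| <= 2 * k%:R.
    rewrite (le_trans (ler_normB _ _))// normrM !normr_nat mulr2n mulrDl mul1r lerD//.
      by rewrite -[leRHS]mulr1 ler_wpM2l.
    by rewrite ler_nat (leq_trans (ltnW ln)).
  by apply: (le_trans n1); rewrite ler_peMr// mulr_ge0.
have pw (n : nat) (u : R) : (n <= k)%N -> `|u| <= 1 ->
    `|\prod_(l < n) ((k%:R * u - l%:R) / (n%:R - l%:R))| <= (2 * k%:R) ^+ n.
  move=> nk hu; rewrite normr_prod -[X in _ ^+ X](card_ord n) -prodr_const.
  by apply: ler_prod => l _; rewrite normr_ge0/=; exact: fac.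
rewrite /ref_bubble normrM (_ : (2 * k%:R) ^+ k = (2 * k%:R) ^+ m * (2 * k%:R) ^+ (k - m)); last by rewrite -exprD subnKC// ltnW.
by apply: ler_pM => //; apply: pw => //; [exact: ltnW|exact: leq_subr].
Qed.

Lemma poly_le_prod (n m : nat) (F : nat -> R * R -> R) (p : R * R -> R) :
  (forall l, exists c a b, forall x, F l x = c + a * x.1 + b * x.2) -> poly_le n p ->
  poly_le (m + n) (fun x => (\prod_(l < m) F l x) * p x).
Proof.
move=> hF hp; elim: m => [|m IH].
  by apply: poly_le_ext hp => x; rewrite big_ord0 mul1r.
have [c [a [b e]]] := hF m.
apply: poly_le_ext (poly_leMaff c a b IH) => x.
by rewrite big_ord_recr /= e; ring.
Qed.

Variable M : mesh R.
Hypothesis cM : conforming M.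

Definition bubble (k : nat) (i : 'I_(ntri M)) j (m : nat) x : R :=
  ref_bubble k m (lam i (ordS j) x) (lam i (ord_pred j) x).

(** A product of k affine functions. *)
Lemma poly_le_bubble k i j m : (m <= k)%N -> poly_le k (bubble k i j m).
Proof.
move=> mk.
have aff (j' : 'I_3) (u : R) (n : R) (l : nat) : exists c a b, forall x,
    (u * lam i j' x - l%:R) / (n - l%:R) = c + a * x.1 + b * x.2.
  have [g [c [_ h]]] := lam_lin i j'.
  exists ((u * c - l%:R) / (n - l%:R)), (u * g.1 / (n - l%:R)), (u * g.2 / (n - l%:R)) => x.
  by rewrite h; ring.
have h2 := poly_le_prod (k - m) (aff (ordS j) k%:R (k - m)%:R) (poly_le_cst 0 1).
have h1 := poly_le_prod m (aff (ord_pred j) k%:R m%:R) h2.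
rewrite addn0 subnKC// in h1.
by apply: poly_le_ext h1 => x; rewrite /bubble /ref_bubble mulr1.
Qed.

Lemma bubble_pt k (i : 'I_(ntri M)) j m a b : bubble k i j m (tri_pt i j a b) = ref_bubble k m a b.
Proof. by rewrite /bubble; have [_ -> ->] := lam_of_rep (conf_nd cM i) j a b. Qed.

Lemma bubble_zero k (i : 'I_(ntri M)) j m x : (0 < m < k)%N ->
  lam i (ordS j) x = 0 \/ lam i (ord_pred j) x = 0 -> bubble k i j m x = 0.
Proof. by move=> /andP[m0 mk] [] e; rewrite /bubble e ?ref_bubble_a0 ?ref_bubble_b0. Qed.

Definition node (k : nat) (i : 'I_(ntri M)) j (m : nat) : R * R :=
  pt_on (endA i j) (endB i j) (m%:R / k%:R).

Lemma nodeE k (i : 'I_(ntri M)) j m : node k i j m = tri_pt i j (1 - m%:R / k%:R) (m%:R / k%:R).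
Proof.
rewrite /node /pt_on /tri_pt [LHS]surjective_pairing [RHS]surjective_pairing /=.
by congr pair; rewrite /GRing.scale/=; ring.
Qed.

Lemma node_ray k (i : 'I_(ntri M)) j m (s : R) :
  node k i j m + s *: (node k i j m - vtx i j) = tri_pt i j ((1 + s) * (1 - m%:R / k%:R)) ((1 + s) * (m%:R / k%:R)).
Proof.
rewrite nodeE /tri_pt [LHS]surjective_pairing [RHS]surjective_pairing /=.
by congr pair; rewrite /GRing.scale/=; ring.
Qed.

Definition bubble_sum (k : nat) (i : 'I_(ntri M)) j (c : nat -> R) x : R :=
  \sum_(1 <= m < k) c m * bubble k i j m x.

Lemma poly_le_bubble_sum k i j c : poly_le k (bubble_sum k i j c).
Proof.
rewrite /bubble_sum; have : forall m, m \in index_iota 1 k -> (m <= k)%N.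
  by move=> m; rewrite mem_index_iota => /andP[_ /ltnW].
elim: (index_iota 1 k) => [|m s IH] h.
  by apply: poly_le_ext (poly_le_cst k 0) => x; rewrite big_nil.
have h1 : poly_le k (fun x => c m * bubble k i j m x).
  by apply/poly_leZ/poly_le_bubble/h; rewrite inE eqxx.
have h2 : poly_le k (fun x => \sum_(m <- s) c m * bubble k i j m x).
  by apply: IH => m' hm'; apply: h; rewrite inE hm' orbT.
by apply: poly_le_ext (poly_leD h1 h2) => x; rewrite big_cons.
Qed.

Lemma bubble_sum_zero k (i : 'I_(ntri M)) j c x :
  lam i (ordS j) x = 0 \/ lam i (ord_pred j) x = 0 -> bubble_sum k i j c x = 0.
Proof.
move=> h; rewrite /bubble_sum big_nat big1// => m hm; rewrite bubble_zero ?mulr0//.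
Qed.

Lemma bubble_sum_node k (i : 'I_(ntri M)) j c m : (0 < m < k)%N -> bubble_sum k i j c (node k i j m) = c m.
Proof.
move=> hm; rewrite /bubble_sum (bigD1_seq m)/= ?mem_index_iota ?iota_uniq//.
rewrite big_nat_cond big1 ?addr0; last first.
  move=> m' /andP[hm' ne]; rewrite nodeE bubble_pt ref_bubble_node//.
  by rewrite (negbTE ne) mulr0.
by rewrite nodeE bubble_pt ref_bubble_node// eqxx mulr1.
Qed.

Lemma bubble_sum_bound k (i : 'I_(ntri M)) j c x : tri i x ->
  `|bubble_sum k i j c x| <= (2 * k%:R) ^+ k * \sum_(1 <= m < k) `|c m|.
Proof.
move=> tx; have [a [b [a0 b0 ab ->]]] := tri_coords cM j tx.
rewrite /bubble_sum (le_trans (ler_norm_sum _ _ _))// mulr_sumr.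
rewrite big_nat [leRHS]big_nat; apply: ler_sum => m hm.
rewrite bubble_pt normrM mulrC; apply: ler_wpM2r => //.
by apply: ref_bubble_bound => //; rewrite ger0_norm//; lra.
Qed.

(** On the edge, q is a polynomial of degree at most k in one variable with k + 1
    zeros. *)
Lemma edge_poly_zero k (i : 'I_(ntri M)) j q : (0 < k)%N -> poly_le k q ->
  (forall m, (m <= k)%N -> q (node k i j m) = 0) ->
  forall s, q (pt_on (endA i j) (endB i j) s) = 0.
Proof.
move=> k0 hq h s.
have [p sp hp] := poly_le_line hq (endA i j) (endB i j - endA i j).
have kn0 : k%:R != 0 :> R by rewrite pnatr_eq0 -lt0n.
suff p0 : p = 0 by rewrite /pt_on hp p0 horner0.
apply: (@roots_geq_poly_eq0 _ p (mkseq (fun m => m%:R / k%:R : R) k.+1)) => //; last by rewrite size_mkseq.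
  apply/allP => _ /mapP[m + ->]; rewrite mem_iota add0n ltnS => /= mk.
  by rewrite /root -hp; apply/eqP; exact: h.
rewrite map_inj_uniq ?iota_uniq// => m m' /mulIf.
by rewrite invr_eq0 => /(_ kn0)/eqP; rewrite eqr_nat => /eqP.
Qed.
End Bubble.

(** * Energy of the boundary correction on one triangle *)
Section Local.
Variable R : realType.
Local Notation rT := (measurableTypeR R).
Local Notation area := (@area R).
Implicit Types (x y z U V : R * R).

Lemma dot_sqr_le (a b c d : R) : (a * c + b * d) ^+ 2 <= (a ^+ 2 + b ^+ 2) * (c ^+ 2 + d ^+ 2).
Proof. by rewrite -subr_ge0 (_ : _ - _ = (a * d - b * c) ^+ 2) ?sqr_ge0//; ring. Qed.

(** The gradient is recovered from two directional derivatives by Cramer's rule. *)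
Lemma grad_from_edges (U V : R * R) (gx gy al be B : R) : cross U V != 0 ->
  U.1 * gx + U.2 * gy = al -> V.1 * gx + V.2 * gy = be -> `|al| <= B -> `|be| <= B ->
  gx ^+ 2 + gy ^+ 2 <= 2 * B ^+ 2 * (enorm U ^+ 2 + enorm V ^+ 2) / cross U V ^+ 2.
Proof.
move=> D0 ea eb ha hb.
have D2 : 0 < cross U V ^+ 2 by rewrite lt_neqAle eq_sym sqrf_eq0 D0 sqr_ge0.
rewrite ler_pdivlMr//.
have -> : (gx ^+ 2 + gy ^+ 2) * cross U V ^+ 2 = (al * V.2 - be * U.2) ^+ 2 + (be * U.1 - al * V.1) ^+ 2.
  by rewrite -ea -eb /cross; ring.
rewrite !enorm_sqr.
have := sqr_le_of_norm ha; have := sqr_le_of_norm hb => b2 a2.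
have q1 := sqr_ge0 (al * V.2 + be * U.2); have q2 := sqr_ge0 (be * U.1 + al * V.1).
have s1 : al ^+ 2 * V.1 ^+ 2 <= B ^+ 2 * V.1 ^+ 2 by rewrite ler_wpM2r ?sqr_ge0.
have s2 : al ^+ 2 * V.2 ^+ 2 <= B ^+ 2 * V.2 ^+ 2 by rewrite ler_wpM2r ?sqr_ge0.
have s3 : be ^+ 2 * U.1 ^+ 2 <= B ^+ 2 * U.1 ^+ 2 by rewrite ler_wpM2r ?sqr_ge0.
have s4 : be ^+ 2 * U.2 ^+ 2 <= B ^+ 2 * U.2 ^+ 2 by rewrite ler_wpM2r ?sqr_ge0.
move: q1 q2.
have -> : (al * V.2 + be * U.2) ^+ 2 = al ^+ 2 * V.2 ^+ 2 + be ^+ 2 * U.2 ^+ 2 + 2 * (al * V.2 * (be * U.2)) by ring.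
have -> : (be * U.1 + al * V.1) ^+ 2 = be ^+ 2 * U.1 ^+ 2 + al ^+ 2 * V.1 ^+ 2 + 2 * (al * V.1 * (be * U.1)) by ring.
have -> : (al * V.2 - be * U.2) ^+ 2 = al ^+ 2 * V.2 ^+ 2 + be ^+ 2 * U.2 ^+ 2 - 2 * (al * V.2 * (be * U.2)) by ring.
have -> : (be * U.1 - al * V.1) ^+ 2 = be ^+ 2 * U.1 ^+ 2 + al ^+ 2 * V.1 ^+ 2 - 2 * (al * V.1 * (be * U.1)) by ring.
rewrite -mulrA !mulrDr; move: s1 s2 s3 s4; clear; lra.
Qed.

(** What is known of a trial function on one boundary triangle: it vanishes at
    the nodes moved by a relative amount sg m, at most s, along the rays from the
    opposite vertex. *)
Definition local_data (k : nat) (sig s : R) (M : mesh R) (i : 'I_(ntri M)) j (q : R * R -> R) (sg : nat -> R) :=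
  [/\ forall l l', enorm (edgev i l) * enorm (edgev i l') <= sig * `|tdet i|, 0 <= s <= 1,
   poly_le k q & forall m, (0 < m < k)%N -> `|sg m| <= s /\ q (node k i j m + sg m *: (node k i j m - vtx i j)) = 0].

Definition tri_energy (M : mesh R) (i : 'I_(ntri M)) (q : R * R -> R) : R :=
  \int[area]_(x in (otri i : set (rT * rT))) (dx q x ^+ 2 + dy q x ^+ 2).

(** The derivatives of q along the two edges through the vertex j are polynomials,
    so the energy of q bounds them in the maximum norm, on and around the
    triangle; mm is this bound.  The mean value theorem on the segment from the
    node to the zero of q on the same ray then bounds q at the node. *)
Lemma node_values (k : nat) : (0 < k)%N -> exists2 K : R, 0 < K & exists2 c : R, 0 < c &
  forall (M : mesh R) (cM : conforming M) (i : 'I_(ntri M)) j q sg (s sig : R), 0 <= sig ->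
  local_data k sig s i j q sg ->
  exists mm : R, [/\ 0 <= mm,
    c * mm ^+ 2 * tri_area i <= sig * `|tdet i| * tri_energy i q &
    forall m, (0 < m < k)%N -> `|q (node k i j m)| <= K * s * mm].
Proof.
move=> k0; have [K K0 [c c0 [H1 H2]]] := tri_poly_estimates R k0.
exists K => //; exists (c / 4); first by rewrite divr_gt0.
move=> M cM i j q sg s sig sig0 [shape /andP[s0 s1] hq hz].
set U := endA i j - vtx i j; set V := endB i j - vtx i j.
have D0 := conf_nd cM i.
have crUV : cross U V = tdet i by rewrite (tdetE i j).
have [qx [qy [hx hy hd]]] := poly_le_derive hq.
have dqx x : dx q x = qx x by have [_] := hd x (1, 0); rewrite /dx => ->; rewrite /= mul1r mul0r addr0.
have dqy x : dy q x = qy x by have [_] := hd x (0, 1); rewrite /dy => ->; rewrite /= mul1r mul0r add0r.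
(* Derivatives of q along the two edges. *)
pose g1 x := U.1 * qx x + U.2 * qy x; pose g2 x := V.1 * qx x + V.2 * qy x.
have hg1 : poly_le k g1 by apply: poly_leD; exact: poly_leZ.
have hg2 : poly_le k g2 by apply: poly_leD; exact: poly_leZ.
have [x1 [tx1 B1 I1]] := H1 M cM i j g1 hg1.
have [x2 [tx2 B2 I2]] := H1 M cM i j g2 hg2.
have [eU eV] := edgev_coord i j; rewrite -/U -/V in eU eV.
have U2 : enorm U ^+ 2 <= sig * `|tdet i| by rewrite eU expr2.
have V2 : enorm V ^+ 2 <= sig * `|tdet i| by rewrite eV expr2.
have sub : (otri i : set (rT * rT)) `<=` cells M by move=> x ox; apply/cellsP; exists i.
have int_bm f : bmeas M f -> area.-integrable (otri i : set (rT * rT)) (EFin \o f).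
  by move=> bf; exact: (integrableS (measurable_cells M) (measurable_otri i) sub (bmeas_integrable cM bf)).
have bqx := bmeas_continuous cM (poly_le_continuous hx).
have bqy := bmeas_continuous cM (poly_le_continuous hy).
have bg1 := bmeas_continuous cM (poly_le_continuous hg1).
have bg2 := bmeas_continuous cM (poly_le_continuous hg2).
have bE := bmeasD (bmeasX bqx) (bmeasX bqy).
set E := tri_energy i q.
have EE : E = \int[area]_(x in (otri i : set (rT * rT))) (qx x ^+ 2 + qy x ^+ 2).
  by apply: eq_Rintegral => x _; rewrite dqx dqy.
have E0 : 0 <= E by apply: Rintegral_ge0 => x _; apply: addr_ge0; exact: sqr_ge0.
have bnd (W : R * R) (g : R * R -> R) : bmeas M g -> (forall x, g x = W.1 * qx x + W.2 * qy x) -> enorm W ^+ 2 <= sig * `|tdet i| ->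
    \int[area]_(x in (otri i : set (rT * rT))) (g x ^+ 2) <= sig * `|tdet i| * E.
  move=> bg gE W2; apply: (@le_trans _ _ (enorm W ^+ 2 * E)); last by apply: ler_wpM2r.
  rewrite EE -(RintegralZl _ (measurable_otri i) (int_bm _ bE)).
  apply: (le_Rintegral (measurable_otri i) (int_bm _ (bmeasX bg)) (int_bm _ (bmeasM (bmeas_cst M _) bE))) => x _.
  by rewrite gE enorm_sqr; exact: dot_sqr_le.
have J1 := le_trans I1 (bnd U g1 bg1 (fun=> erefl) U2).
have J2 := le_trans I2 (bnd V g2 bg2 (fun=> erefl) V2).
exists (`|g1 x1| + `|g2 x2|); split.
- by apply: addr_ge0.
- have : (`|g1 x1| + `|g2 x2|) ^+ 2 <= 2 * (`|g1 x1| ^+ 2 + `|g2 x2| ^+ 2).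
    have := sqr_ge0 (`|g1 x1| - `|g2 x2|); rewrite sqrrB sqrrD !mulr2n; clear; lra.
  move=> sq; apply: (@le_trans _ _ (c / 4 * (2 * (`|g1 x1| ^+ 2 + `|g2 x2| ^+ 2)) * tri_area i)).
    by apply: ler_wpM2r; [exact: tri_area_ge0|apply: ler_wpM2l => //; rewrite divr_ge0// ltW].
  move: J1 J2; clear; rewrite -/E; set a := `|g1 x1| ^+ 2; set b := `|g2 x2| ^+ 2; set d := sig * _ * E; set t := tri_area i.
  lra.
- move=> m hm; have [sm qz] := hz m hm; move: (hm) => /andP[m0 mk].
  set N := node k i j m in qz *.
  have kpos : 0 < k%:R :> R by rewrite ltr0n.
  set tau := m%:R / k%:R : R.
  have tau0 : 0 <= tau by rewrite divr_ge0.
  have tau1 : tau <= 1 by rewrite ler_pdivrMr// mul1r ler_nat ltnW.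
  have bound t : `|t| <= `|sg m| -> `|(N - vtx i j).1 * qx (t *: (N - vtx i j) + N) + (N - vtx i j).2 * qy (t *: (N - vtx i j) + N)| <= K * (`|g1 x1| + `|g2 x2|).
    move=> ht; rewrite [t *: _ + N]addrC /N node_ray -/tau.
    have t1 : `|t| <= 1 by rewrite (le_trans ht)// (le_trans sm).
    have cb u : 0 <= u -> u <= 1 -> `|(1 + t) * u| <= 2.
      move=> u0 u1; rewrite normrM (ger0_norm u0) -[2]mulr1; apply: ler_pM => //.
      by rewrite (le_trans (ler_normD _ _))// normr1; lra.
    have c1 : `|(1 + t) * (1 - tau)| <= 2 by apply: cb; lra.
    have c2 := cb _ tau0 tau1.
    set y := tri_pt _ _ _ _.
    have -> : (node k i j m - vtx i j).1 * qx y + (node k i j m - vtx i j).2 * qy y = (1 - tau) * g1 y + tau * g2 y.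
      by rewrite nodeE /tri_pt /g1 /g2 /U /V -/tau /= /GRing.scale/=; ring.
    rewrite (le_trans (ler_normD _ _))// [leRHS]mulrDr lerD// normrM.
      rewrite -[leRHS]mul1r; apply: ler_pM => //; last exact: B1.
      by rewrite ger0_norm; lra.
    rewrite -[leRHS]mul1r; apply: ler_pM => //; last exact: B2.
    by rewrite ger0_norm.
  have shrink r : 0 <= r <= 1 -> `|r * sg m| <= `|sg m|.
    by move=> /andP[r0 r1]; rewrite normrM ger0_norm// ler_piMl.
  have := segment_lipschitz (fun y => hd y (N - vtx i j)) (fun r hr => bound (r * sg m) (shrink r hr)).
  rewrite [sg m *: _ + N]addrC qz sub0r normrN => h.
  apply: (le_trans h); rewrite mulrAC; apply: ler_wpM2r; first exact: addr_ge0.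
  by apply: ler_wpM2l => //; exact: ltW.
Qed.

(** An inverse inequality: on a triangle the derivative of a polynomial along an
    edge vector is bounded by the polynomial itself. *)
Lemma energy_upper (k : nat) : (0 < k)%N -> exists2 K : R, 0 < K &
  forall (M : mesh R) (cM : conforming M) (i : 'I_(ntri M)) (j : 'I_3) q (sig : R), 0 <= sig ->
  (forall l l', enorm (edgev i l) * enorm (edgev i l') <= sig * `|tdet i|) -> poly_le k q ->
  forall S, 0 <= S -> (forall x, tri i x -> `|q x| <= S) ->
  tri_energy i q <= K * sig * S ^+ 2 / `|tdet i| * tri_area i.
Proof.
move=> k0; have [K K0 [c c0 [H1 H2]]] := tri_poly_estimates R k0.
exists (4 * K ^+ 2); first by rewrite mulr_gt0// exprn_gt0.
move=> M cM i j q sig sig0 shape hq.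
set U := endA i j - vtx i j; set V := endB i j - vtx i j.
have D0 := conf_nd cM i.
have crUV : cross U V = tdet i by rewrite (tdetE i j).
have [qx [qy [hx hy hd]]] := poly_le_derive hq.
have dqx x : dx q x = qx x by have [_] := hd x (1, 0); rewrite /dx => ->; rewrite /= mul1r mul0r addr0.
have dqy x : dy q x = qy x by have [_] := hd x (0, 1); rewrite /dy => ->; rewrite /= mul1r mul0r add0r.
pose g1 x := U.1 * qx x + U.2 * qy x; pose g2 x := V.1 * qx x + V.2 * qy x.
have [eU eV] := edgev_coord i j; rewrite -/U -/V in eU eV.
have U2 : enorm U ^+ 2 <= sig * `|tdet i| by rewrite eU expr2.
have V2 : enorm V ^+ 2 <= sig * `|tdet i| by rewrite eV expr2.
have bqx := bmeas_continuous cM (poly_le_continuous hx).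
have bqy := bmeas_continuous cM (poly_le_continuous hy).
have bE := bmeasD (bmeasX bqx) (bmeasX bqy).
set E := tri_energy i q.
have EE : E = \int[area]_(x in (otri i : set (rT * rT))) (qx x ^+ 2 + qy x ^+ 2).
  by apply: eq_Rintegral => x _; rewrite dqx dqy.
move=> S S0 hS.
have der (W : R * R) (g : R * R -> R) : (W = U \/ W = V) -> (forall x, is_derive x W q (g x)) -> forall x, tri i x -> `|g x| <= K * S.
  move=> hW hg x tx; have [a [b [a0 b0 ab ->]]] := tri_coords cM j tx.
  apply: (lip_derive_bound (hg _)); exists 1 => // t t1.
  have a2 : `|a| <= 2 by rewrite ger0_norm//; move: a0 b0 ab; clear; lra.
  have b2 : `|b| <= 2 by rewrite ger0_norm//; move: a0 b0 ab; clear; lra.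
  have at2 : `|a + t| <= 2.
    by rewrite (le_trans (ler_normD _ _))// (ger0_norm a0); move: a0 b0 ab t1; clear; lra.
  have bt2 : `|b + t| <= 2.
    by rewrite (le_trans (ler_normD _ _))// (ger0_norm b0); move: a0 b0 ab t1; clear; lra.
  case: hW => ->.
    have -> : t *: U + tri_pt i j a b = tri_pt i j (a + t) b.
      rewrite /tri_pt -/U -/V [LHS]surjective_pairing [RHS]surjective_pairing /=.
      by congr pair; rewrite /GRing.scale/=; ring.
    have := H2 M cM i j q S hq hS (a + t) b a b at2 b2 a2 b2.
    by rewrite subrr normr0 addr0 [a + t]addrC addrK.
  have -> : t *: V + tri_pt i j a b = tri_pt i j a (b + t).
    rewrite /tri_pt -/U -/V [LHS]surjective_pairing [RHS]surjective_pairing /=.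
    by congr pair; rewrite /GRing.scale/=; ring.
  have := H2 M cM i j q S hq hS a (b + t) a b a2 bt2 a2 b2.
  by rewrite subrr normr0 add0r [b + t]addrC addrK.
have d1 := der U g1 (or_introl erefl) (fun x => hd x U).
have d2 := der V g2 (or_intror erefl) (fun x => hd x V).
have nD : 0 < `|tdet i| by rewrite normr_gt0.
rewrite EE; apply: (le_trans (otri_upper cM bE (m := 2 * (K * S) ^+ 2 * (enorm U ^+ 2 + enorm V ^+ 2) / cross U V ^+ 2) _)).
  move=> x ox; have tx := otri_tri (conf_nd cM) ox.
  apply: (grad_from_edges _ erefl erefl); [by rewrite crUV|exact: d1|exact: d2].
apply: ler_wpM2r; first exact: tri_area_ge0.
rewrite crUV -[tdet i ^+ 2]real_normK ?num_real//.
rewrite ler_pdivrMr ?exprn_gt0// (_ : _ / _ * _ = (4 * K ^+ 2) * S ^+ 2 * (sig * `|tdet i|)); last first.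
  by field; rewrite gt_eqF.
apply: (@le_trans _ _ (4 * K ^+ 2 * S ^+ 2 * (sig * `|tdet i|))).
  rewrite (_ : 2 * (K * S) ^+ 2 * _ = 2 * K ^+ 2 * S ^+ 2 * (enorm U ^+ 2 + enorm V ^+ 2)); last by ring.
  rewrite (_ : 4 * K ^+ 2 * S ^+ 2 * _ = 2 * K ^+ 2 * S ^+ 2 * (sig * `|tdet i| + sig * `|tdet i|)); last by ring.
  apply: ler_wpM2l; last exact: lerD.
  apply: mulr_ge0; last exact: exprn_ge0.
  by apply: mulr_ge0 => //; apply: exprn_ge0; exact: ltW.
by [].
Qed.

(** By node_values the coefficients of the bubbles, hence the bubbles, are at most
    of order s times the gradient of q; energy_upper bounds their energy.  The
    area and the determinant cancel.  The second part serves when the energy of q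
    is zero. *)
Lemma local_estimate (k : nat) : (0 < k)%N -> exists2 C : R, 0 < C &
  forall (M : mesh R) (cM : conforming M) (i : 'I_(ntri M)) (j : 'I_3) q sg (s sig : R), 0 <= sig ->
  local_data k sig s i j q sg ->
  tri_energy i (bubble_sum k i j (fun m => q (node k i j m))) <= C * sig ^+ 2 * s ^+ 2 * tri_energy i q /\
  (tri_energy i q = 0 -> 0 < tri_area i -> forall m, (0 < m < k)%N -> q (node k i j m) = 0).
Proof.
move=> k0; have [K K0 [c c0 H1]] := node_values k0; have [K' K'0 H2] := energy_upper k0.
pose F : R := (2 * k%:R) ^+ k * k%:R * K.
have kpos : 0 < k%:R :> R by rewrite ltr0n.
have F0 : 0 < F by rewrite /F !mulr_gt0// exprn_gt0// mulr_gt0.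
exists (K' * F ^+ 2 / c); first by rewrite divr_gt0// mulr_gt0// exprn_gt0.
move=> M cM i j q sg s sig sig0 loc; have [mm [mm0 h1 h2]] := H1 M cM i j q sg s sig sig0 loc.
have [shape /andP[s0 s1] hq _] := loc.
have D0 : 0 < `|tdet i| by rewrite normr_gt0; exact: conf_nd.
split; last first.
  move=> E0 t0 m hm; move: h1; rewrite E0 mulr0 pmulr_lle0// pmulr_rle0// => mm2.
  have mmz : mm = 0 by apply/eqP; rewrite -sqrf_eq0 eq_le mm2 sqr_ge0.
  by have := h2 m hm; rewrite mmz mulr0 normr_le0 => /eqP.
have S0 : 0 <= F * s * mm by apply: mulr_ge0 => //; apply: mulr_ge0 => //; exact: ltW.
have hS x : tri i x -> `|bubble_sum k i j (fun m => q (node k i j m)) x| <= F * s * mm.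
  move=> tx; apply: (le_trans (bubble_sum_bound cM k j _ tx)).
  rewrite /F -!mulrA; apply: ler_wpM2l; first by rewrite exprn_ge0// mulr_ge0.
  apply: (@le_trans _ _ (\sum_(1 <= m < k) K * s * mm)).
    by rewrite big_nat [leRHS]big_nat; apply: ler_sum => m hm; exact: h2.
  rewrite sumr_const_nat -[_ *+ _]mulr_natl !mulrA; apply: ler_wpM2r => //.
  apply: ler_wpM2r => //; apply: ler_wpM2r; first exact: ltW.
  by rewrite ler_nat leq_subr.
apply: (le_trans (H2 M cM i j _ sig sig0 shape (poly_le_bubble_sum _ _ _ _) _ S0 hS)).
rewrite (_ : K' * sig * _ / _ * _ = K' * F ^+ 2 / c * sig * s ^+ 2 / `|tdet i| * (c * mm ^+ 2 * tri_area i)); last first.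
  by field; rewrite !gt_eqF.
rewrite (_ : K' * F ^+ 2 / c * sig ^+ 2 * s ^+ 2 * _ = K' * F ^+ 2 / c * sig * s ^+ 2 / `|tdet i| * (sig * `|tdet i| * tri_energy i q)); last first.
  by field; rewrite !gt_eqF.
apply: ler_wpM2l => //.
rewrite divr_ge0 ?(ltW D0)//; apply: mulr_ge0; last exact: sqr_ge0.
by apply: mulr_ge0 => //; rewrite divr_ge0 ?(ltW c0)// mulr_ge0 ?(ltW K'0)// sqr_ge0.
Qed.
End Local.

(** * Nodes on the curved boundary *)
Section Nodes.
Variable R : realType.
Implicit Types (x y z : R * R).

Lemma diam_meshsize (M : mesh R) (i : 'I_(ntri M)) : Defs.diam (tri i) <= meshsize M.
Proof. by rewrite /meshsize; apply: le_bigmax. Qed.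

(** The conclusion of shape_reg as a property of a mesh. *)
Definition shape_ok (sig : R) (M : mesh R) :=
  forall (i : 'I_(ntri M)) l l', enorm (edgev i l) * enorm (edgev i l') <= sig * `|tdet i|.

(** The equivalence says that the nearest intersection exists and is unique. *)
Definition node_shift (k : nat) Omega (M : mesh R) (s : R) (i : 'I_(ntri M)) j m (sg : R) :=
  `|sg| <= s /\ forall P, nearest_on (bdry Omega) (line (vtx i j) (node k i j m)) (node k i j m) P <->
     P = node k i j m + sg *: (node k i j m - vtx i j).

(** Shape regularity makes the ray from the opposite vertex transversal to the
    edge, so boundary_nodes applies; the same property converts the bound on the
    distance into a bound relative to the length of the ray. *)
Lemma mesh_nodes (k : nat) (Omega : set (R * R)) (sig s : R) : (2 <= k)%N -> domain Omega ->
  smooth_boundary k Omega -> 0 <= sig -> 0 < s ->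
  exists2 h0 : R, 0 < h0 & forall M : mesh R, conforming M -> shape_ok sig M ->
    (forall (i : 'I_(ntri M)) j, Gammah M (vtx i j) -> bdry Omega (vtx i j)) -> meshsize M <= h0 ->
    forall (i : 'I_(ntri M)) j m, in_Sh i j -> (0 < m < k)%N -> exists sg, node_shift k Omega s i j m sg.
Proof.
move=> k2 dO sO sig0 s0.
pose kap := (2 * sig + 1)^-1.
have kap0 : 0 < kap by rewrite invr_gt0 ltr_wpDl// mulr_ge0.
have s10 : 0 < sig + 1 by rewrite ltr_wpDl.
pose eps := s / (sig + 1).
have eps0 : 0 < eps by rewrite divr_gt0.
have [del del0 H] := boundary_nodes k2 dO sO kap0 eps0.
exists (del / 2); first by rewrite divr_gt0.
move=> M cM shape vG hM i j m Sh hm.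
have nd := conf_nd cM i; have D0 : 0 < `|tdet i| by rewrite normr_gt0.
set A := endA i j; set B := endB i j; set O := vtx i j.
have tA : tri i A by exact: tri_vtx nd _.
have tB : tri i B by exact: tri_vtx nd _.
have eA : edge i j A by apply/(edgeP nd); split => //; rewrite (lam_vtx nd) neq_ordS.
have eB : edge i j B by apply/(edgeP nd); split => //; rewrite (lam_vtx nd) neq_ord_pred.
have GA : bdry Omega A by apply: vG; exact: Sh eA.
have GB : bdry Omega B by apply: vG; exact: Sh eB.
have crUV : cross (A - O) (B - O) = tdet i by rewrite (tdetE i j).
have neAB : A <> B.
  move=> e; have : cross (A - O) (B - O) = 0 by rewrite e /cross; ring.
  by rewrite crUV => /eqP; rewrite (negbTE nd).
have AB : edist A B < del.
  apply: (le_lt_trans (diam_ub cM tA tB)); apply: (le_lt_trans (diam_meshsize i)).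
  by apply: (le_lt_trans hM); rewrite ltr_pdivrMr// ltr_pMr// ltr1n.
pose tau := m%:R / k%:R : R.
move: (hm) => /andP[m0 mk].
have kpos : 0 < k%:R :> R by rewrite ltr0n (leq_ltn_trans _ mk).
have tau0 : 0 <= tau by rewrite divr_ge0// ltW.
have tau1 : tau <= 1 by rewrite ler_pdivrMr// mul1r ler_nat ltnW.
set N := node k i j m.
have NE : N = A + tau *: (B - A) by [].
pose z := N - O.
have zE : z = (1 - tau) *: (A - O) + tau *: (B - O).
  rewrite /z NE [LHS]surjective_pairing [RHS]surjective_pairing /=.
  by congr pair; rewrite /GRing.scale/=; ring.
have crz : cross z (B - A) = tdet i.
  by rewrite -crUV zE /cross/= /GRing.scale/=; ring.
have z0 : z <> 0.
  move=> e; move: crz; rewrite e /cross/= !mul0r subrr => /esym/eqP; by rewrite (negbTE nd).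
have [eU eV] := edgev_coord i j; rewrite -/A -/B -/O in eU eV.
have nz : enorm z <= enorm (A - O) + enorm (B - O).
  rewrite zE (le_trans (enorm_triangle _ _))// !enormZ !ger0_norm ?subr_ge0// lerD// ler_piMl ?enorm_ge0//.
  by rewrite lerBlDl lerDr.
have sh1 := shape i (ord_pred j) j; have sh2 := shape i (ordS j) j; have sh3 := shape i j j.
rewrite -eU -/(edgev i j) in sh1; rewrite -eV in sh2.
have trans : kap * enorm z * enorm (B - A) <= `|cross z (B - A)|.
  rewrite crz /kap -mulrA mulrC ler_pdivrMr; last by rewrite ltr_wpDl// mulr_ge0.
  apply: (@le_trans _ _ ((enorm (A - O) + enorm (B - O)) * enorm (edgev i j))).
    by apply: ler_wpM2r => //; exact: enorm_ge0.
  rewrite mulrDl; apply: (le_trans (lerD sh1 sh2)).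
  by move: D0; clear; set t := `|_|; set q := sig; move=> t0; rewrite mulrDr mulr1; move: t0; lra.
have tau01 : 0 <= tau <= 1 by rewrite tau0.
have [sg [GP sgle uniq]] := H A B tau z GA GB AB neAB tau01 trans z0.
rewrite -NE in GP uniq.
have nz0 : 0 < enorm z.
  by rewrite lt_neqAle enorm_ge0 andbT; apply/eqP => /esym/enorm_eq0.
have dist t : edist N (N + t *: z) = `|t| * enorm z.
  by rewrite edistE opprD addrA subrr sub0r enormN enormZ.
have lineP Q : line O N Q <-> exists t, Q = N + t *: z.
  split=> [[u _ <-]|[t ->]].
    exists (u - 1); rewrite /pt_on /z [LHS]surjective_pairing [RHS]surjective_pairing /=.
    by congr pair; rewrite /GRing.scale/=; ring.
  exists (t + 1) => //; rewrite /pt_on /z [LHS]surjective_pairing [RHS]surjective_pairing /=.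
  by congr pair; rewrite /GRing.scale/=; ring.
exists sg; split.
  have : `|sg| * `|tdet i| <= s * `|tdet i|.
    apply: (@le_trans _ _ (`|sg| * (enorm z * enorm (B - A)))).
      apply: ler_wpM2l => //; rewrite -crz; exact: cross_le_enorm.
    rewrite mulrA; apply: (@le_trans _ _ (eps * enorm (B - A) * enorm (B - A))).
      by apply: ler_wpM2r => //; exact: enorm_ge0.
    rewrite -mulrA; apply: (@le_trans _ _ (eps * (sig * `|tdet i|))).
      by apply: ler_wpM2l; [exact: ltW|exact: sh3].
    rewrite mulrA; apply: ler_wpM2r => //.
    by rewrite /eps mulrAC ler_pdivrMr// ler_wpM2l ?ltW// ltrDl.
  by rewrite ler_pM2r.
move=> P; split.
  move=> [[GPP /lineP[t Pt]] near]; rewrite Pt; congr (_ + _ *: _).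
  apply: uniq; first by rewrite -Pt.
  have : edist N P <= edist N (N + sg *: z).
    by apply: near; split => //; apply/lineP; exists sg.
  by rewrite Pt !dist ler_pM2r.
move=> ->; split; first by split => //; apply/lineP; exists sg.
move=> Q [GQ /lineP[t Qt]]; rewrite Qt !dist.
have [le|/ltW le] := leP `|t| `|sg|; last by apply: ler_wpM2r => //; exact: ltW.
by rewrite (uniq t) // -Qt.
Qed.

(** For unshifted nodes the system is the identity.  A combination of bubbles
    varies by at most a constant times s times the size of its coefficients
    between a node and the shifted node, so the kernel is zero for small s. *)
Lemma shifted_interpolation (k : nat) : (0 < k)%N -> exists2 s0 : R, 0 < s0 &
  forall (M : mesh R) (cM : conforming M) (i : 'I_(ntri M)) j (s : R) (sg : nat -> R), s <= s0 -> s <= 1 ->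
  (forall m, (0 < m < k)%N -> `|sg m| <= s) -> forall y : nat -> R, exists c : nat -> R,
   forall m, (0 < m < k)%N -> bubble_sum k i j c (node k i j m + sg m *: (node k i j m - vtx i j)) = y m.
Proof.
move=> k0; have [K K0 [c0 c00 [_ H2]]] := tri_poly_estimates R k0.
pose F : R := K * (2 * k%:R) ^+ k * k%:R.
have kpos : 0 < k%:R :> R by rewrite ltr0n.
have F0 : 0 < F by rewrite /F !mulr_gt0// exprn_gt0// mulr_gt0.
exists ((2 * F)^-1); first by rewrite invr_gt0 mulr_gt0.
move=> M cM i j s sg hs hs1 hsg y.
pose P m := node k i j m + sg m *: (node k i j m - vtx i j).
have key (c : nat -> R) : (forall m, (0 < m < k)%N -> bubble_sum k i j c (P m) = 0) -> forall m, (0 < m < k)%N -> c m = 0.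
  move=> hc.
  pose S := (2 * k%:R) ^+ k * \sum_(1 <= m < k) `|c m|.
  have hS x : tri i x -> `|bubble_sum k i j c x| <= S by exact: bubble_sum_bound.
  have sum0 : 0 <= \sum_(1 <= m < k) `|c m| by apply: sumr_ge0.
  have cm m : (0 < m < k)%N -> `|c m| <= K * S * s.
    move=> hm; move: (hm) => /andP[m0 mk].
    rewrite -(bubble_sum_node cM i j c hm) -[X in `|X|]subr0 -(hc m hm) /P node_ray nodeE.
    set tau := m%:R / k%:R : R.
    have tau0 : 0 <= tau by rewrite divr_ge0// ltW.
    have tau1 : tau <= 1 by rewrite ler_pdivrMr// mul1r ler_nat ltnW.
    have s1 := hsg m hm.
    have cb u : 0 <= u -> u <= 1 -> `|(1 + sg m) * u| <= 2.
      move=> u0 u1; rewrite normrM (ger0_norm u0) -[2]mulr1; apply: ler_pM => //.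
      by rewrite (le_trans (ler_normD _ _))// normr1 (_ : 2 = 1 + 1)// lerD2l (le_trans s1).
    have t10 : 0 <= 1 - tau by rewrite subr_ge0.
    have t11 : 1 - tau <= 1 by rewrite lerBlDl lerDr.
    have a1 : `|1 - tau| <= 2 by rewrite (ger0_norm t10); lra.
    have a2 : `|tau| <= 2 by rewrite (ger0_norm tau0); lra.
    apply: (le_trans (H2 M cM i j _ S (poly_le_bubble_sum _ _ _ _) hS _ _ _ _ a1 a2 (cb _ t10 t11) (cb _ tau0 tau1))).
    have -> : 1 - tau - (1 + sg m) * (1 - tau) = - (sg m * (1 - tau)) by ring.
    have -> : tau - (1 + sg m) * tau = - (sg m * tau) by ring.
    rewrite !normrN (normrM (sg m) (1 - tau)) (normrM (sg m) tau) (ger0_norm t10) (ger0_norm tau0) -mulrDr subrK mulr1.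
    by apply: ler_wpM2l => //; rewrite mulr_ge0 ?(ltW K0)// mulr_ge0// exprn_ge0// mulr_ge0.
  have : \sum_(1 <= m < k) `|c m| <= 2^-1 * \sum_(1 <= m < k) `|c m|.
    apply: (@le_trans _ _ (\sum_(1 <= m < k) K * S * s)).
      by rewrite big_nat [leRHS]big_nat; apply: ler_sum => m hm; exact: cm.
    rewrite sumr_const_nat -[_ *+ _]mulr_natl.
    have KS : 0 <= K * S by rewrite mulr_ge0 ?(ltW K0)// mulr_ge0// exprn_ge0// mulr_ge0.
    apply: (@le_trans _ _ (k%:R * (K * S * (2 * F)^-1))).
      apply: (@le_trans _ _ ((k - 1)%:R * (K * S * (2 * F)^-1))).
        by apply: ler_wpM2l => //; apply: ler_wpM2l.
      apply: ler_wpM2r; last by rewrite ler_nat leq_subr.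
      by rewrite mulr_ge0// invr_ge0 mulr_ge0// ltW.
    rewrite le_eqVlt; apply/orP; left; apply/eqP; rewrite /S /F; field.
    by rewrite !gt_eqF// ?exprn_gt0// mulr_gt0.
  move=> le; have sz : \sum_(1 <= m < k) `|c m| = 0.
    by apply/eqP; rewrite eq_le sum0 andbT; move: le; set q := \sum_(_ <= _ < _) _; lra.
  move=> m hm; apply/eqP; rewrite -normr_le0.
  by apply: (le_trans (cm m hm)); rewrite /S sz mulr0 mulr0 mul0r.
(* Row and column a stand for the node a + 1, since 0 < m < k. *)
pose A := \matrix_(a < k.-1, b < k.-1) bubble k i j a.+1 (P b.+1).
have rng (a : 'I_k.-1) : (0 < a.+1 < k)%N by rewrite /= -ltn_predRL.
have bE (c : nat -> R) x : bubble_sum k i j c x = \sum_(a < k.-1) c a.+1 * bubble k i j a.+1 x.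
  by rewrite /bubble_sum big_add1 big_mkord.
have Au : A \in unitmx.
  rewrite -row_free_unit -kermx_eq0; apply/eqP/row_matrixP => r; rewrite row0.
  have := mulmx_ker A => /row_matrixP/(_ r); rewrite row_mul row0; set v := row r _ => vA; clearbody v.
  pose c m := if insub m.-1 is Some a then v 0 (a : 'I_k.-1) else 0.
  have cE (a : 'I_k.-1) : c a.+1 = v 0 a by rewrite /c /= valK.
  apply/rowP => a; rewrite [RHS]mxE -cE; apply: key (rng a) => m hm.
  have ml : (m.-1 < k.-1)%N by move: hm => /andP[h1 h2]; rewrite ltn_predRL prednK.
  have mE : m = (Ordinal ml).+1 :> nat by rewrite /= prednK//; case/andP: hm.
  rewrite bE [in P m]mE; have := congr1 (fun u : 'rV_k.-1 => u 0 (Ordinal ml)) vA; rewrite !mxE => vA0; rewrite -[RHS]vA0.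
  by apply: eq_bigr => b _; rewrite cE mxE.
pose v := (\row_(b < k.-1) y b.+1) *m invmx A.
have vA : v *m A = \row_(b < k.-1) y b.+1 by rewrite /v mulmxKV.
clearbody v.
pose c m := if insub m.-1 is Some a then v 0 (a : 'I_k.-1) else 0.
have cE (a : 'I_k.-1) : c a.+1 = v 0 a by rewrite /c /= valK.
exists c => m hm.
have ml : (m.-1 < k.-1)%N by move: hm => /andP[h1 h2]; rewrite ltn_predRL prednK.
have mE : m = (Ordinal ml).+1 :> nat by rewrite /= prednK//; case/andP: hm.
rewrite -/(P m) bE [in P m]mE [in RHS]mE.
have := congr1 (fun u : 'rV_k.-1 => u 0 (Ordinal ml)) vA; rewrite !mxE => vA0; rewrite -[RHS]vA0.
by apply: eq_bigr => b _; rewrite cE mxE.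
Qed.
End Nodes.

(** * Trial functions, test functions and the map between them *)
Section Spaces.
Variable R : realType.
Local Notation rT := (measurableTypeR R).
Local Notation area := (@area R).
Implicit Types (x y z : R * R) (f g v w u : R * R -> R).
Variable M : mesh R.
Hypothesis cM : conforming M.
Local Notation nd := (conf_nd cM).
Variables (k : nat) (Omega : set (R * R)).
Hypothesis uniqSh : forall (i : 'I_(ntri M)) j j', in_Sh i j -> in_Sh i j' -> j = j'.

Lemma within_continuous_pwp (A : set (R * R)) w : A `<=` Umesh M -> pwp M k w -> {within A, continuous w}.
Proof.
move=> AU hw; pose q i := s2val (cid2 (hw i)).
apply: (@closed_cover_continuous _ _ _ (fun i : 'I_(ntri M) => tri i) q) => [i|i|i|x /AU//].
- exact: (closed_tri nd).
- exact: (poly_le_continuous (s2valP (cid2 (hw i)))).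
- exact: (s2valP' (cid2 (hw i))).
Qed.

(** This makes poly_expr independent of the choice of the polynomial. *)
Lemma tri_poly_unique (i : 'I_(ntri M)) q q' : poly_le k q -> poly_le k q' ->
  (forall x, tri i x -> q x = q' x) -> forall y, q y = q' y.
Proof.
move=> hq hq' e y; apply/eqP; rewrite -subr_eq0; apply/eqP.
have tin : exists x, interior (tri i) x by case: cM => + _; exact.
have [x /nbhs_prodP[ep ep0 hx]] := tin.
have hd : poly_le k (fun x => q x - q' x).
  by apply: poly_le_ext (poly_leD hq (poly_leZ (-1) hq')) => z; rewrite mulN1r.
apply: (poly_le0_everywhere hd ep0 (x := x)) => z h1 h2.
by rewrite e ?subrr//; exact: hx.
Qed.

Lemma poly_exprP (i : 'I_(ntri M)) w : pwp M k w ->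
  poly_le k (poly_expr k w i) /\ forall x, tri i x -> w x = poly_expr k w i x.
Proof.
move=> hw; have [q hq e] := hw i.
by have := @getPex _ [set q | poly_le k q /\ (forall x, tri i x -> w x = q x)] (ex_intro _ q (conj hq e)).
Qed.

Lemma poly_expr_eq (i : 'I_(ntri M)) w q : poly_le k q -> (forall x, tri i x -> w x = q x) ->
  forall y, poly_expr k w i y = q y.
Proof.
move=> hq e.
have [h1 h2] : [set q | poly_le k q /\ (forall x, tri i x -> w x = q x)] (poly_expr k w i).
  by apply: getPex; exists q.
by apply: (tri_poly_unique (i := i) h1 hq) => x tx; by rewrite -(e _ tx) (h2 _ tx).
Qed.

(** Membership in Wh without its continuity clause, which follows from the values
    on the closed triangles (within_continuous_pwp). *)
Definition trial w := [/\ pwp M k w, (forall (i : 'I_(ntri M)) j, Gammah M (vtx i j) -> w (vtx i j) = 0) &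
  forall (i : 'I_(ntri M)) j (m : nat) P, in_Sh i j -> (0 < m < k)%N ->
    nearest_on (bdry Omega) (line (vtx i j) (node k i j m)) (node k i j m) P -> poly_expr k w i P = 0].

(** As for trial: Vh without continuity. *)
Definition test v := [/\ pwp M k v, (forall x, Gammah M x -> v x = 0) &
  forall x, (Omega `\` Omegah M) x -> v x = 0].

Lemma WhE w : Wh k Omega M w <-> trial w.
Proof.
split=> [[h1 _ h3 h4]|[h1 h3 h4]]; first by split.
split => //; apply: within_continuous_pwp => //; exact: interior_subset.
Qed.

Lemma VhE v : Vh k Omega M v <-> test v.
Proof.
split=> [[_ h1 h2 h3]|[h1 h2 h3]]; first by split.
by split => //; apply: within_continuous_pwp => //; rewrite (closure_Omegah nd).
Qed.

Lemma trialD w u : trial w -> trial u -> trial (fun x => w x + u x).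
Proof.
move=> [h1 h2 h3] [g1 g2 g3]; split; first exact: pwpD.
  by move=> i j G; rewrite h2// g2// addr0.
move=> i j m P Sh hm nP; have [p1 e1] := poly_exprP i h1; have [p2 e2] := poly_exprP i g1.
rewrite (poly_expr_eq (poly_leD p1 p2)); first by rewrite (h3 i j m)// (g3 i j m)// addr0.
by move=> x tx; rewrite e1// e2.
Qed.

Lemma trialZ (a : R) w : trial w -> trial (fun x => a * w x).
Proof.
move=> [h1 h2 h3]; split; first exact: pwpZ.
  by move=> i j G; rewrite h2// mulr0.
move=> i j m P Sh hm nP; have [p1 e1] := poly_exprP i h1.
rewrite (poly_expr_eq (poly_leZ a p1)); first by rewrite (h3 i j m)// mulr0.
by move=> x tx; rewrite e1.
Qed.

Lemma testD w u : test w -> test u -> test (fun x => w x + u x).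
Proof.
move=> [h1 h2 h3] [g1 g2 g3]; split; first exact: pwpD.
  by move=> x G; rewrite h2// g2// addr0.
by move=> x G; rewrite h3// g3// addr0.
Qed.

Lemma testZ (a : R) w : test w -> test (fun x => a * w x).
Proof.
move=> [h1 h2 h3]; split; first exact: pwpZ.
  by move=> x G; rewrite h2// mulr0.
by move=> x G; rewrite h3// mulr0.
Qed.

(** Each triangle contributes its bubbles on its closed set of points only.  A
    point of a boundary triangle may lie in other triangles, where the bubbles
    vanish, so the sum has at most one nonzero term. *)
Definition edge_corr (c : 'I_(ntri M) -> 'I_3 -> nat -> R) x : R :=
  \sum_i \sum_j (if `[< in_Sh i j /\ tri i x >] then bubble_sum k i j (c i j) x else 0).

Lemma edge_corr_other c (i i' : 'I_(ntri M)) j' x : tri i x -> i' != i ->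
  (if `[< in_Sh i' j' /\ tri i' x >] then bubble_sum k i' j' (c i' j') x else 0) = 0.
Proof.
move=> tx ii'; case: ifPn => // /asboolP[Sh tx'].
by apply: bubble_sum_zero; exact: (boundary_edge_isolated cM Sh ii' tx' tx).
Qed.

Lemma edge_corr_Sh c (i : 'I_(ntri M)) j x : in_Sh i j -> tri i x -> edge_corr c x = bubble_sum k i j (c i j) x.
Proof.
move=> Sh tx; rewrite /edge_corr (bigD1 i)//= [X in _ + X]big1 ?addr0; last first.
  by move=> i' ii'; rewrite big1// => j' _; exact: edge_corr_other tx ii'.
rewrite (bigD1 j)//= [X in _ + X]big1 ?addr0; last first.
  move=> j' jj'; case: ifPn => // /asboolP[Sh' _].
  by move: jj'; rewrite (uniqSh Sh' Sh) eqxx.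
by rewrite ifT//; apply/asboolP.
Qed.

Lemma edge_corr_nSh c (i : 'I_(ntri M)) x : (forall j, ~ in_Sh i j) -> tri i x -> edge_corr c x = 0.
Proof.
move=> nSh tx; rewrite /edge_corr (bigD1 i)//= [X in _ + X]big1 ?addr0; last first.
  by move=> i' ii'; rewrite big1// => j' _; exact: edge_corr_other tx ii'.
by rewrite big1// => j _; case: ifPn => // /asboolP[/nSh].
Qed.

Lemma Sh_dec (i : 'I_(ntri M)) : (exists j, in_Sh i j) \/ (forall j, ~ in_Sh i j).
Proof.
have [h|h] := pselect (exists j, in_Sh i j); first by left.
by right => j Sh; apply: h; exists j.
Qed.

Lemma pwp_edge_corr c : pwp M k (edge_corr c).
Proof.
move=> i; have [[j Sh]|nSh] := Sh_dec i.
  by exists (bubble_sum k i j (c i j)); [exact: poly_le_bubble_sum|move=> x tx; exact: edge_corr_Sh].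
by exists (fun=> 0); [exact: poly_le_cst|move=> x tx; exact: edge_corr_nSh].
Qed.

Lemma edge_node (i : 'I_(ntri M)) j m : (m <= k)%N -> (0 < k)%N -> edge i j (node k i j m).
Proof.
move=> mk k0; exists (m%:R / k%:R) => //=; rewrite in_itv/=.
by rewrite divr_ge0//= ler_pdivrMr ?ltr0n// mul1r ler_nat.
Qed.

Lemma tri_node (i : 'I_(ntri M)) j m : (m <= k)%N -> (0 < k)%N -> tri i (node k i j m).
Proof. by move=> mk k0; have /(edgeP (nd i))[] := edge_node i j mk k0. Qed.

Lemma node0 (i : 'I_(ntri M)) j : node k i j 0 = endA i j.
Proof. by rewrite /node /pt_on mul0r scale0r addr0. Qed.

Lemma nodek (i : 'I_(ntri M)) j : (0 < k)%N -> node k i j k = endB i j.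
Proof.
by move=> k0; rewrite /node /pt_on divff ?pnatr_eq0 -?lt0n// scale1r addrC subrK.
Qed.

(** A point of the boundary of the polygon is a vertex or lies inside an edge,
    which is then a boundary edge; there k + 1 zeros suffice. *)
Lemma Gammah_zero v : (0 < k)%N -> pwp M k v ->
  (forall (i : 'I_(ntri M)) j, Gammah M (vtx i j) -> v (vtx i j) = 0) ->
  (forall (i : 'I_(ntri M)) j m, in_Sh i j -> (0 < m < k)%N -> v (node k i j m) = 0) ->
  forall x, Gammah M x -> v x = 0.
Proof.
move=> k0 hv v1 v2 x Gx; have [[i tx] nO] := (GammahP nd x).1 Gx.
have /(triP (nd i)) hx := tx.
have [[j lj]|no] := pselect (exists j, lam i j x = 0); last first.
  case: nO; apply: (otri_Omegah nd (i := i)) => j; rewrite lt_neqAle hx andbT.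
  by apply/eqP => e; apply: no; exists j.
have ex : edge i j x by apply/(edgeP (nd i)).
have s1 : lam i (ordS j) x + lam i (ord_pred j) x = 1.
  by have := lam_sum (nd i) x; rewrite (sum3E _ j) lj add0r.
have vert (l : 'I_3) : lam i l x = 1 -> (forall l', l' != l -> lam i l' x = 0) -> v x = 0.
  move=> l1 l0; have e : x = vtx i l.
    apply: (lam_inj nd (i := i)) => l'; rewrite (lam_vtx (nd i)).
    by have [->|/l0] := eqVneq l' l.
  by rewrite e; apply: v1; rewrite -e.
have [pA|] := ltP 0 (lam i (ordS j) x); last first.
  move=> h; have A0 : lam i (ordS j) x = 0 by apply/eqP; rewrite eq_le h hx.
  apply: (vert (ord_pred j)); first by rewrite -s1 A0 add0r.
  by move=> l'; case: (ord3P j l') => -> //; rewrite eqxx.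
have [pB|] := ltP 0 (lam i (ord_pred j) x); last first.
  move=> h; have B0 : lam i (ord_pred j) x = 0 by apply/eqP; rewrite eq_le h hx.
  apply: (vert (ordS j)); first by rewrite -s1 B0 addr0.
  by move=> l'; case: (ord3P j l') => -> //; rewrite eqxx.
have Sh := boundary_relint_Sh cM Gx ex pA pB.
have [q hq e] := hv i.
have [s _ xE] := ex; rewrite (e _ tx) -xE.
apply: (edge_poly_zero k0 hq) => m mk; rewrite -e; last exact: tri_node.
have endG l : edge i j (vtx i l) -> v (vtx i l) = 0 by move=> h; apply: v1; exact: Sh.
have [->|m0] := posnP m.
  by rewrite node0; apply: endG; rewrite -[vtx i (ordS j)]/(endA i j) -node0; exact: edge_node.
move: mk; rewrite leq_eqVlt => /predU1P[->|mk]; last by apply: v2 => //; rewrite m0.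
by rewrite nodek//; apply: endG; rewrite -[vtx i (ord_pred j)]/(endB i j) -nodek//; exact: edge_node.
Qed.

(** The test function attached to w: bubbles remove the values of w at the nodes
    of the boundary edges.  The value 0 outside the polygon is required by Vh. *)
Definition to_test w x : R := if `[< Umesh M x >] then w x - edge_corr (fun i j m => w (node k i j m)) x else 0.

Lemma to_testE w x : Umesh M x -> to_test w x = w x - edge_corr (fun i j m => w (node k i j m)) x.
Proof. by move=> Ux; rewrite /to_test ifT//; apply/asboolP. Qed.

Lemma Omegah_U x : Omegah M x -> Umesh M x. Proof. exact: interior_subset. Qed.

Lemma pwp_ext w u : (forall x, Umesh M x -> w x = u x) -> pwp M k w -> pwp M k u.
Proof.
move=> e h i; have [q hq eq] := h i; exists q => // x tx.
by rewrite -e ?eq//; exists i.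
Qed.

Lemma pwp_to_test w : pwp M k w -> pwp M k (to_test w).
Proof.
move=> hw; apply: pwp_ext (pwpB hw (pwp_edge_corr (fun i j m => w (node k i j m)))) => x Ux.
by rewrite to_testE.
Qed.

Lemma test_to_test w : (0 < k)%N -> trial w -> test (to_test w).
Proof.
move=> k0 [h1 h2 h3].
have G0 : forall x, Gammah M x -> to_test w x = 0.
  apply: Gammah_zero => //; first exact: pwp_to_test.
    move=> i j Gv; rewrite to_testE; last by exists i; exact: (tri_vtx (nd i)).
    have tv := tri_vtx (nd i) j.
    rewrite h2// sub0r; have [[l Sh]|nSh] := Sh_dec i; last by rewrite (edge_corr_nSh _ nSh tv) oppr0.
    rewrite (edge_corr_Sh _ Sh tv) bubble_sum_zero ?oppr0// !(lam_vtx (nd i)).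
    have [<-|_] := eqVneq (ordS l) j; last by left.
    by right; rewrite -ordSS eq_sym neq_ordS.
  move=> i j m Sh hm; have mk : (m <= k)%N by case/andP: hm => _ /ltnW.
  have tn := tri_node i j mk k0.
  by rewrite to_testE; [rewrite (edge_corr_Sh _ Sh tn) (bubble_sum_node cM)// subrr|exists i].
split => //; first exact: pwp_to_test.
move=> x [_ nO]; have [Ux|nU] := pselect (Umesh M x).
  by apply: G0; apply/(GammahP nd).
by rewrite /to_test ifF//; apply/negP => /asboolP.
Qed.
End Spaces.

(** * Estimates for the boundary correction on a mesh *)
Section TriArea.
Variable R : realType.
Local Notation rT := (measurableTypeR R).
Local Notation area := (@area R).
Local Notation mu := (@lebesgue_measure R).
Implicit Types (x y z : R * R) (f g v w u : R * R -> R).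
Variable M : mesh R.
Hypothesis cM : conforming M.
Local Notation nd := (conf_nd cM).

Lemma tri_area_gt0 (i : 'I_(ntri M)) : 0 < tri_area i.
Proof.
have [x ox] : exists x, otri i x.
  exists (tri_pt i ord0 3^-1 3^-1) => j.
  have [e1 e2 e3] := lam_of_rep (nd i) ord0 3^-1 3^-1.
  by case: (ord3P ord0 j) => ->; rewrite /tri_pt ?e1 ?e2 ?e3//; lra.
have /nbhs_prodP[e e0 h] : nbhs x (otri i) by apply: open_nbhs_nbhs; split => //; exact: open_otri.
pose B : set (rT * rT) := `[x.1, x.1 + e / 2] `*` `[x.2, x.2 + e / 2].
have mB : measurable B by apply: measurableX; exact: measurable_itv.
have BO : B `<=` (otri i : set (rT * rT)).
  move=> y [] /=; rewrite !in_itv/= => /andP[a1 a2] /andP[a3 a4].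
  by apply: h; rewrite ltr_norml; apply/andP; split; lra.
have : (area B <= area (otri i : set (rT * rT)))%E.
  by apply: le_measure; rewrite ?inE //; exact: measurable_otri.
rewrite /area [X in (X <= _)%E -> _]product_measure1E; [|exact: measurable_itv..].
have L (c : R) : (mu `[c, (c + e / 2)%R] = (e / 2)%:E)%E.
  by rewrite lebesgue_measure_itv/= lte_fin ltrDl divr_gt0// -EFinD; congr EFin; lra.
rewrite [X in (X * _)%E](L x.1) [X in (_ * X)%E](L x.2) -EFinM => le.
have p : 0 < e / 2 * (e / 2) by rewrite mulr_gt0// divr_gt0.
apply: (lt_le_trans p); rewrite /tri_area.
by rewrite -lee_fin fineK// ge0_fin_numE//; exact: area_otri_fin.
Qed.
End TriArea.

Section Energy.
Variable R : realType.
Local Notation rT := (measurableTypeR R).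
Local Notation area := (@area R).
Implicit Types (x y z : R * R) (f g v w u : R * R -> R).
Variable M : mesh R.
Hypothesis cM : conforming M.
Local Notation nd := (conf_nd cM).
Local Notation int_cells := (int_cells M).
Variables (k : nat) (Omega : set (R * R)).
Hypothesis k0 : (0 < k)%N.
Hypothesis uniqSh : forall (i : 'I_(ntri M)) j j', in_Sh i j -> in_Sh i j' -> j = j'.

Lemma tri_energy_ext (i : 'I_(ntri M)) w u : (forall x, tri i x -> w x = u x) -> tri_energy i w = tri_energy i u.
Proof.
move=> e; apply: eq_Rintegral => x /set_mem ox.
have E z : 'D_z w x = 'D_z u x.
  apply: near_eq_derive; apply: (otri_near cM ox) => y; exact: e.
by rewrite /dx /dy !E.
Qed.

Lemma tri_energy_ge0 (i : 'I_(ntri M)) w : 0 <= tri_energy i w.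
Proof. by apply: Rintegral_ge0 => x _; rewrite addr_ge0 ?sqr_ge0. Qed.

Lemma tri_energy0 (i : 'I_(ntri M)) : tri_energy i (fun=> 0) = 0.
Proof.
have mi := measurable_otri (M := M) i.
rewrite /tri_energy -[RHS](mul0r (fine (area (otri i : set (rT * rT))))) -(Rintegral_cst _ mi).
apply: eq_Rintegral => x _; rewrite /dx /dy.
have E z : 'D_z (fun=> 0 : R) x = 0 by have [_ ->] := is_derive_cst (0 : R) x z.
by rewrite !E expr0n addr0.
Qed.

Lemma bmeas_grad2 w : pwp M k w -> bmeas M (fun x => dx w x ^+ 2 + dy w x ^+ 2).
Proof. by move=> hw; exact: (bmeasD (bmeasX (bmeas_dx cM hw)) (bmeasX (bmeas_dy cM hw))). Qed.

Lemma grad_norm_sum w : pwp M k w -> grad_norm M w ^+ 2 = \sum_(i : 'I_(ntri M)) tri_energy i w.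
Proof. by move=> hw; rewrite (grad_norm_sqr cM) (int_cells_sum cM (bmeas_grad2 hw)). Qed.

Lemma grad_norm_eq0 w : pwp M k w -> grad_norm M w = 0 -> forall i : 'I_(ntri M), tri_energy i w = 0.
Proof.
move=> hw g0 i; have := grad_norm_sum hw; rewrite g0 expr0n => /esym/eqP.
rewrite psumr_eq0; last by move=> j _; exact: tri_energy_ge0.
by move=> /allP/(_ i); rewrite mem_index_enum => /(_ isT)/eqP.
Qed.

Lemma grad_norm_ext w u : pwp M k w -> pwp M k u -> (forall x, Umesh M x -> w x = u x) -> grad_norm M w = grad_norm M u.
Proof.
move=> hw hu e.
have E : grad_norm M w ^+ 2 = grad_norm M u ^+ 2.
  apply: (etrans (grad_norm_sum hw)); apply: esym; apply: (etrans (grad_norm_sum hu)).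
  by apply: eq_bigr => i _; apply: tri_energy_ext => x tx; apply: esym; apply: e; exists i.
have g1 := grad_norm_ge0 M w; have g2 := grad_norm_ge0 M u.
move: E g1 g2; move: (grad_norm M w) (grad_norm M u) => a b E a0 b0.
by apply/eqP; rewrite -(@eqrXn2 _ 2)// E.
Qed.

(** On each triangle the integral of v^2 bounds the maximum of v. *)
Lemma int_cells_eq0 v : pwp M k v -> int_cells (fun x => v x ^+ 2) = 0 -> forall x, Umesh M x -> v x = 0.
Proof.
move=> hv v0 x [i tx].
have [K K0 [c c0 [H _]]] := tri_poly_estimates R k0.
have [q hq e] := hv i.
have [x0 [tx0 B I]] := H M cM i ord0 q hq.
have : \sum_(i : 'I_(ntri M)) \int[area]_(x in (otri i : set (rT * rT))) (v x ^+ 2) = 0.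
  by rewrite -(int_cells_sum cM (bmeasX (bmeas_pwp cM hv))).
move/eqP; rewrite psumr_eq0; last by move=> j _; apply: Rintegral_ge0 => y _; exact: sqr_ge0.
move=> /allP/(_ i); rewrite mem_index_enum => /(_ isT)/eqP.
have -> : \int[area]_(x in (otri i : set (rT * rT))) (v x ^+ 2) = \int[area]_(x in (otri i : set (rT * rT))) (q x ^+ 2).
  by apply: eq_Rintegral => y /set_mem/(otri_tri nd)/e ->.
move=> I0; rewrite I0 in I.
have q0 : `|q x0| = 0.
  have c1 : 0 < c * tri_area i by rewrite mulr_gt0// tri_area_gt0.
  have : c * tri_area i * `|q x0| ^+ 2 <= 0 by rewrite mulrAC.
  by rewrite pmulr_rle0// => h; apply/eqP; rewrite -sqrf_eq0 eq_le h sqr_ge0.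
have [a [b [a0 b0 ab ->]]] := tri_coords cM ord0 tx.
have tr : tri i (tri_pt i ord0 a b) by apply: tri_pt_in.
rewrite e//; apply/eqP; rewrite -normr_le0; have := B a b; rewrite q0 mulr0.
by apply; rewrite ger0_norm//; lra.
Qed.

Variables (sig s : R).
Hypothesis sig0 : 0 <= sig.
Hypothesis s01 : 0 <= s <= 1.
Hypothesis shape : shape_ok sig M.
Hypothesis shifts : forall (i : 'I_(ntri M)) j m, in_Sh i j -> (0 < m < k)%N -> exists sg, node_shift k Omega s i j m sg.

Lemma shift_fun (i : 'I_(ntri M)) j : in_Sh i j -> exists sg : nat -> R, forall m, (0 < m < k)%N -> node_shift k Omega s i j m (sg m).
Proof.
move=> Sh; have /choice[sg h] : forall m, exists t : R, (0 < m < k)%N -> node_shift k Omega s i j m t; last by exists sg.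
move=> m; have [hm|hm] := boolP (0 < m < k)%N; last by exists 0.
by have [t ht] := shifts Sh hm; exists t.
Qed.

Lemma trial_local w (i : 'I_(ntri M)) j : trial M k Omega w -> in_Sh i j ->
  exists2 q, (poly_le k q /\ forall x, tri i x -> w x = q x) & exists sg, local_data k sig s i j q sg.
Proof.
move=> [h1 h2 h3] Sh; have [hq e] := poly_exprP i h1; exists (poly_expr k w i) => //.
have [sg hsg] := shift_fun Sh; exists sg; split => // m hm; have [a1 a2] := hsg m hm; split => //.
by apply: (h3 i j m) => //; apply/a2.
Qed.

Lemma bubble_sum_ext i j c c' x : (forall m, (0 < m < k)%N -> c m = c' m) -> bubble_sum (M := M) k i j c x = bubble_sum k i j c' x.
Proof.
by move=> h; apply: eq_big_nat => m hm; rewrite h.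
Qed.

(** The energy is a sum over the triangles; only boundary triangles contribute
    to that of the correction. *)
Lemma to_test_energy C w : 0 <= C -> (forall (i : 'I_(ntri M)) (j : 'I_3) q sg,
  local_data k sig s i j q sg ->
  tri_energy i (bubble_sum k i j (fun m => q (node k i j m))) <= C * tri_energy i q) -> trial M k Omega w ->
  grad_norm M (fun x => w x - to_test M k w x) ^+ 2 <= C * grad_norm M w ^+ 2.
Proof.
move=> C0 H hw; have [h1 h2 h3] := hw.
have E1 := grad_norm_sum (pwpB h1 (pwp_to_test cM uniqSh h1)); have E2 := grad_norm_sum h1.
move: E1 E2; move: (grad_norm M w) (grad_norm M _) => g1 g2 -> ->.
rewrite mulr_sumr; apply: ler_sum => i _.
have -> : tri_energy i (fun x => w x - to_test M k w x) = tri_energy i (edge_corr (M:=M) k (fun i j m => w (node k i j m))).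
  by apply: tri_energy_ext => x tx; rewrite to_testE; [ring|exists i].
have [[j Sh]|nSh] := Sh_dec i; last first.
  have -> : tri_energy i (edge_corr (M:=M) k (fun i j m => w (node k i j m))) = 0.
    by rewrite -(tri_energy0 i); apply: tri_energy_ext => x tx; rewrite (edge_corr_nSh cM _ _ nSh tx).
  exact: (mulr_ge0 C0 (tri_energy_ge0 i w)).
have [q [hq e] [sg ld]] := trial_local hw Sh.
have -> : tri_energy i (edge_corr (M:=M) k (fun i j m => w (node k i j m))) = tri_energy i (bubble_sum k i j (fun m => q (node k i j m))).
  apply: tri_energy_ext => x tx; rewrite (edge_corr_Sh cM k uniqSh _ Sh tx); apply: bubble_sum_ext => m hm; apply: e.
  by apply: tri_node => //; case/andP: hm => _ /ltnW.
by rewrite (tri_energy_ext e); exact: H ld.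
Qed.

(** If the gradient is zero, the nodal values are zero by the second part of
    local_estimate, so w coincides with the test function to_test w, to which
    Poincare's inequality applies. *)
Lemma trial_definite (D : R) w : (forall (i : 'I_(ntri M)) (j : 'I_3) q sg,
  local_data k sig s i j q sg -> tri_energy i q = 0 -> 0 < tri_area i -> forall m, (0 < m < k)%N -> q (node k i j m) = 0) ->
  (forall x, cells M x -> `|x.1| <= D) ->
  trial M k Omega w -> grad_norm M w = 0 -> forall x, Umesh M x -> w x = 0.
Proof.
move=> H hD hw g0; have [h1 h2 h3] := hw.
have E0 := grad_norm_eq0 h1 g0.
have wp x : Umesh M x -> to_test M k w x = w x.
  move=> Ux; rewrite to_testE//; case: (Ux) => i tx; have [[j Sh]|nSh] := Sh_dec i; last first.
    by rewrite (edge_corr_nSh cM _ _ nSh tx) subr0.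
  rewrite (edge_corr_Sh cM k uniqSh _ Sh tx) (@bubble_sum_ext i j _ (fun=> 0) x) /bubble_sum.
    by rewrite big1 ?subr0// => m _; rewrite mul0r.
  move=> m hm; have [q [hq e] [sg ld]] := trial_local hw Sh.
  rewrite e; last by apply: tri_node => //; case/andP: hm => _ /ltnW.
  by apply: (H _ _ _ _ ld) => //; [rewrite -(tri_energy_ext e)|exact: tri_area_gt0].
have [v1 v2 v3] := test_to_test cM uniqSh k0 hw.
have gv : grad_norm M (to_test M k w) = 0 by rewrite (grad_norm_ext v1 h1 wp).
have P := poincare cM v1 v2 hD.
move: P; rewrite -(grad_norm_sqr cM) gv expr0n mulr0 => P.
have I0 : int_cells (fun x => to_test M k w x ^+ 2) = 0.
  by apply/eqP; rewrite eq_le P; apply: int_cells_ge0 => x _; exact: sqr_ge0.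
by move=> x Ux; rewrite -wp//; exact: (int_cells_eq0 v1 I0).
Qed.

(** Add to v the bubbles whose values at the points of Gamma cancel those of the
    polynomial expression of v.  As v is zero at the nodes, to_test removes
    exactly these bubbles. *)
Lemma to_test_surj v (s0 : R) : s <= s0 ->
  (forall (i : 'I_(ntri M)) j (sg : nat -> R),
  (forall m, (0 < m < k)%N -> `|sg m| <= s) -> forall y : nat -> R, exists c : nat -> R,
   forall m, (0 < m < k)%N -> bubble_sum k i j c (node k i j m + sg m *: (node k i j m - vtx i j)) = y m) ->
  test M k Omega v -> exists2 w, trial M k Omega w & forall x, Umesh M x -> to_test M k w x = v x.
Proof.
move=> ss H [v1 v2 v3].
have : forall p : 'I_(ntri M) * 'I_3, exists c : nat -> R, in_Sh p.1 p.2 -> forall m P, (0 < m < k)%N ->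
  nearest_on (bdry Omega) (line (vtx p.1 p.2) (node k p.1 p.2 m)) (node k p.1 p.2 m) P ->
  bubble_sum k p.1 p.2 c P = - poly_expr k v p.1 P.
  move=> [i j] /=; have [Sh|nSh] := pselect (in_Sh i j); last by exists (fun=> 0).
  have [sg hsg] := shift_fun Sh.
  have hs m : (0 < m < k)%N -> `|sg m| <= s by move=> /hsg[].
  have [c hc] := H i j sg hs (fun m => - poly_expr k v i (node k i j m + sg m *: (node k i j m - vtx i j))).
  exists c => _ m P hm; have [_ h] := hsg m hm; move=> /h ->; exact: hc.
move=> /choice[c hc].
pose c' i j := c (i, j).
pose w x := v x + edge_corr k c' x.
have vb (i : 'I_(ntri M)) j m : (m <= k)%N -> in_Sh i j -> v (node k i j m) = 0.
  by move=> mk Sh; apply: v2; apply: Sh; exact: edge_node.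
have hw : pwp M k w := pwpD v1 (pwp_edge_corr cM k uniqSh c').
have tw x i j : in_Sh i j -> tri i x -> w x = v x + bubble_sum k i j (c' i j) x.
  by move=> Sh tx; rewrite /w (edge_corr_Sh cM k uniqSh _ Sh tx).
exists w; first split => //.
- move=> i j Gv; have tv := tri_vtx (nd i) j.
  rewrite /w v2// add0r; have [[l Sh]|nSh] := Sh_dec i; last by rewrite (edge_corr_nSh cM _ _ nSh tv).
  rewrite (edge_corr_Sh cM k uniqSh _ Sh tv) bubble_sum_zero// !(lam_vtx (nd i)).
  have [<-|_] := eqVneq (ordS l) j; last by left.
  by right; rewrite -ordSS eq_sym neq_ordS.
- move=> i j m P Sh hm nP; have [p1 e1] := poly_exprP i v1.
  rewrite (poly_expr_eq cM (poly_leD p1 (poly_le_bubble_sum k i j (c' i j)))).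
    by rewrite (hc (i, j) Sh m P hm nP) subrr.
  by move=> x tx; rewrite (tw _ _ _ Sh tx) e1.
move=> x Ux; rewrite to_testE//; case: (Ux) => i tx; have [[j Sh]|nSh] := Sh_dec i; last first.
  by rewrite /w !(edge_corr_nSh cM _ _ nSh tx) subr0 addr0.
rewrite (edge_corr_Sh cM k uniqSh _ Sh tx) (tw _ _ _ Sh tx) (@bubble_sum_ext i j _ (c' i j) x) ?addrK// => m hm.
have mk : (m <= k)%N by case/andP: hm => _ /ltnW.
by rewrite (tw _ _ _ Sh (tri_node cM (k:=k) i j mk k0)) vb// add0r (bubble_sum_node cM).
Qed.
End Energy.

(** * Linear systems in finite-dimensional spaces of functions *)
Section Solver.
Variables (K : fieldType) (T : Type) (U : set T).
Implicit Types (v w : T -> K).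

(** Spaces of functions are handled as sets closed under linear combinations, and
    functions are identified when they agree on U. *)
Definition lincl (S : set (T -> K)) := S (fun=> 0) /\
  forall a v w, S v -> S w -> S (fun x => a * v x + w x).

Lemma lincl_sum S n (c : 'I_n -> K) (vv : 'I_n -> T -> K) : lincl S -> (forall i, S (vv i)) ->
  S (fun x => \sum_(i < n) c i * vv i x).
Proof.
move=> [S0 SD]; elim: n c vv => [|n IH] c vv hv.
  by rewrite (_ : (fun x => _) = fun=> 0)//; apply/funext => x; rewrite big_ord0.
rewrite (_ : (fun x => _) = fun x => c ord0 * vv ord0 x + \sum_(i < n) c (lift ord0 i) * vv (lift ord0 i) x).
  by apply: SD => //; exact: IH.
by apply/funext => x; rewrite big_ord_recl.
Qed.

Lemma linear_sum S (L : (T -> K) -> K) n (c : 'I_n -> K) (vv : 'I_n -> T -> K) : lincl S ->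
  (forall a v w, S v -> S w -> L (fun x => a * v x + w x) = a * L v + L w) -> (forall i, S (vv i)) ->
  L (fun x => \sum_(i < n) c i * vv i x) = \sum_(i < n) c i * L (vv i).
Proof.
move=> lS lL; have [S0 SD] := lS; elim: n c vv => [|n IH] c vv hv.
  rewrite big_ord0 (_ : (fun x => _) = fun=> 0); last by apply/funext => x; rewrite big_ord0.
  have e := lL (-1) _ _ S0 S0; rewrite [in RHS]mulN1r addNr in e; apply: etrans e; congr (L _).
  by apply/funext => x; rewrite mulr0 addr0.
rewrite (_ : (fun x => _) = fun x => c ord0 * vv ord0 x + \sum_(i < n) c (lift ord0 i) * vv (lift ord0 i) x).
  by rewrite lL ?IH ?big_ord_recl//; apply: lincl_sum.
by apply/funext => x; rewrite big_ord_recl.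
Qed.

Definition lin_indep (n : nat) (vv : 'I_n -> T -> K) :=
  forall c : 'I_n -> K, (forall x, U x -> \sum_(i < n) c i * vv i x = 0) -> forall i, c i = 0.

(** A linearly independent family of maximal length spans S up to equality on U. *)
Lemma max_family (S : set (T -> K)) N :
  (forall n, (N < n)%N -> forall vv : 'I_n -> T -> K, (forall i, S (vv i)) -> ~ lin_indep vv) ->
  exists n (vv : 'I_n -> T -> K), [/\ forall i, S (vv i), lin_indep vv &
    forall v, S v -> exists c : 'I_n -> K, forall x, U x -> v x = \sum_(i < n) c i * vv i x].
Proof.
move=> hN.
pose P n := `[< exists vv : 'I_n -> T -> K, (forall i, S (vv i)) /\ lin_indep vv >].
have exP : exists n, P n.
  exists 0%N; apply/asboolP; exists (fun _ _ => 0); split; [by case|by move=> c _; case].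
have leP n : P n -> (n <= N)%N.
  by move=> /asboolP[vv [h1 h2]]; rewrite leqNgt; apply/negP => /hN/(_ vv h1).
case: (ex_maxnP exP leP) => n /asboolP[vv [h1 h2]] hmax.
exists n, vv; split => // v Sv.
pose ww (i : 'I_n.+1) : T -> K := if unlift ord_max i is Some i' then vv i' else v.
have wS i : S (ww i) by rewrite /ww; case: unliftP.
have : ~ lin_indep ww.
  move=> h; have : (n.+1 <= n)%N by apply: hmax; apply/asboolP; exists ww.
  by rewrite ltnn.
move=> /existsNP[c /not_implyP[hc /existsNP[i0 ci0]]].
have sumE x : \sum_(i < n.+1) c i * ww i x = \sum_(i < n) c (lift ord_max i) * vv i x + c ord_max * v x.
  rewrite big_ord_recr /= /ww unlift_none; congr (_ + _); apply: eq_bigr => i _.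
  have -> : widen_ord (leqnSn n) i = lift ord_max i by apply: val_inj; rewrite /= /bump leqNgt ltn_ord.
  by rewrite liftK.
have cm : c ord_max != 0.
  apply/eqP => c0; apply: ci0; have h i : c (lift ord_max i) = 0.
    apply: (h2 (fun i => c (lift ord_max i))) => x Ux.
    by have := hc x Ux; rewrite sumE c0 mul0r addr0.
  by case: (unliftP ord_max i0) => [j ->|->].
exists (fun i => - c (lift ord_max i) / c ord_max) => x Ux.
have := hc x Ux; rewrite sumE => /eqP; rewrite addrC addr_eq0 => /eqP e.
rewrite -[LHS](mulKf cm) e mulrN mulr_sumr -sumrN; apply: eq_bigr => i _.
by rewrite mulrA -mulNr; congr (_ * _); rewrite mulrC mulNr.
Qed.

(** A basis of SV modulo equality on U is lifted through P to SW.  The matrix of B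
    between the lifted family and the basis is square and has a zero kernel. *)
Lemma solve_abstract (SV SW : set (T -> K)) (P : (T -> K) -> T -> K) (B : (T -> K) -> (T -> K) -> K) (F : (T -> K) -> K) N :
  lincl SV -> lincl SW ->
  (forall n, (N < n)%N -> forall vv : 'I_n -> T -> K, (forall i, SV (vv i)) -> ~ lin_indep vv) ->
  (forall a w w' v, SW w -> SW w' -> SV v -> B (fun x => a * w x + w' x) v = a * B w v + B w' v) ->
  (forall a w v v', SW w -> SV v -> SV v' -> B w (fun x => a * v x + v' x) = a * B w v + B w v') ->
  (forall w v v', SW w -> SV v -> SV v' -> (forall x, U x -> v x = v' x) -> B w v = B w v') ->
  (forall a v v', SV v -> SV v' -> F (fun x => a * v x + v' x) = a * F v + F v') ->
  (forall v v', SV v -> SV v' -> (forall x, U x -> v x = v' x) -> F v = F v') ->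
  (forall a w w' x, SW w -> SW w' -> U x -> P (fun x => a * w x + w' x) x = a * P w x + P w' x) ->
  (forall v, SV v -> exists2 w, SW w & forall x, U x -> P w x = v x) ->
  (forall w, SW w -> (forall v, SV v -> B w v = 0) -> forall x, U x -> P w x = 0) ->
  exists2 u, SW u & forall v, SV v -> B u v = F v.
Proof.
move=> lV lW hN Bl Br Be Fl Fe Pl Ps Pi.
have [n [vv [hv iv sp]]] := max_family hN.
have /choice[ww hww] : forall i, exists w, SW w /\ forall x, U x -> P w x = vv i x.
  by move=> i; have [w h1 h2] := Ps _ (hv i); exists w.
have hw i : SW (ww i) by have [] := hww i.
have tot w (L : (T -> K) -> K) : SW w ->
   (forall a v v', SV v -> SV v' -> L (fun x => a * v x + v' x) = a * L v + L v') ->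
   (forall v v', SV v -> SV v' -> (forall x, U x -> v x = v' x) -> L v = L v') ->
   (forall b, B w (vv b) = L (vv b)) -> forall v, SV v -> B w v = L v.
  move=> Sw Ll Le h v Sv; have [c hc] := sp v Sv.
  have Sc := lincl_sum c lV hv.
  rewrite (Be _ _ _ Sw Sv Sc hc) (Le _ _ Sv Sc hc).
  rewrite (linear_sum (L := B w) c lV _ hv); last by move=> a v1 v2 s1 s2; exact: Br.
  by rewrite (linear_sum (L := L) c lV Ll hv); apply: eq_bigr => i _; rewrite h.
have Bs (r : 'I_n -> K) v : SV v -> B (fun x => \sum_(i < n) r i * ww i x) v = \sum_(i < n) r i * B (ww i) v.
  by move=> Sv; rewrite (linear_sum (L := fun w => B w v) r lW _ hw)// => a w1 w2 s1 s2; exact: Bl.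
pose A : 'M[K]_n := \matrix_(i, j) B (ww i) (vv j).
have fA : row_free A.
  apply: inj_row_free => r rA.
  pose w x := \sum_(i < n) r 0 i * ww i x.
  have Sw : SW w := lincl_sum _ lW hw.
  have Bw v : SV v -> B w v = 0.
    apply: (tot w (fun=> 0)) => //; first by move=> *; rewrite mulr0 addr0.
    move=> b; rewrite /w Bs//; have := congr1 (fun m : 'rV_n => m 0 b) rA; rewrite !mxE => E; rewrite -[RHS]E.
    by apply: eq_bigr => i _; rewrite mxE.
  have Pw := Pi w Sw Bw.
  apply/rowP => i; rewrite mxE; apply: (iv (fun i => r 0 i)) => x Ux.
  rewrite -[RHS](Pw x Ux) /w (linear_sum (L := fun w => P w x) _ lW _ hw); last by move=> a w1 w2 s1 s2; exact: Pl.
  by apply: eq_bigr => j _; have [_ ->] := hww j.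
have uA : A \in unitmx by rewrite -row_free_unit.
have [r rA] : exists r : 'rV_n, r *m A = \row_j F (vv j).
  by exists ((\row_j F (vv j)) *m invmx A); rewrite mulmxKV.
exists (fun x => \sum_(i < n) r 0 i * ww i x); first exact: lincl_sum.
apply: tot => //; first exact: lincl_sum.
move=> b; rewrite Bs//.
move/(congr1 (fun m : 'rV_n => m 0 b)): rA; rewrite !mxE => <-.
by apply: eq_bigr => i _; rewrite mxE.
Qed.
End Solver.

Section Dependent.
Variable R : realType.
Variables (M : mesh R) (k : nat).

(** A piecewise polynomial is determined by its coefficients, a vector of
    length N; more than N such vectors are dependent. *)
Lemma pwp_dependent n (vv : 'I_n -> R * R -> R) :
  (#|{: 'I_(ntri M) * 'I_k.+1 * 'I_k.+1}| < n)%N -> (forall i, pwp M k (vv i)) -> ~ lin_indep (Umesh M) vv.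
Proof.
move=> hn hv iv; pose J : finType := ('I_(ntri M) * 'I_k.+1 * 'I_k.+1)%type.
have hJ : (#|J| < n)%N by [].
have : forall p : 'I_n * 'I_(ntri M), exists c : nat -> nat -> R, forall x, tri p.2 x ->
   vv p.1 x = \sum_(i < k.+1) \sum_(j < k.+1 - i) c i j * x.1 ^+ i * x.2 ^+ j.
  by move=> [a t]; have [q [c hc] e] := hv a t; exists c => x /e ->.
move=> /choice[c hc].
pose A : 'M[R]_(n, #|J|) := \matrix_(a, l) (let p : J := enum_val l in c (a, p.1.1) p.1.2 p.2).
suff fA : row_free A by move: (rank_leq_col A); rewrite (eqP fA) leqNgt hJ.
apply: inj_row_free => r rA; apply/rowP => a; rewrite mxE; move: a.
apply: (iv (fun a => r 0 a)) => x [t tx].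
have E (i j : 'I_k.+1) : \sum_a r 0 a * c (a, t) i j = 0.
  have := congr1 (fun m : 'rV_#|J| => m 0 (enum_rank ((t, i, j) : J))) rA; rewrite !mxE => h; rewrite -[RHS]h.
  by apply: eq_bigr => a _; rewrite mxE enum_rankK.
under eq_bigr => a _ do rewrite (hc (a, t) x tx) mulr_sumr.
rewrite exchange_big big1// => i _.
under eq_bigr => a _ do rewrite mulr_sumr.
rewrite exchange_big big1// => j _ /=.
have jk : (j < k.+1)%N by rewrite (leq_trans (ltn_ord j))// leq_subr.
apply: (@etrans _ _ ((\sum_a r 0 a * c (a, t) i j) * (x.1 ^+ i * x.2 ^+ j))).
  by rewrite mulr_suml; apply: eq_bigr => a _; rewrite !mulrA.
by rewrite (E i (Ordinal jk)) mul0r.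
Qed.
End Dependent.

(** * The bilinear and linear forms on piecewise polynomials *)
Section Forms.
Variable R : realType.
Local Notation rT := (measurableTypeR R).
Local Notation area := (@area R).
Implicit Types (x y z : R * R) (f g v w u : R * R -> R).
Variable M : mesh R.
Hypothesis cM : conforming M.
Local Notation nd := (conf_nd cM).
Local Notation int_cells := (int_cells M).
Local Notation bmeas := (bmeas M).
Local Notation pwp := (pwp M).
Variable k : nat.

Lemma dx_ext w u x : (forall y, Umesh M y -> w y = u y) -> cells M x -> dx w x = dx u x /\ dy w x = dy u x.
Proof.
move=> e /cellsP[i ox].
have E z : 'D_z w x = 'D_z u x.
  by apply: near_eq_derive; apply: (otri_near cM ox) => y ty; apply: e; exists i.
by rewrite /dx /dy !E.
Qed.

Lemma cells_Umesh x : cells M x -> Umesh M x.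
Proof. by move=> Ux; apply: Omegah_U; exact: cells_Omegah. Qed.

Section Ah.
Variables (nu : R) (b : R * R -> R * R).
Hypothesis cb : continuous (fst \o b) /\ continuous (snd \o b).

Definition ah_integrand w v x : R := nu * (dx w x * dx v x + dy w x * dy v x)
     + ((b x).1 * dx w x + (b x).2 * dy w x) * v x.

Lemma ah_cells w v : ah nu b M w v = int_cells (ah_integrand w v).
Proof. exact: int_Omegah. Qed.

Lemma bmeas_ah_integrand w v : pwp k w -> pwp k v -> bmeas (ah_integrand w v).
Proof.
move=> hw hv.
have b1 : bmeas (fun x => (b x).1) by exact: (bmeas_continuous cM cb.1).
have b2 : bmeas (fun x => (b x).2) by exact: (bmeas_continuous cM cb.2).
have h1 := bmeasM (bmeas_dx cM hw) (bmeas_dx cM hv); have h2 := bmeasM (bmeas_dy cM hw) (bmeas_dy cM hv).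
have h3 := bmeasM (bmeas_cst M nu) (bmeasD h1 h2).
have h4 := bmeasM (bmeasD (bmeasM b1 (bmeas_dx cM hw)) (bmeasM b2 (bmeas_dy cM hw))) (bmeas_pwp cM hv).
exact: (bmeasD h3 h4).
Qed.

Lemma dxZD (a : R) w u x : pwp k w -> pwp k u -> cells M x ->
  dx (fun x => a * w x + u x) x = a * dx w x + dx u x /\ dy (fun x => a * w x + u x) x = a * dy w x + dy u x.
Proof.
move=> hw hu Ux; have [e1 e2] := dxD cM (pwpZ a hw) hu Ux; have [e3 e4] := dxZ cM a hw Ux.
by rewrite e1 e2 e3 e4.
Qed.

Lemma int_cells_lin (a : R) f g h : bmeas f -> bmeas g -> (forall x, cells M x -> h x = a * f x + g x) -> int_cells h = a * int_cells f + int_cells g.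
Proof.
move=> hf hg e; apply: (etrans (int_cells_ext e)).
apply: (etrans (int_cellsD cM (bmeasM (bmeas_cst M a) hf) hg)).
by congr (_ + _); exact: (int_cellsZ cM a hf).
Qed.

Lemma ah_linl (a : R) w w' v : pwp k w -> pwp k w' -> pwp k v ->
  ah nu b M (fun x => a * w x + w' x) v = a * ah nu b M w v + ah nu b M w' v.
Proof.
move=> h1 h2 h3; apply: (etrans (ah_cells _ _)).
apply: (etrans (int_cells_lin (a := a) (bmeas_ah_integrand h1 h3) (bmeas_ah_integrand h2 h3) _)); last by rewrite -!ah_cells.
by move=> x Ux; have [e1 e2] := dxZD a h1 h2 Ux; rewrite /ah_integrand e1 e2; clear; ring.
Qed.

Lemma ah_linr (a : R) w v v' : pwp k w -> pwp k v -> pwp k v' ->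
  ah nu b M w (fun x => a * v x + v' x) = a * ah nu b M w v + ah nu b M w v'.
Proof.
move=> h1 h2 h3; apply: (etrans (ah_cells _ _)).
apply: (etrans (int_cells_lin (a := a) (bmeas_ah_integrand h1 h2) (bmeas_ah_integrand h1 h3) _)); last by rewrite -!ah_cells.
by move=> x Ux; have [e1 e2] := dxZD a h2 h3 Ux; rewrite /ah_integrand e1 e2; clear; ring.
Qed.

Lemma ah_extr w v v' : (forall x, Umesh M x -> v x = v' x) -> ah nu b M w v = ah nu b M w v'.
Proof.
move=> e; apply: (etrans (ah_cells _ _)); apply: esym; apply: (etrans (ah_cells _ _)); apply: int_cells_ext => x Ux.
by have [e1 e2] := dx_ext e Ux; rewrite /ah_integrand e1 e2 (e x)//; exact: cells_Umesh.
Qed.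
End Ah.

Section Fh.
Variables (Omega : set (R * R)) (fe : R * R -> R).
Hypothesis oO : open Omega.
Hypothesis hfe : L2 (Omega `|` Omegah M) fe.

(** On the bounded set cells a square-integrable function is integrable, by
    |t| <= 1 + t^2. *)
Lemma L2_int v : bmeas v -> area.-integrable (cells M) (fun x => (fe x * v x)%:E).
Proof.
move=> [mv [B hB]]; have [mf i2] := hfe.
have mU := measurable_cells M.
have mO : measurable (Omega `|` Omegah M : set (rT * rT)).
  by apply: measurableU; apply: open_measurable2 => //; exact: open_interior.
have sU : cells M `<=` (Omega `|` Omegah M : set (rT * rT)) by move=> x Ux; right; exact: cells_Omegah.
have mfU : measurable_fun (cells M) (fe : rT * rT -> rT) by exact: measurable_funS mf.
have j2 : area.-integrable (cells M) (fun x => (fe x ^+ 2)%:E) by exact: (integrableS mO mU sU i2).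
have j1 : area.-integrable (cells M) (fun x => (1 + fe x ^+ 2)%:E).
  have i1 := bmeas_integrable cM (bmeas_cst M (1 : R)).
  by have := integrableD mU i1 j2; apply: eq_integrable => // x _; rewrite /= EFinD.
have j3 : area.-integrable (cells M) (fun x => B%:E * (1 + fe x ^+ 2)%:E)%E by exact: integrableZl.
apply: (le_integrable mU _ _ j3).
  by apply/measurable_EFinP; exact: measurable_funM.
move=> x Ux; rewrite -EFinM /= lee_fin !normrM.
have B0 : 0 <= B by exact: (le_trans (normr_ge0 _) (hB x Ux)).
rewrite (ger0_norm B0) mulrC; apply: ler_pM => //; first exact: hB.
have p : 0 <= 1 + fe x ^+ 2 by rewrite addr_ge0// sqr_ge0.
rewrite (ger0_norm p) -(real_normK (num_real (fe x))).
by move: (`|fe x|) => t; have := sqr_ge0 (t - 1); nra.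
Qed.

Lemma Fh_lin (a : R) v v' : pwp k v -> pwp k v' ->
  Fh fe M (fun x => a * v x + v' x) = a * Fh fe M v + Fh fe M v'.
Proof.
move=> h1 h2; have mU := measurable_cells M; rewrite /Fh !(int_Omegah cM).
have i1 := L2_int (bmeas_pwp cM h1); have i2 := L2_int (bmeas_pwp cM h2).
have i3 : area.-integrable (cells M) (fun x => (a * (fe x * v x))%:E).
  by have := integrableZl mU a i1; apply: eq_integrable => // x _; rewrite /= EFinM.
have e1 := RintegralZl a mU i1; have e2 := RintegralD mU i3 i2.
apply: (etrans _ (etrans e2 _)); last by congr (_ + _).
by apply: eq_Rintegral => x _; rewrite mulrDr mulrCA.
Qed.

Lemma Fh_ext v v' : (forall x, Umesh M x -> v x = v' x) -> Fh fe M v = Fh fe M v'.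
Proof.
move=> e; apply: eq_Rintegral => x /set_mem Ox; by rewrite (e x)//; exact: Omegah_U.
Qed.
End Fh.
End Forms.

(** * Existence, uniqueness and inf-sup bound on one mesh *)
Lemma stab_arith (R : realType) (nu p q : R) : 0 < nu -> nu / 2 * (p * q) <= 0 -> 2^-1 * p <= q -> 0 <= p -> p = 0.
Proof.
move=> nu0 h1 h2 g0.
apply/eqP; rewrite eq_le g0 andbT leNgt; apply/negP => p0.
have q0 : 0 < q by apply: lt_le_trans h2; rewrite mulr_gt0// invr_gt0.
have : 0 < nu / 2 * (p * q) by rewrite mulr_gt0 ?mulr_gt0// ?divr_gt0.
by rewrite ltNge h1.
Qed.

Lemma quotient_arith (R : realType) (c p q a : R) : 0 < p -> 0 < q -> c * (p * q) <= a -> c <= a / (p * q).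
Proof. by move=> p0 q0 h; rewrite ler_pdivlMr// mulr_gt0. Qed.

Section Wellposed.
Variable R : realType.
Implicit Types (x y z : R * R) (f g v w u : R * R -> R).
Variable M : mesh R.
Hypothesis cM : conforming M.
Local Notation nd := (conf_nd cM).
Variables (k : nat) (Omega : set (R * R)).
Hypothesis k0 : (0 < k)%N.
Hypothesis uniqSh : forall (i : 'I_(ntri M)) j j', in_Sh i j -> in_Sh i j' -> j = j'.
Local Notation trial := (trial M k Omega).
Local Notation test := (test M k Omega).
Local Notation to_test := (to_test M k).

Lemma bubble_sum_lin (i : 'I_(ntri M)) j (a : R) c c' x :
  bubble_sum k i j (fun m => a * c m + c' m) x = a * bubble_sum k i j c x + bubble_sum k i j c' x.
Proof.
rewrite /bubble_sum mulr_sumr -big_split; apply: eq_bigr => m _ /=.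
by rewrite mulrDl mulrA.
Qed.

Lemma to_test_lin (a : R) w w' x : Umesh M x ->
  to_test (fun y => a * w y + w' y) x = a * to_test w x + to_test w' x.
Proof.
move=> Ux; rewrite !to_testE//; case: (Ux) => i tx; have [[j Sh]|nSh] := Sh_dec i.
  by rewrite !(edge_corr_Sh cM k uniqSh _ Sh tx) bubble_sum_lin; ring.
by rewrite !(edge_corr_nSh cM k _ nSh tx); ring.
Qed.

Lemma to_test_zero w : (forall x, Umesh M x -> w x = 0) -> forall x, Umesh M x -> to_test w x = 0.
Proof.
move=> w0 x Ux; rewrite to_testE// w0// sub0r; case: (Ux) => i tx; have [[j Sh]|nSh] := Sh_dec i.
  rewrite (edge_corr_Sh cM k uniqSh _ Sh tx) /bubble_sum big_nat big1 ?oppr0// => m hm.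
  have mk : (m <= k)%N by case/andP: hm => _ /ltnW.
  by rewrite w0 ?mul0r//; exists i; exact: (tri_node cM i j mk k0).
by rewrite (edge_corr_nSh cM k _ nSh tx) oppr0.
Qed.

Lemma pwp0 : pwp M k (fun=> 0).
Proof. by move=> i; exists (fun=> 0) => //; exact: poly_le_cst. Qed.

Lemma trial0 : trial (fun=> 0).
Proof.
split => //; first exact: pwp0.
by move=> i j m P _ _ _; rewrite (poly_expr_eq cM (poly_le_cst k 0)).
Qed.

Lemma test0 : test (fun=> 0).
Proof. by split => //; exact: pwp0. Qed.

Lemma lincl_trial : lincl trial.
Proof. by split; [exact: trial0|move=> a v w hv hw; exact: (trialD cM (trialZ cM a hv) hw)]. Qed.

Lemma lincl_test : lincl test.
Proof. by split; [exact: test0|move=> a v w hv hw; exact: (testD (testZ a hv) hw)]. Qed.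

Lemma grad_norm_zero : grad_norm M (fun=> 0) = 0.
Proof.
apply/eqP; rewrite -sqrf_eq0; apply/eqP; apply: (etrans (grad_norm_sum cM pwp0)).
by apply: big1 => i _; exact: tri_energy0.
Qed.

Variables (nu : R) (b : R * R -> R * R).
Hypothesis nu0 : 0 < nu.
Hypothesis cb : continuous (fst \o b) /\ continuous (snd \o b).
Hypothesis stab : forall w, trial w ->
  nu / 2 * (grad_norm M w * grad_norm M (to_test w)) <= ah nu b M w (to_test w) /\
  2^-1 * grad_norm M w <= grad_norm M (to_test w).
Hypothesis definite : forall w, trial w -> grad_norm M w = 0 -> forall x, Umesh M x -> w x = 0.
Hypothesis surj : forall v, test v -> exists2 w, trial w & forall x, Umesh M x -> to_test w x = v x.

Lemma trial_pwp w : trial w -> pwp M k w. Proof. by case. Qed.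
Lemma test_pwp v : test v -> pwp M k v. Proof. by case. Qed.

(** Test with to_test w, which gives a zero gradient. *)
Lemma ah_inj w : trial w -> (forall v, test v -> ah nu b M w v = 0) -> forall x, Umesh M x -> w x = 0.
Proof.
move=> hw h; apply: definite => //; have [h1 h2] := stab hw.
rewrite (h _ (test_to_test cM uniqSh k0 hw)) in h1.
exact: (stab_arith nu0 h1 h2 (grad_norm_ge0 M w)).
Qed.

(** The supremum is at least the value at to_test w.  This function is nonzero:
    its gradient norm is at least half of the one of w, which is positive. *)
Lemma infsup w : trial w -> nonzero M w ->
  ((nu / 2)%:E <= ereal_sup [set (ah nu b M w v / (grad_norm M w * grad_norm M v))%:E
                      | v in [set v | Vh k Omega M v /\ nonzero M v]])%E.
Proof.
move=> hw [x0 Ox0 wx0]; have [h1 h2] := stab hw.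
have vV := test_to_test cM uniqSh k0 hw.
have g0 : 0 < grad_norm M w.
  rewrite lt_neqAle grad_norm_ge0 andbT eq_sym; apply: contra wx0 => /eqP/(definite hw) ->//.
  exact: Omegah_U.
have half0 : 0 < 2^-1 :> R by rewrite invr_gt0.
have v0 : 0 < grad_norm M (to_test w) := lt_le_trans (mulr_gt0 half0 g0) h2.
have mem : [set v | Vh k Omega M v /\ nonzero M v] (to_test w).
  split; first by apply/(VhE cM).
  apply: contrapT => nz; move: v0; suff -> : grad_norm M (to_test w) = 0 by rewrite ltxx.
  have vp := test_pwp vV; rewrite (grad_norm_ext cM vp pwp0) ?grad_norm_zero// => x Ux.
  apply: contrapT => /eqP vx; have [Ox|nO] := pselect (Omegah M x); first by apply: nz; exists x.
  by case: vV => _ vG _; move/eqP: vx; apply; apply: vG; apply/(GammahP nd).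
apply: le_trans (ereal_sup_ubound _); last by exists (to_test w); [exact: mem|reflexivity].
by rewrite lee_fin; exact: (quotient_arith g0 v0 h1).
Qed.

Lemma wellposed fe : open Omega -> L2 (Omega `|` Omegah M) fe ->
  exists2 u, discrete_solution k Omega nu b fe M u &
    forall u', discrete_solution k Omega nu b fe M u' -> forall x, Omegah M x -> u' x = u x.
Proof.
move=> oO hfe.
have [u hu eu] : exists2 u, trial u & forall v, test v -> ah nu b M u v = Fh fe M v.
  apply: (@solve_abstract R (R * R)%type (Umesh M) test trial to_test (ah nu b M) (Fh fe M) #|{: 'I_(ntri M) * 'I_k.+1 * 'I_k.+1}|).
  - exact: lincl_test.
  - exact: lincl_trial.
  - by move=> n hn vv hv; apply: (pwp_dependent hn) => i; exact: (test_pwp (hv i)).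
  - by move=> a w w' v /trial_pwp h1 /trial_pwp h2 /test_pwp h3; exact: (ah_linl cM nu cb a h1 h2 h3).
  - by move=> a w v v' /trial_pwp h1 /test_pwp h2 /test_pwp h3; exact: (ah_linr cM nu cb a h1 h2 h3).
  - by move=> w v v' _ _ _; exact: (ah_extr cM).
  - by move=> a v v' /test_pwp h1 /test_pwp h2; exact: (Fh_lin cM oO hfe a h1 h2).
  - by move=> v v' _ _; exact: Fh_ext.
  - by move=> a w w' x _ _; exact: to_test_lin.
  - exact: surj.
  - by move=> w hw h; apply: to_test_zero; exact: (ah_inj hw h).
exists u; first by split; [apply/(WhE cM)|move=> v /(VhE cM); exact: eu].
move=> u' [/(WhE cM) hu' eu'] x Ox.
have hd : trial (fun x => -1 * u x + u' x) by apply: lincl_trial.2.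
have := ah_inj hd _ (Omegah_U Ox); rewrite mulN1r addrC => H; apply/eqP; rewrite -subr_eq0; apply/eqP; apply: H.
move=> v hv; rewrite (ah_linl cM nu cb (-1) (trial_pwp hu) (trial_pwp hu') (test_pwp hv)).
by rewrite (eu v hv) (eu' v (proj2 (VhE cM k Omega v) hv)) mulN1r addNr.
Qed.
End Wellposed.

(** * Constants uniform in the mesh *)
(** The two coordinates and their opposites are linear functionals, bounded by D
    at the boundary vertices. *)
Lemma box_of_bdry (R : realType) (M : mesh R) (cM : conforming M) (G : set (R * R)) (D : R) :
  G `<=` box D -> (forall (i : 'I_(ntri M)) j, Gammah M (vtx i j) -> G (vtx i j)) ->
  Umesh M `<=` box D.
Proof.
move=> GD vG x Ux; have hB (i : 'I_(ntri M)) j (h : Gammah M (vtx i j)) := (boxP D _).1 (GD _ (vG i j h)).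
have H (d : R * R) : d != 0 -> (forall (i : 'I_(ntri M)) j, Gammah M (vtx i j) -> d.1 * (vtx i j).1 + d.2 * (vtx i j).2 <= D) ->
  d.1 * x.1 + d.2 * x.2 <= D by move=> d0 h; exact: (Umesh_halfplane cM d0 h Ux).
have n1 (a : R) : a != 0 -> (a, 0) != 0 :> R * R by move=> h; apply: contra h => /eqP[->].
have n2 (a : R) : a != 0 -> (0, a) != 0 :> R * R by move=> h; apply: contra h => /eqP[->].
have m0 : (-1 : R) != 0 by rewrite oppr_eq0 oner_eq0.
have a1 := H _ (n1 1 (oner_neq0 _)); have a2 := H _ (n1 (-1) m0).
have a3 := H _ (n2 1 (oner_neq0 _)); have a4 := H _ (n2 (-1) m0).
rewrite /= !mul1r !mul0r ?addr0 ?add0r ?mulN1r in a1 a2 a3 a4.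
apply/boxP; rewrite !ler_norml; split; apply/andP; split.
- rewrite lerNl; apply: a2 => i j /hB[]; rewrite /= mul0r addr0 mulN1r lerNl ler_norml => /andP[]//.
- by apply: a1 => i j /hB[]; rewrite /= mul0r addr0 mul1r ler_norml => /andP[].
- rewrite lerNl; apply: a4 => i j /hB[_]; rewrite /= mul0r add0r mulN1r lerNl ler_norml => /andP[]//.
- by apply: a3 => i j /hB[_]; rewrite /= mul0r add0r mul1r ler_norml => /andP[].
Qed.

Lemma le_of_small_shift (R : realType) (q s th p w : R) : 0 <= q -> 0 <= s -> 0 <= th -> s * (1 + q) <= th ->
  0 <= p -> 0 <= w -> p ^+ 2 <= q * s ^+ 2 * w ^+ 2 -> p <= th * w.
Proof.
move=> q0 s0 th0 h p0 w0 e.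
have tw : 0 <= th * w by rewrite mulr_ge0.
rewrite -(@ler_pXn2r _ 2)// ?nnegrE//; apply: le_trans e _; rewrite exprMn.
apply: ler_wpM2r; first exact: sqr_ge0.
have h2 : (s * (1 + q)) ^+ 2 <= th ^+ 2.
  by rewrite ler_sqr ?nnegrE// mulr_ge0// addr_ge0.
apply: le_trans h2; rewrite exprMn mulrC; apply: ler_wpM2l; first exact: sqr_ge0.
have := sqr_ge0 q; nra.
Qed.

Theorem proposition3p3 (R : realType) (k : nat) (Omega : set (R * R)) (nu : R)
    (b : R * R -> R * R) (f : R * R -> R) (Th : set (mesh R))
    (hk : (2 <= k)%N)
    (hOmega : domain Omega)
    (hGamma : smooth_boundary k Omega)
    (hnu : 0 < nu)
    (hb : Cn k.-1 (fst \o b) /\ Cn k.-1 (snd \o b))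
    (hdiv : solenoidal b)
    (hf : sobolev k.-1 Omega f)
    (hreg : regular_family Th)
    (hTh : forall M, Th M -> admissible Omega M) :
  exists2 h0 : R, 0 < h0 &
    (forall M, Th M -> meshsize M <= h0 ->
       forall fe : R * R -> R,
         (forall x, Omega x -> fe x = f x) -> L2 (Omega `|` Omegah M) fe ->
         exists2 u, discrete_solution k Omega nu b fe M u &
           forall u', discrete_solution k Omega nu b fe M u' ->
             forall x, Omegah M x -> u' x = u x) /\
    (exists2 alpha : R, 0 < alpha &
       forall M, Th M -> meshsize M <= h0 ->
         forall w, Wh k Omega M w -> nonzero M w ->
           (alpha%:E <=
            ereal_sup [set (ah nu b M w v / (grad_norm M w * grad_norm M v))%:E
                      | v in [set v | Vh k Omega M v /\ nonzero M v]])%E).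
Proof.
have k0 : (0 < k)%N by case: k hk {hGamma hb hf}.
have [n kn] : exists n, k.-1 = n.+1 by exists k.-2; move: hk; case: (k) => [//|[//|m]].
(* As k >= 2, the field b is at least C^1. *)
rewrite kn in hb.
have cb : continuous (fst \o b) /\ continuous (snd \o b).
  by split; [exact: Cn_continuous hb.1|exact: Cn_continuous hb.2].
have [oO _ _ bO] := hOmega.
have [_ [D0 hD0]] := bdry_compact bO.
pose D := `|D0|; have D_ge0 : 0 <= D by exact: normr_ge0.
have hD : bdry Omega `<=` box D.
  move=> x /hD0/boxP[x1 x2]; apply/boxP; have l := ler_norm D0.
  by split; apply: (le_trans _ l).
have [B1 B10 hB1] := continuous_box_bounded D cb.1.
have [B2 B20 hB2] := continuous_box_bounded D cb.2.
pose B := B1 + B2; have B_ge0 : 0 <= B by rewrite addr_ge0 ?ltW.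
have hB x : box D x -> `|(b x).1| <= B /\ `|(b x).2| <= B.
  move=> bx; have h1 := hB1 _ bx; have h2 := hB2 _ bx.
  by split; [apply: (le_trans h1); rewrite lerDl ltW|apply: (le_trans h2); rewrite lerDr ltW].
have [sigma hsig] := hreg.
pose sig := 2 * `|sigma|; have sig0 : 0 <= sig by rewrite mulr_ge0.
have [C C0 locC] := local_estimate R k0.
have [s0 s00 sys] := shifted_interpolation R k0.
pose den := 2 * nu + 4 * B * D.
have den0 : 0 < den.
  by rewrite ltr_wpDr ?mulr_gt0// !mulr_ge0.
(* The relative size allowed for the gradient of w - to_test w. *)
pose th := Num.min 2^-1 (nu / 2 / den).
have th0 : 0 < th by rewrite lt_min invr_gt0 ltr0n/= !divr_gt0.
have th1 : th * den <= nu / 2 by rewrite -ler_pdivlMr// ge_min lexx orbT.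
have th2 : 2^-1 <= 1 - th.
  have : th <= 2^-1 by rewrite ge_min lexx.
  by clear; lra.
pose q := C * sig ^+ 2; have q0 : 0 <= q by rewrite mulr_ge0 ?sqr_ge0 ?ltW.
have q10 : 0 < 1 + q by rewrite ltr_pwDl.
(* The third bound makes q s^2 at most th^2, the second makes to_test onto. *)
pose s := Num.min 1 (Num.min s0 (th / (1 + q))).
have sp : 0 < s by rewrite !lt_min ltr01 s00/= divr_gt0.
have s1 : s <= 1 by rewrite ge_min lexx.
have ss0 : s <= s0 by rewrite !ge_min lexx !orbT.
have sth : s * (1 + q) <= th by rewrite -ler_pdivlMr// !ge_min lexx !orbT.
have s01 : 0 <= s <= 1 by rewrite ltW.
have [h0 h00 nodes] := mesh_nodes hk hOmega hGamma sig0 sp.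
exists h0 => //.
have good M : Th M -> meshsize M <= h0 ->
  [/\ conforming M, forall (i : 'I_(ntri M)) j j', in_Sh i j -> in_Sh i j' -> j = j',
   forall w, trial M k Omega w ->
     nu / 2 * (grad_norm M w * grad_norm M (to_test M k w)) <= ah nu b M w (to_test M k w) /\
     2^-1 * grad_norm M w <= grad_norm M (to_test M k w),
   forall w, trial M k Omega w -> grad_norm M w = 0 -> forall x, Umesh M x -> w x = 0 &
   forall v, test M k Omega v -> exists2 w, trial M k Omega w & forall x, Umesh M x -> to_test M k w x = v x].
  move=> hM mh; have [[cM vG uS _ _] _] := hTh M hM.
  have shape : shape_ok sig M by move=> i l l'; exact: (shape_reg cM (hsig M hM i)).
  have shifts := nodes M cM shape vG mh.
  have UD : Umesh M `<=` box D := box_of_bdry cM hD vG.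
  have hUx x : cells M x -> `|x.1| <= D by move=> /(cells_Umesh cM)/UD/boxP[].
  have hUb x : cells M x -> `|(b x).1| <= B /\ `|(b x).2| <= B.
    by move=> /(cells_Umesh cM)/UD; exact: hB.
  split => //.
  - move=> w hw.
    have E := to_test_energy cM k0 uS s01 shape shifts (C := q * s ^+ 2) (mulr_ge0 q0 (sqr_ge0 s))
      (fun i j p sg ld => proj1 (locC M cM i j p sg s sig sig0 ld)) hw.
    have E' := le_of_small_shift q0 (ltW sp) (ltW th0) sth (grad_norm_ge0 M _) (grad_norm_ge0 M w) E.
    have vV := test_to_test cM uS k0 hw; have [v1 v2 _] := vV.
    have [h1 h2] := infsup_of_close cM hnu hb hdiv (trial_pwp hw) v1 v2 hUx hUb D_ge0 B_ge0 (ltW th0) th1 E'.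
    split; first exact: h1.
    exact: (le_trans (ler_wpM2r (grad_norm_ge0 M w) th2) h2).
  - move=> w hw.
    exact: (trial_definite cM k0 uS s01 shape shifts
      (fun i j p sg ld => proj2 (locC M cM i j p sg s sig sig0 ld)) hUx hw).
  - move=> v hv; apply: (to_test_surj cM k0 uS shifts ss0 _ hv) => i j sg hsg y.
    exact: (sys M cM i j s sg ss0 s1 hsg y).
split.
  move=> M hM mh fe _ hfe; have [cM uS stab def surj] := good M hM mh.
  exact: (wellposed cM k0 uS hnu cb stab def surj oO hfe).
exists (nu / 2); first by rewrite divr_gt0.
move=> M hM mh w hw nz; have [cM uS stab def _] := good M hM mh.
by apply: (infsup cM k0 uS stab def _ nz); apply/(WhE cM).
Qed.
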